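(* Let $p>1$, let $\Omega\subset\mathbb{R}^n$ be a smooth, convex, bounded domain whose boundary has mean curvature bounded from below by a positive constant at each point, and let $g$ be a sufficiently smooth function on $\overline\Omega$. For $\varepsilon>0$ let $u^\varepsilon$ be the classical solution of the regularized Cauchy-Dirichlet problem $$\begin{cases}u_t=\left(\delta_{ij}+(p-2)\dfrac{u_iu_j}{\varepsilon^2+|Du|^2}\right)u_{ij} & \text{in }\Omega\times(0,\infty),\\ u(x,0)=g(x), & x\in\Omega,\\ u(x,t)=g(x), & (x,t)\in\partial\Omega\times(0,\infty),\end{cases}$$ and let $v^\varepsilon(x)=\lim_{t\to\infty}u^\varepsilon(x,t)$ (uniform limit on $\overline\Omega$). Then, as $\varepsilon\to0$, $v^\varepsilon$ converges uniformly to a function $v\in W^{1,p}(\Omega)$, where $v$ is a $p$-harmonic function in $\Omega$ having boundary values $g$. Thus $$\lim_{\varepsilon\to0}\lim_{t\to\infty}u^\varepsilon(x,t)=\lim_{\varepsilon\to0}v^\varepsilon(x)=v(x).$$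
   Context: $D$ is the spatial gradient, $u_i=\partial u/\partial x_i$, $u_{ij}=\partial^2u/\partial x_i\partial x_j$, and repeated indices are summed. The solutions $u^\varepsilon$ are continuous on $\overline\Omega\times[0,\infty)$. Mean curvature is taken with the sign convention in which convex domains have nonnegative mean curvature. A function is $p$-harmonic in $\Omega$ if it is a $W^{1,p}_{loc}(\Omega)$ weak solution of $\operatorname{div}(|Dv|^{p-2}Dv)=0$. It is known that, for each $\varepsilon>0$, $u^\varepsilon(\cdot,t)$ converges uniformly on $\overline\Omega$ as $t\to\infty$ to a Lipschitz function $v^\varepsilon\in C^\infty(\Omega)$ with bounded gradient satisfying $\operatorname{div}\big((\varepsilon^2+|Dv^\varepsilon|^2)^{p/2-1}Dv^\varepsilon\big)=0$ in $\Omega$ and $v^\varepsilon=g$ on $\partial\Omega$. *)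

(* Defs.v *)
From HB Require Import structures.
From mathcomp Require Import all_boot all_order all_algebra.
From mathcomp Require Import all_classical all_reals all_analysis.

Set Implicit Arguments.
Unset Strict Implicit.
Unset Printing Implicit Defensive.
Import Order.TTheory GRing.Theory Num.Theory.
Import numFieldNormedType.Exports.

Local Open Scope classical_set_scope.
Local Open Scope ring_scope.

Definition measure_rV_display : measure_display.
Proof. by constructor. Qed.

Section measurable_rV.
Variables (R : realType) (n : nat).

Definition rV_coord (i : 'I_n) (x : 'rV[R]_n) : R := x ord0 i.

Let rV_measurable := g_sigma_preimage rV_coord.

Let rV_set0 : rV_measurable set0.
Proof. exact: sigma_algebra0. Qed.

Let rV_setC A : rV_measurable A -> rV_measurable (~` A).
Proof. exact: sigma_algebraC. Qed.

Let rV_bigcup (F : (set 'rV[R]_n)^nat) :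
  (forall i, rV_measurable (F i)) -> rV_measurable (\bigcup_i F i).
Proof. exact: sigma_algebra_bigcup. Qed.

HB.instance Definition _ := @isMeasurable.Build measure_rV_display
  'rV[R]_n rV_measurable rV_set0 rV_setC rV_bigcup.

Lemma measurable_rV_coord (i : 'I_n) : measurable_fun setT (rV_coord i).
Proof.
move=> _ Y mY; rewrite setTI; apply: sub_sigma_algebra => /=.
rewrite -bigcup_seq/=; exists i => /=; first by rewrite mem_index_enum.
by exists Y => //; rewrite setTI.
Qed.

Lemma measurable_fun_rVP d (T : measurableType d) (f : T -> 'rV[R]_n) :
  (forall i, measurable_fun setT (rV_coord i \o f)) -> measurable_fun setT f.
Proof.
move=> mf _ A mA.
suff : g_sigma_preimage (fun i => rV_coord i \o f) `<=` measurable.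
  by rewrite g_sigma_preimage_comp; apply; exists A.
apply: smallest_sub; first exact: sigma_algebra_measurable.
rewrite -bigcup_seq; apply: bigcup_sub => i _ B [C mC <-].
exact: mf.
Qed.

End measurable_rV.

Section lebesgue_step.
Variables (R : realType) (n : nat).

Definition rV_cons (z : R * 'rV[R]_n) : 'rV[R]_n.+1 :=
  row_mx (z.1%:M : 'rV_1) z.2.

Lemma measurable_rV_cons : measurable_fun setT rV_cons.
Proof.
apply: measurable_fun_rVP => i; case: (@split_ordP 1 n i) => j ->.
- have -> : rV_coord (lshift n j) \o rV_cons = fst.
    by apply/funext => z /=; rewrite /rV_coord (@row_mxEl _ _ 1 n) mxE [j]ord1.
  exact: measurable_fst.
- have -> : rV_coord (rshift 1 j) \o rV_cons = rV_coord j \o snd.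
    by apply/funext => z /=; rewrite /rV_coord (@row_mxEr _ _ 1 n).
  by apply: measurableT_comp; [exact: measurable_rV_coord|exact: measurable_snd].
Qed.

Let rV_uncons (x : 'rV[R]_n.+1) : R * 'rV[R]_n :=
  (x ord0 ord0, rsubmx (x : 'rV_(1 + n))).

Let rV_consK : cancel rV_cons rV_uncons.
Proof.
move=> [a v]; rewrite /rV_uncons /rV_cons row_mxKr /=; congr pair.
transitivity (row_mx (a%:M : 'rV_1) v ord0 (lshift n ord0)).
  by congr (row_mx _ _ _ _); exact: val_inj.
by rewrite row_mxEl mxE eqxx.
Qed.

Let measurable_rV_uncons : measurable_fun setT rV_uncons.
Proof.
apply/measurable_fun_pairP; split; first exact: measurable_rV_coord.
apply: measurable_fun_rVP => i.
have -> : rV_coord i \o (snd \o rV_uncons) = @rV_coord R n.+1 (rshift 1 i).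
  by apply/funext => x /=; rewrite /rV_coord mxE.
exact: measurable_rV_coord.
Qed.

Variable mu : {sigma_finite_measure set 'rV[R]_n -> \bar R}.

Definition lebesgue_cons : set 'rV[R]_n.+1 -> \bar R :=
  pushforward (lebesgue_measure \x mu)%E rV_cons.

Let lebesgue_cons0 : lebesgue_cons set0 = 0%E.
Proof. by rewrite /lebesgue_cons /pushforward preimage_set0 measure0. Qed.

Let lebesgue_cons_ge0 A : (0 <= lebesgue_cons A)%E.
Proof. by rewrite /lebesgue_cons /pushforward measure_ge0. Qed.

Let lebesgue_cons_sigma_additive : semi_sigma_additive lebesgue_cons.
Proof.
move=> F mF tF mUF; rewrite /lebesgue_cons /pushforward preimage_bigcup.
apply: measure_semi_sigma_additive.
- by move=> k; rewrite -[X in measurable X]setTI; exact: measurable_rV_cons.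
- apply/trivIsetP => /= i j _ _ ij; rewrite -preimage_setI.
  by move/trivIsetP : tF => /(_ _ _ _ _ ij) ->//; rewrite preimage_set0.
- rewrite -preimage_bigcup -[X in measurable X]setTI.
  exact: measurable_rV_cons.
Qed.

HB.instance Definition _ := isMeasure.Build _ _ _ lebesgue_cons
  lebesgue_cons0 lebesgue_cons_ge0 lebesgue_cons_sigma_additive.

Let lebesgue_cons_sigma_finite : sigma_finite setT lebesgue_cons.
Proof.
have [F UF mF] : sigma_finite setT (lebesgue_measure \x mu)%E.
  have /sigma_finiteP[F [TF ndF Foo]] := sigma_finiteT (@lebesgue_measure R).
  have /sigma_finiteP[G [TG ndG Goo]] := sigma_finiteT mu.
  exists (fun k => F k `*` G k).
    rewrite -setXTT TF TG predeqE => -[x y]; split.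
      move=> [/= [i _ Fix] [j _ Gjy]]; exists (maxn i j) => //; split.
      - by move: x Fix; exact/subsetPset/ndF/leq_maxl.
      - by move: y Gjy; exact/subsetPset/ndG/leq_maxr.
    by move=> [i _ []/= ? ?]; split; exists i.
  move=> k; have [? ?] := Foo k; have [? ?] := Goo k.
  split; first exact: measurableX.
  by rewrite product_measure1E// lte_mul_pinfty// ge0_fin_numE.
exists (fun k => rV_uncons @^-1` F k).
  by rewrite -preimage_bigcup -UF preimage_setT.
move=> k; split.
  by rewrite -[X in measurable X]setTI; apply: measurable_rV_uncons => //; case: (mF k).
rewrite /lebesgue_cons /pushforward -comp_preimage.
have -> : rV_uncons \o rV_cons = id by exact/funext.
by case: (mF k).
Qed.

HB.instance Definition _ := Measure_isSigmaFinite.Build _ _ _ lebesgue_cons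
  lebesgue_cons_sigma_finite.

End lebesgue_step.

(* Borel-Lebesgue measure on R^n, as an iterated product: dirac on the
   one-point space 'rV[R]_0, then (lebesgue_measure \x _) transported along
   (a, x) |-> (a, x_1, ..., x_n). *)
Fixpoint lebesgue_rV (R : realType) (n : nat) :
    {sigma_finite_measure set 'rV[R]_n -> \bar R} :=
  match n return {sigma_finite_measure set 'rV[R]_n -> \bar R} with
  | 0%N => \d_(0 : 'rV[R]_0)
  | n'.+1 => lebesgue_cons (lebesgue_rV R n')
  end.

Section calculus.
Variables (R : realType) (n : nat).
Implicit Types (f : 'rV[R]_n -> R) (U Omega : set 'rV[R]_n).

Definition basis_rV (i : 'I_n) : 'rV[R]_n := delta_mx ord0 i.

Definition partial (i : 'I_n) f : 'rV[R]_n -> R := fun x => 'D_(basis_rV i) f x.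

Definition grad f (x : 'rV[R]_n) : 'rV[R]_n := \row_i partial i f x.

(* The library norm on 'rV[R]_n is the sup norm; this is the Euclidean one. *)
Definition enorm (x : 'rV[R]_n) : R := Num.sqrt (\sum_i x ord0 i ^+ 2).

Definition divergence (F : 'rV[R]_n -> 'rV[R]_n) (x : 'rV[R]_n) : R :=
  \sum_i partial i (fun y => F y ord0 i) x.

(* Only meant for U open. *)
Fixpoint Ck (k : nat) U f : Prop :=
  (forall x, U x -> {for x, continuous f}) /\
  match k with
  | 0%N => True
  | k'.+1 => forall i, (forall x, U x -> derivable f x (basis_rV i)) /\
                       Ck k' U (partial i f)
  end.

Definition smooth_on U f : Prop := forall k, Ck k U f.

(* f is of class C^k on closure Omega, i.e. it is there the restriction of
   a C^k function on R^n. *)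
Definition Ck_closure (k : nat) Omega f : Prop :=
  exists2 h, Ck k setT h & forall x, closure Omega x -> h x = f x.

End calculus.

Section domains.
Variables (R : realType) (n : nat).
Implicit Types (Omega : set 'rV[R]_n) (rho : 'rV[R]_n -> R).

Definition boundary Omega : set 'rV[R]_n := closure Omega `\` interior Omega.

(* Near x, Omega is {rho < 0} with rho smooth and D rho nonvanishing (so that
   boundary Omega is {rho = 0} near x, with outward normal D rho / |D rho|). *)
Definition local_defining Omega (x : 'rV[R]_n) rho : Prop :=
  exists U, [/\ open U, U x, smooth_on U rho,
    forall y, U y -> grad rho y != 0 &
    forall y, U y -> (Omega y <-> rho y < 0)].

Definition smooth_boundary Omega : Prop :=
  forall x, boundary Omega x -> exists rho, local_defining Omega x rho.

(* Mean curvature at x of the level set of rho through x: average of the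
   principal curvatures, i.e. div (D rho / |D rho|) / (n - 1).  For rho < 0
   inside, it is nonnegative when the domain is convex. *)
Definition mean_curvature rho (x : 'rV[R]_n) : R :=
  divergence (fun y => (enorm (grad rho y))^-1 *: grad rho y) x / n.-1%:R.

(* At a boundary point the value does not depend on the choice of rho. *)
Definition mean_curvature_bounded_below Omega : Prop :=
  exists2 c : R, 0 < c & forall x rho,
    boundary Omega x -> local_defining Omega x rho -> c <= mean_curvature rho x.

Definition smooth_convex_domain Omega : Prop :=
  [/\ open Omega, Omega !=set0, bounded_set Omega, convex_set Omega &
      smooth_boundary Omega].

End domains.

Section sobolev.
Variables (R : realType) (n : nat) (p : R) (Omega : set 'rV[R]_n).
Implicit Types (f v phi : 'rV[R]_n -> R) (w : 'rV[R]_n -> 'rV[R]_n).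
Local Notation mu := (lebesgue_rV R n).

Definition Lp_on (D : set 'rV[R]_n) f : Prop :=
  measurable_fun D f /\ (\int[mu]_(x in D) (`|f x| `^ p)%:E < +oo)%E.

Definition Lp_loc f : Prop :=
  forall K, compact K -> K `<=` Omega -> Lp_on K f.

Definition test_function phi : Prop :=
  [/\ smooth_on setT phi, compact (closure [set x | phi x != 0]) &
      closure [set x | phi x != 0] `<=` Omega].

Definition weak_gradient v w : Prop := forall phi i, test_function phi ->
  \int[mu]_(x in Omega) (v x * partial i phi x) =
  - \int[mu]_(x in Omega) (w x ord0 i * phi x).

(* Membership of v in W^{1,p}, resp. W^{1,p}_loc, is the existence of a w. *)
Definition W1p_loc v w : Prop :=
  [/\ Lp_loc v, forall i, Lp_loc (fun x => w x ord0 i) & weak_gradient v w].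

Definition W1p v w : Prop :=
  [/\ Lp_on Omega v, forall i, Lp_on Omega (fun x => w x ord0 i) &
      weak_gradient v w].

(* When p < 2, |w|^(p-2) w reads 0 where w = 0, in accordance with its
   continuous extension, because powR 0 _ is then 0. *)
Definition p_harmonic v : Prop :=
  exists2 w, W1p_loc v w & forall phi, test_function phi ->
    \int[mu]_(x in Omega)
      (enorm (w x) `^ (p - 2) * \sum_i w x ord0 i * partial i phi x) = 0.

End sobolev.

Section regularized.
Variables (R : realType) (n : nat) (p e : R) (Omega : set 'rV[R]_n).
Variable (g : 'rV[R]_n -> R).

Definition reg_operator (f : 'rV[R]_n -> R) (x : 'rV[R]_n) : R :=
  \sum_i \sum_j
    ((i == j)%:R + (p - 2) * (partial i f x * partial j f x)
                   / (e ^+ 2 + enorm (grad f x) ^+ 2))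
    * partial j (partial i f) x.

Definition classical_solution (u : 'rV[R]_n -> R -> R) : Prop :=
  [/\ {within closure Omega `*` [set t | 0 <= t],
        continuous (fun z : 'rV[R]_n * R => u z.1 z.2)},
      forall x t, Omega x -> 0 < t ->
        [/\ derivable (u x) t 1,
            {for (x, t), continuous (fun z : 'rV[R]_n * R => derive1 (u z.1) z.2)},
            forall i, derivable (u^~ t) x (basis_rV R i) /\
              {for (x, t),
                continuous (fun z : 'rV[R]_n * R => partial i (u^~ z.2) z.1)},
            forall i j, derivable (partial i (u^~ t)) x (basis_rV R j) /\
              {for (x, t), continuous (fun z : 'rV[R]_n * R =>
                 partial j (partial i (u^~ z.2)) z.1)} &
            derive1 (u x) t = reg_operator (u^~ t) x],
      forall x, Omega x -> u x 0 = g x &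
      forall x t, boundary Omega x -> 0 < t -> u x t = g x].

(* What is known of the limit as t --> +oo of a classical solution: it is a
   Lipschitz classical solution of the regularized p-Laplace equation
   div ((e^2 + |Dv|^2)^(p/2 - 1) Dv) = 0 with boundary values g. *)
Definition stationary_solution (v : 'rV[R]_n -> R) : Prop :=
  [/\ [lipschitz v x | x in closure Omega],
      smooth_on Omega v,
      exists M, forall x, Omega x -> enorm (grad v x) <= M,
      forall x, Omega x -> divergence (fun y =>
        (e ^+ 2 + enorm (grad v y) ^+ 2) `^ (p / 2 - 1) *: grad v y) x = 0 &
      forall x, boundary Omega x -> v x = g x].

End regularized.

(* Main.v *)
(* All stationary solutions v^e are Lipschitz with one constant: barriers built
   from the distance to supporting hyperplanes of the convex domain bound the
   slope at the boundary, and doubling of variables carries the bound inside.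
   The flux (e^2 + |xi|^2)^(p/2-1) xi is strictly monotone in xi, uniformly for
   bounded xi and small e, up to an error |e - e'|; testing the difference of
   the equations of v^e and v^e' with ((v^e - v^e' - delta)_+)^2 and using the
   Poincare inequality shows that (v^e) is uniformly Cauchy as e -> 0. Testing
   next with (v^e - v^e') zeta for cutoffs zeta shows that the gradients are
   Cauchy in L^1_loc, so along a sequence they converge almost everywhere, and
   bounded convergence passes to the limit in the weak equation. *)

Require Import Defs.
From HB Require Import structures.
From mathcomp Require Import all_boot all_order all_algebra.
From mathcomp Require Import all_classical all_reals all_analysis.
From mathcomp Require Import measurable_realfun ring lra.

Set Implicit Arguments.
Unset Strict Implicit.
Unset Printing Implicit Defensive.
Import Order.TTheory GRing.Theory Num.Theory.
Import numFieldNormedType.Exports.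

Local Open Scope classical_set_scope.
Local Open Scope ring_scope.


(** * One-variable calculus *)

(** As the regularization vanishes the equation degenerates or becomes singular at zero gradient, so
    the estimates may see [e] only through |b|^2 / (e^2 + |b|^2), which lies in [0, 1]. The
    Lipschitz bound therefore uses the nondivergence form, whose ellipticity constants min(1, p - 1)
    and 1 + |p - 2| are independent of [e]. The comparison of two solutions uses the divergence
    form: when (xi, e) is read as a vector X of R^(n+1), the flux is the first block of |X|^(p-2) X,
    and a change of [e] costs an error proportional to |e - e'|. Squaring the positive part makes
    the test function C^1; subtracting delta moves its support into a closed subset of Omega,
    because the difference of two solutions vanishes on the boundary. Integration by parts is thus
    applied to C^1 functions that extend by zero. Since the whole family is Cauchy, the limit is
    fixed before any gradient is considered, and a sequence is extracted for the gradients alone.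
    Dimension 0 is treated apart: the boundary is then empty, and the link with [g] comes from the
    evolution equation. *)

Section one_variable.
Variable R : realType.
Implicit Types (h k : R -> R) (a b x t d r eta delta : R).

Lemma is_derive_epsP (V : normedModType R) (f : V -> R) (x v : V) (d : R) :
  is_derive x v f d <->
  (forall eta, 0 < eta -> exists2 delta : R, 0 < delta &
     forall t, `|t| < delta -> `|f (x + t *: v) - f x - t * d| <= eta * `|t|).
Proof.
have incr_quotE (t : R) : t != 0 ->
    `|d - t^-1 *: (f (t *: v + x) - f x)| = `|f (x + t *: v) - f x - t * d| / `|t|.
  move=> t0; rewrite -normrV ?unitfE// -normrM distrC; congr `| _ |.
  by rewrite (addrC x) [X in X - _]mulrC; field.
split.
  move=> [df dd] eta eta0.
  have /cvgrPdist_le/(_ _ eta0) : (fun s : R => s^-1 *: ((f \o shift x) (s *: v) - f x)) @ 0^' --> d.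
    by rewrite -dd; exact: df.
  rewrite near_withinE => -[/= delta delta0 H]; exists delta => // t td.
  have [->|t0] := eqVneq t 0.
    by rewrite scale0r addr0 subrr mul0r subrr normr0 mulr0.
  have /= := H t _ t0; rewrite sub0r normrN => /(_ td).
  rewrite incr_quotE// ler_pdivrMr ?normr_gt0//.
move=> H.
have cd : (fun s : R => s^-1 *: ((f \o shift x) (s *: v) - f x)) @ 0^' --> d.
  apply/cvgrPdist_le => eta eta0.
  have [delta delta0 Hd] := H _ eta0.
  rewrite near_withinE; exists delta => //= t /=; rewrite sub0r normrN => td t0.
  by rewrite incr_quotE// ler_pdivrMr ?normr_gt0//; exact: Hd.
split; first by apply/cvg_ex; exists d.
exact/cvg_lim.
Qed.

Lemma MVT_two_sided h (dh : R -> R) a b :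
  (forall x, `|x - a| <= `|b - a| -> is_derive x 1 h (dh x)) ->
  exists2 c : R, `|c - a| <= `|b - a| & h b - h a = dh c * (b - a).
Proof.
move=> H.
have cts x : `|x - a| <= `|b - a| -> {for x, continuous h}.
  move=> /H dx; apply: differentiable_continuous; apply/derivable1_diffP.
  exact: ex_derive.
have [ab|ba|<-] := ltgtP a b.
- have [||c ci e] := @MVT _ h dh a b ab.
  + move=> x; rewrite in_itv/= => /andP[ax xb]; apply: H.
    by rewrite !ger0_norm; lra.
  + apply: continuous_in_subspaceT => x; rewrite inE/= in_itv/= => /andP[ax xb].
    by apply: cts; rewrite !ger0_norm; lra.
  + exists c => //; move: ci; rewrite in_itv/= => /andP[ac cb].
    by rewrite !ger0_norm; lra.
- have [||c ci e] := @MVT _ h dh b a ba.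
  + move=> x; rewrite in_itv/= => /andP[ax xb]; apply: H.
    by rewrite !ler0_norm; lra.
  + apply: continuous_in_subspaceT => x; rewrite inE/= in_itv/= => /andP[ax xb].
    by apply: cts; rewrite !ler0_norm; lra.
  + exists c; last by lra.
    move: ci; rewrite in_itv/= => /andP[ac cb].
    by rewrite !ler0_norm; lra.
- by exists a; rewrite ?subrr ?mulr0.
Qed.

(** Second-order expansion at 0 with Peano remainder. It survives subtraction and can be compared
    with a parabola touching from above, which is all that the maximum principle asks of a function
    along a line. *)
Definition taylor2 h a b := forall eta, 0 < eta -> exists2 delta : R, 0 < delta &
  forall t, `|t| < delta ->
    `|h t - h 0 - a * t - b / 2 * t ^+ 2| <= eta * t ^+ 2.

Lemma taylor2B h k a b a' b' : taylor2 h a b -> taylor2 k a' b' ->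
  taylor2 (fun t => h t - k t) (a - a') (b - b').
Proof.
move=> Hh Hk eta eta0.
have e2 : 0 < eta / 2 by rewrite divr_gt0.
have [d1 d10 H1] := Hh _ e2; have [d2 d20 H2] := Hk _ e2.
exists (Num.min d1 d2); first by rewrite lt_min d10.
move=> t; rewrite lt_min => /andP[/H1 h1 /H2 h2].
have -> : h t - k t - (h 0 - k 0) - (a - a') * t - (b - b') / 2 * t ^+ 2 =
  (h t - h 0 - a * t - b / 2 * t ^+ 2) - (k t - k 0 - a' * t - b' / 2 * t ^+ 2).
  by field.
apply: le_trans (ler_normB _ _) _; lra.
Qed.

Lemma taylor2N h a b : taylor2 h a b -> taylor2 (fun t => - h t) (- a) (- b).
Proof.
move=> H; have H0 : taylor2 (fun=> 0 : R) 0 0.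
  move=> eta eta0; exists 1 => // t _.
  by rewrite !(mul0r, subr0) normr0 mulr_ge0// ?sqr_ge0 ?ltW.
have := taylor2B H0 H; rewrite !sub0r.
by under eq_fun do rewrite sub0r.
Qed.

(** After subtraction the linear term dominates at small scale and [t] may have either sign, so the
    slopes agree; division by [t ^+ 2] then compares the second-order coefficients. *)
Lemma taylor2_le h a b a' b' : taylor2 h a b ->
  (exists2 delta : R, 0 < delta & forall t, `|t| < delta ->
     h t <= h 0 + a' * t + b' / 2 * t ^+ 2) ->
  a = a' /\ b <= b'.
Proof.
move=> H [delta delta0 Hd].
have key eta : 0 < eta -> exists2 d : R, 0 < d & forall t, `|t| < d ->
    (a - a') * t + (b - b') / 2 * t ^+ 2 <= eta * t ^+ 2.
  move=> /H[d d0 K]; exists (Num.min d delta); first by rewrite lt_min d0.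
  move=> t; rewrite lt_min => /andP[/K + /Hd]; rewrite ler_norml => /andP[+ _].
  by nra.
have aa' : a = a'.
  have [d d0 K] := key 1 ltr01.
  apply/eqP; rewrite -subr_eq0; apply/negPn/negP => ne.
  set C : R := 1 + `|(b - b') / 2|.
  have C0 : 0 < C by rewrite ltr_pwDl.
  set s : R := `|a - a'|; have s0 : 0 < s by rewrite normr_gt0.
  (* At distance [m] on the side where the linear term is positive, that term is [s * m], while the
     quadratic terms are at most [C * m ^+ 2], hence at most half of it. *)
  set m : R := Num.min (d / 2) (s / (2 * C)).
  have m0 : 0 < m by rewrite lt_min !divr_gt0// mulr_gt0.
  have md : m <= d / 2 by rewrite ge_min lexx.
  have mC : m * C <= s / 2.
    have : m <= s / (2 * C) by rewrite ge_min lexx orbT.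
    by rewrite ler_pdivlMr ?mulr_gt0//; lra.
  have /K : `|Num.sg (a - a') * m| < d.
    by rewrite normrM normr_sg ne mul1r gtr0_norm//; lra.
  rewrite mulrA (mulrC (a - a')) -normrEsg exprMn sqr_sg ne !mul1r -/s.
  have : - C * m ^+ 2 <= ((b - b') / 2 - 1) * m ^+ 2.
    apply: ler_wpM2r; first exact: sqr_ge0.
    by rewrite /C; have := ler_norm (- ((b - b') / 2)); rewrite normrN; lra.
  have : m * C * m <= s / 2 * m by apply: ler_wpM2r => //; exact: ltW.
  have : 0 < s * m by rewrite mulr_gt0.
  nra.
split => //; rewrite -subr_le0; apply/ler_addgt0Pr => eta eta0.
have e2 : 0 < eta / 2 by rewrite divr_gt0.
have [d d0 K] := key _ e2.
have : `|d / 2| < d by rewrite gtr0_norm ?divr_gt0//; lra.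
move=> /K; rewrite aa' subrr mul0r add0r.
have : 0 < (d / 2) ^+ 2 by rewrite exprn_gt0 ?divr_gt0.
move=> p; rewrite ler_pM2r//; lra.
Qed.

(** The mean value theorem is applied to the remainder, whose derivative [dh t - dh 0 - b * t] is at
    most [eta * |t|] near 0 by differentiability of [dh] at 0. *)
Lemma taylor2_derive h (dh : R -> R) b :
  (exists2 r : R, 0 < r & forall t, `|t| < r -> is_derive t 1 h (dh t)) ->
  is_derive (0 : R) 1 dh b -> taylor2 h (dh 0) b.
Proof.
move=> [r r0 H] /is_derive_epsP Hb eta eta0.
have [d d0 K] := Hb _ eta0.
exists (Num.min r d) => [|t]; first by rewrite lt_min r0.
rewrite lt_min => /andP[tr td].
pose k t := h t - dh 0 * t - b / 2 * t ^+ 2.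
have [|c ct e] := @MVT_two_sided k (fun t => dh t - dh 0 - b * t) 0 t.
  move=> x; rewrite !subr0 => xt.
  have hx := H x (le_lt_trans xt tr).
  have -> : k = h - (dh 0 \*: id) - ((b / 2) \*: (@GRing.exp R ^~ 2%N)).
    by apply/funext => y.
  by apply: is_derive_eq; rewrite /GRing.scale/= /GRing.scale/=; field.
move: e; rewrite /k /= mulr0 expr0n/= mulr0 !subr0 => e.
have -> : h t - h 0 - dh 0 * t - b / 2 * t ^+ 2 =
  h t - dh 0 * t - b / 2 * t ^+ 2 - h 0 by ring.
rewrite e normrM -(real_normK (num_real t)) expr2 mulrA.
rewrite !subr0 in ct.
apply: ler_wpM2r => //; apply: le_trans (_ : eta * `|c| <= _).
  have := K c (le_lt_trans ct td); rewrite add0r /GRing.scale/= mulr1.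
  by rewrite (mulrC c).
by apply: ler_wpM2l => //; exact: ltW.
Qed.

End one_variable.

(** * Euclidean geometry and second-order jets *)

Section euclidean.
Variables (R : realType) (n : nat).
Implicit Types (x y z a b : 'rV[R]_n) (X Y Z : 'M[R]_n) (c s t : R).

Definition dot x y : R := \sum_i x ord0 i * y ord0 i.

Definition bil X x y : R := (x *m X *m y^T) ord0 ord0.

Lemma dotC x y : dot x y = dot y x.
Proof. by apply: eq_bigr => i _; rewrite mulrC. Qed.

Lemma dotDl x y z : dot (x + y) z = dot x z + dot y z.
Proof. by rewrite -big_split/=; apply: eq_bigr => i _; rewrite mxE mulrDl. Qed.

Lemma dotZl c x y : dot (c *: x) y = c * dot x y.
Proof. by rewrite mulr_sumr; apply: eq_bigr => i _; rewrite mxE mulrA. Qed.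

Lemma dotNl x y : dot (- x) y = - dot x y.
Proof. by rewrite -scaleN1r dotZl mulN1r. Qed.

Lemma dotBl x y z : dot (x - y) z = dot x z - dot y z.
Proof. by rewrite dotDl dotNl. Qed.

Lemma dotDr x y z : dot x (y + z) = dot x y + dot x z.
Proof. by rewrite dotC dotDl !(dotC x). Qed.

Lemma dotZr c x y : dot x (c *: y) = c * dot x y.
Proof. by rewrite dotC dotZl (dotC x). Qed.

Lemma dotNr x y : dot x (- y) = - dot x y.
Proof. by rewrite dotC dotNl dotC. Qed.

Definition dotE := (dotDl, dotNl, dotZl, dotDr, dotNr, dotZr).

Lemma dot_basis x i : dot x (basis_rV R i) = x ord0 i.
Proof.
rewrite /dot (bigD1 i)//= mxE !eqxx mulr1 big1 ?addr0// => j ji.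
by rewrite mxE (negbTE ji) andbF mulr0.
Qed.

Lemma dotxx_ge0 x : 0 <= dot x x.
Proof. by apply: sumr_ge0 => i _; rewrite -expr2 sqr_ge0. Qed.

Lemma enorm_sqr x : enorm x ^+ 2 = dot x x.
Proof.
rewrite sqr_sqrtr; last by apply: sumr_ge0 => i _; exact: sqr_ge0.
by apply: eq_bigr => i _; rewrite expr2.
Qed.

Lemma enorm_ge0 x : 0 <= enorm x.
Proof. exact: sqrtr_ge0. Qed.

Lemma coord_le_enorm x i : `|x ord0 i| <= enorm x.
Proof.
rewrite -(@ler_pXn2r _ 2) ?nnegrE ?enorm_ge0// enorm_sqr real_normK ?num_real//.
rewrite /dot (bigD1 i)//= -expr2 lerDl.
by apply: sumr_ge0 => j _; rewrite -expr2 sqr_ge0.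
Qed.

Lemma enorm_eq0 x : (enorm x == 0) = (x == 0).
Proof.
apply/eqP/eqP => [x0|->].
  apply/rowP => i; apply/eqP; rewrite mxE -normr_le0 -x0.
  exact: coord_le_enorm.
by rewrite /enorm big1 ?sqrtr0// => i _; rewrite mxE expr0n.
Qed.

Lemma enorm_gt0 x : (0 < enorm x) = (x != 0).
Proof. by rewrite lt0r enorm_ge0 andbT enorm_eq0. Qed.

Lemma enormN x : enorm (- x) = enorm x.
Proof. by rewrite /enorm; congr Num.sqrt; apply: eq_bigr => i _; rewrite mxE sqrrN. Qed.

Lemma enorm_distC x y : enorm (x - y) = enorm (y - x).
Proof. by rewrite -enormN opprB. Qed.

Lemma cauchy_schwarz x y : dot x y <= enorm x * enorm y.
Proof.
have [->|x0] := eqVneq x 0.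
  rewrite /dot big1 ?mulr_ge0 ?enorm_ge0// => i _; by rewrite mxE mul0r.
have [->|y0] := eqVneq y 0.
  rewrite /dot big1 ?mulr_ge0 ?enorm_ge0// => i _; by rewrite mxE mulr0.
move: x0 y0; rewrite -!enorm_gt0.
have := dotxx_ge0 (enorm y *: x - enorm x *: y).
rewrite !dotE (dotC y x) -!enorm_sqr.
set p := enorm x; set q := enorm y; set d := dot x y => H p0 q0.
have : 0 <= 2 * (p * q) * (p * q - d).
  apply: le_trans H _; rewrite le_eqVlt; apply/orP; left; apply/eqP; ring.
by rewrite pmulr_rge0 ?subr_ge0// !mulr_gt0.
Qed.

Lemma bilDl X x y z : bil X (x + y) z = bil X x z + bil X y z.
Proof. by rewrite /bil !mulmxDl mxE. Qed.

Lemma bilZl X c x y : bil X (c *: x) y = c * bil X x y.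
Proof. by rewrite /bil -!scalemxAl mxE. Qed.

Lemma bilDr X x y z : bil X z (x + y) = bil X z x + bil X z y.
Proof. by rewrite /bil linearD/= mulmxDr mxE. Qed.

Lemma bilZr X c x y : bil X y (c *: x) = c * bil X y x.
Proof. by rewrite /bil linearZ/= -scalemxAr mxE. Qed.

Lemma bilBm X Y x y : bil (X - Y) x y = bil X x y - bil Y x y.
Proof. by rewrite /bil mulmxBr mulmxBl !mxE. Qed.

Lemma bilNm X x y : bil (- X) x y = - bil X x y.
Proof. by rewrite /bil mulmxN mulNmx mxE. Qed.

Lemma bilDm X Y x y : bil (X + Y) x y = bil X x y + bil Y x y.
Proof. by rewrite /bil mulmxDr mulmxDl !mxE. Qed.

Lemma bilE X x y : bil X x y = \sum_i \sum_j x ord0 i * X i j * y ord0 j.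
Proof.
rewrite /bil mxE exchange_big/=; apply: eq_bigr => j _.
by rewrite !mxE mulr_suml.
Qed.

Lemma sum_bil_basisl X (x y : 'rV[R]_n) :
  \sum_i x ord0 i * bil X (basis_rV R i) y = bil X x y.
Proof.
rewrite bilE; apply: eq_bigr => i _; rewrite bilE (bigD1 i)//= [X in _ + X]big1 ?addr0.
  by rewrite mulr_sumr; apply: eq_bigr => j _; rewrite mxE !eqxx mul1r mulrA.
move=> k ki; rewrite big1// => j _.
by rewrite mxE (negbTE ki) andbF !mul0r.
Qed.

Lemma sum_bil_basisr X (x y : 'rV[R]_n) :
  \sum_i x ord0 i * bil X y (basis_rV R i) = bil X y x.
Proof.
rewrite bilE exchange_big/=; apply: eq_bigr => i _.
rewrite bilE exchange_big/= (bigD1 i)//= [X in _ + X]big1 ?addr0.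
  by rewrite mulr_sumr; apply: eq_bigr => j _; rewrite mxE !eqxx mulr1 mulrC.
move=> k ki; rewrite big1// => j _.
by rewrite mxE (negbTE ki) andbF !mulr0.
Qed.

Lemma bil_basis X i : bil X (basis_rV R i) (basis_rV R i) = X i i.
Proof.
rewrite bilE (bigD1 i)//= (bigD1 i)//= [X in _ + X + _]big1 => [|j ji].
  rewrite [X in _ + X]big1 => [|j ji]; first by rewrite mxE !eqxx mul1r mulr1 !addr0.
  by rewrite big1// => k _; rewrite mxE (negbTE ji) andbF !mul0r.
by rewrite mxE [X in _ * X]mxE (negbTE ji) andbF mulr0.
Qed.

(* [X |-> tr X + c X(b, b)] is the trace against the matrix [1 + c b^T b],
   which is the square of [1 + s b^T b] for a suitable [s]. *)
Lemma sum_squares_elliptic b c : 0 <= 1 + c * dot b b ->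
  exists xi : 'I_n -> 'rV[R]_n,
    forall X, \tr X + c * bil X b b = \sum_i bil X (xi i) (xi i).
Proof.
move=> H; suff [s s2] : exists s, 2 * s + s ^+ 2 * dot b b = c.
  exists (fun i => basis_rV R i + (s * b ord0 i) *: b) => X.
  transitivity (\sum_i (X i i + (s * (b ord0 i * bil X (basis_rV R i) b)
     + s * (b ord0 i * bil X b (basis_rV R i))
     + s ^+ 2 * bil X b b * (b ord0 i * b ord0 i)))).
    rewrite !big_split/= -!mulr_sumr sum_bil_basisl sum_bil_basisr -/(dot b b).
    by rewrite -s2 /mxtrace; ring.
  apply: eq_bigr => i _; rewrite bilDl !bilDr !bilZl !bilZr bil_basis; ring.
have [b0|b0] := eqVneq (dot b b) 0; first by exists (c / 2); rewrite b0; field.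
exists ((Num.sqrt (1 + c * dot b b) - 1) / dot b b).
have /eqP := sqr_sqrtr H; set r := Num.sqrt _; rewrite -subr_eq0 => /eqP e.
apply/eqP; rewrite -subr_eq0; apply/eqP.
transitivity ((r ^+ 2 - (1 + c * dot b b)) / dot b b); last by rewrite e mul0r.
by field.
Qed.

Lemma elliptic_le0 Z b c : 0 <= 1 + c * dot b b ->
  (forall xi, bil Z xi xi <= 0) -> \tr Z + c * bil Z b b <= 0.
Proof.
move=> /sum_squares_elliptic[xi ->] H; apply: sumr_le0 => i _; exact: H.
Qed.

End euclidean.

(** * Directional derivatives and second-order jets along lines *)

Section chain_rule.
Variables (R : realType) (n : nat).
Implicit Types (f : 'rV[R]_n -> R) (U : set 'rV[R]_n) (x xi : 'rV[R]_n).

Lemma is_derive_line (V : normedModType R) (f : V -> R) (x v : V) (s d : R) :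
  is_derive (x + s *: v) v f d -> is_derive s 1 (fun t => f (x + t *: v)) d.
Proof.
move=> /is_derive_epsP H; apply/is_derive_epsP => eta /H[delta d0 K].
exists delta => // t /K; rewrite -(addrA x) -scalerDl.
by rewrite /GRing.scale/= mulr1.
Qed.

Lemma nbhs_radiusP (V : normedModType R) (P : set V) (x : V) : nbhs x P <->
  exists2 r : R, 0 < r & forall y, `|y - x| < r -> P y.
Proof.
split.
  move=> /nbhs_ballP[r r0 H]; exists r => // y yx; apply: H.
  by rewrite -ball_normE/= distrC.
move=> [r r0 H]; apply/nbhs_ballP; exists r => // y.
by rewrite -ball_normE/= distrC; exact: H.
Qed.

Lemma continuous_at_epsP (V : normedModType R) (f : V -> R) (x : V) :
  {for x, continuous f} <-> forall eta : R, 0 < eta ->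
    exists2 r : R, 0 < r & forall y, `|y - x| < r -> `|f y - f x| <= eta.
Proof.
split.
  move=> /cvgrPdist_le H eta /H /nbhs_radiusP[r r0 K]; exists r => // y /K.
  by rewrite /= distrC.
move=> H; apply/cvgrPdist_le => eta /H[r r0 K]; apply/nbhs_radiusP.
by exists r => // y /K; rewrite distrC.
Qed.

(** Partial sums of the coordinate expansion of [xi]: the corners of the broken line from [x] to
    [x + t *: xi] that follows the axes. *)
Definition truncate_rV (xi : 'rV[R]_n) (k : nat) : 'rV[R]_n :=
  \row_j (if (j < k)%N then xi ord0 j else 0).

Lemma truncate_rVS xi (i : 'I_n) :
  truncate_rV xi i.+1 = truncate_rV xi i + xi ord0 i *: basis_rV R i.
Proof.
apply/rowP => j; rewrite !mxE/= ltnS leq_eqVlt -[_ == _ :> nat]/(j == i).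
by case: eqVneq => [->|ji] /=; rewrite ?ltnn ?mulr1 ?add0r// mulr0 addr0.
Qed.

Lemma norm_rV_leP (x : 'rV[R]_n) (r : R) : 0 <= r ->
  (`|x| <= r <-> forall i, `|x ord0 i| <= r).
Proof.
have -> : `|x| = \big[Num.max/0]_ij `|x ij.1 ij.2| by exact: mx_normrE.
move=> r0; split => [/bigmax_leP[_ H] i|H].
  exact: (H (ord0, i)).
by apply/bigmax_leP; split => //= -[a i] _ /=; rewrite ord1.
Qed.

Lemma coord_le_norm (x : 'rV[R]_n) i : `|x ord0 i| <= `|x|.
Proof. by have /norm_rV_leP : `|x| <= `|x| by []; apply. Qed.

Lemma norm_le_enorm (x : 'rV[R]_n) : `|x| <= enorm x.
Proof. by apply/norm_rV_leP => [|i]; [exact: enorm_ge0|exact: coord_le_enorm]. Qed.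

Lemma enorm_le_norm (x : 'rV[R]_n) : enorm x <= n%:R * `|x|.
Proof.
rewrite -(@ler_pXn2r _ 2) ?nnegrE ?enorm_ge0 ?mulr_ge0// enorm_sqr exprMn.
apply: (@le_trans _ _ (n%:R * `|x| ^+ 2)).
  rewrite mulr_natl -[X in _ *+ X]card_ord -sumr_const; apply: ler_sum => i _.
  by rewrite -expr2 -real_normK ?num_real// lerXn2r// ?nnegrE// coord_le_norm.
apply: ler_wpM2r; first exact: sqr_ge0.
by rewrite -natrX ler_nat; case: (n) => // m; rewrite expnS leq_pmulr// expn1.
Qed.

Lemma norm_truncate_rV xi k : `|truncate_rV xi k| <= `|xi|.
Proof.
apply/norm_rV_leP => // i; rewrite mxE; case: ifP => _; first exact: coord_le_norm.
by rewrite normr0.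
Qed.

(* Continuity of the partial derivatives lets the increment along [xi] be
   telescoped over the coordinates by the mean value theorem. *)
Lemma is_derive_dot_grad U f x xi : open U -> U x -> Ck 1 U f ->
  is_derive x xi f (dot xi (grad f x)).
Proof.
move=> oU Ux [_ Hf].
have H k eta : (k <= n)%N -> 0 < eta -> exists2 delta : R, 0 < delta &
    forall t, `|t| < delta -> `|f (x + t *: truncate_rV xi k) - f x -
       t * dot (truncate_rV xi k) (grad f x)| <= eta * `|t|.
  elim: k eta => [|k IH] eta kn eta0.
    have z0 : truncate_rV xi 0 = 0 by apply/rowP => j; rewrite !mxE.
    exists 1 => // t _; rewrite z0 scaler0 addr0 subrr sub0r.
    by rewrite -(scale0r 0) dotZl mul0r mulr0 oppr0 normr0 mulr_ge0// ltW.
  pose i := Ordinal kn.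
  have [df cf] := Hf i.
  set M := `|xi| + 1; have M0 : 0 < M by rewrite ltr_pwDr.
  have e2 : 0 < eta / 2 by rewrite divr_gt0.
  have [d1 d10 K1] := IH _ (ltnW kn) e2.
  have /continuous_at_epsP/(_ (eta / (2 * M))) : {for x, continuous (partial i f)}.
    by case: cf => cf _; exact: cf.
  rewrite divr_gt0 ?mulr_gt0// => /(_ isT)[r1 r10 C1].
  have /nbhs_radiusP[r2 r20 C2] : nbhs x U by exact: open_nbhs_nbhs.
  set r := Num.min r1 r2.
  have r0 : 0 < r by rewrite lt_min r10.
  exists (Num.min d1 (r / (2 * M))); first by rewrite lt_min d10 divr_gt0// mulr_gt0.
  move=> t; rewrite lt_min => /andP[td1 tr].
  have {}K1 := K1 _ td1.
  rewrite (truncate_rVS xi i) scalerDr addrA scalerA dotDl dotZl.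
  set y := x + t *: _.
  have yb c : `|c| <= `|t * xi ord0 i| -> `|y + c *: basis_rV R i - x| < r.
    move=> cb; rewrite /y addrC !addrA addNr add0r.
    have : `|t| * (2 * M) < r by rewrite -ltr_pdivlMr ?mulr_gt0.
    apply: le_lt_trans; apply: le_trans (ler_normD _ _) _.
    rewrite mulr2n mulrDl mul1r mulrDr lerD//.
      rewrite normrZ ler_wpM2l//; apply: le_trans (norm_truncate_rV _ _) _.
      by rewrite lerDl.
    rewrite normrZ; apply: le_trans (_ : `|c| * 1 <= _).
      rewrite ler_wpM2l//; apply/norm_rV_leP => // j; rewrite mxE.
      by case: eqP; case: eqP; rewrite /= ?normr1 ?normr0.
    rewrite mulr1; apply: le_trans cb _; rewrite normrM ler_wpM2l//.
    by apply: le_trans (coord_le_norm _ _) _; rewrite lerDl.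
  have [|c cb e] := @MVT_two_sided R (fun s => f (y + s *: basis_rV R i))
     (fun s => partial i f (y + s *: basis_rV R i)) 0 (t * xi ord0 i).
    move=> s; rewrite !subr0 => sb; apply: is_derive_line; apply: derivableP.
    by apply: df; apply: C2; apply: lt_le_trans (yb _ sb) _; rewrite ge_min lexx orbT.
  rewrite !subr0 scale0r addr0 in e cb.
  have /C1 : `|y + c *: basis_rV R i - x| < r1.
    by apply: lt_le_trans (yb _ cb) _; rewrite ge_min lexx.
  rewrite ler_pdivlMr ?mulr_gt0// => {}C1.
  have -> : f (y + (t * xi ord0 i) *: basis_rV R i) - f x -
     t * (dot (truncate_rV xi i) (grad f x) + xi ord0 i * dot (basis_rV R i) (grad f x)) =
     (f y - f x - t * dot (truncate_rV xi i) (grad f x)) +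
     (t * xi ord0 i) * (partial i f (y + c *: basis_rV R i) - partial i f x).
    rewrite (dotC (basis_rV R i)) dot_basis mxE mulrBr [(t * _) * partial i f (_ + _)]mulrC -e; ring.
  apply: le_trans (ler_normD _ _) _.
  have : `|t * xi ord0 i| * `|partial i f (y + c *: basis_rV R i) - partial i f x|
         <= `|t| * (eta / 2).
    rewrite normrM -mulrA ler_wpM2l//.
    have xiM : `|xi ord0 i| <= M by apply: le_trans (coord_le_norm _ _) _; rewrite lerDl.
    apply: le_trans (_ : M * `|partial i f (y + c *: basis_rV R i) - partial i f x| <= _).
      exact: ler_wpM2r.
    by lra.
  rewrite -normrM; move: K1; rewrite -/y; lra.
apply/is_derive_epsP => eta eta0.
have [d d0 K] := H n eta (leqnn n) eta0; exists d => // t /K.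
by have -> : truncate_rV xi n = xi by apply/rowP => j; rewrite mxE ltn_ord.
Qed.

Lemma Ck_le k l U f : (k <= l)%N -> Ck l U f -> Ck k U f.
Proof.
elim: k l f => [|k IH] [|l] f //=; first by move=> _ [].
rewrite ltnS => kl [cf Hf]; split => // i; have [df Cf] := Hf i.
by split => //; exact: IH Cf.
Qed.

Definition hessian f x : 'M[R]_n := \matrix_(i, j) partial j (partial i f) x.

(** The pair (b, X) acts as gradient and Hessian, tested one line at a time. The touching arguments
    below move points along lines, and this form passes at once to differences and to [- f]. *)
Definition jet2 f x b (X : 'M[R]_n) := forall xi,
  taylor2 (fun t => f (x + t *: xi)) (dot b xi) (bil X xi xi).

Lemma jet2_C2 U f x : open U -> U x -> Ck 2 U f ->
  jet2 f x (grad f x) (hessian f x).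
Proof.
move=> oU Ux Cf xi.
have Cf1 : Ck 1 U f by exact: Ck_le Cf.
have -> : dot (grad f x) xi = dot xi (grad f (x + 0 *: xi)).
  by rewrite scale0r addr0 dotC.
apply: (@taylor2_derive _ (fun t => f (x + t *: xi))
          (fun t => dot xi (grad f (x + t *: xi)))).
  have /nbhs_radiusP[r r0 K] : nbhs x U by exact: open_nbhs_nbhs.
  exists (r / (`|xi| + 1)) => [|t]; first by rewrite divr_gt0// ltr_pwDr.
  rewrite ltr_pdivlMr ?ltr_pwDr// => tr.
  apply: is_derive_line; apply: is_derive_dot_grad oU _ Cf1; apply: K.
  rewrite addrC addKr normrZ; apply: le_lt_trans tr.
  by rewrite ler_wpM2l// lerDl.
have -> : (fun t => dot xi (grad f (x + t *: xi))) =
    \sum_i (xi ord0 i \*: (fun t => partial i f (x + t *: xi))).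
  by apply/funext => t; rewrite fct_sumE; apply: eq_bigr => i _; rewrite mxE.
rewrite bilE; apply: is_derive_eq.
  apply: is_derive_sum => i; apply: is_deriveZ; apply: is_derive_line.
  apply: (is_derive_dot_grad (U := U)) => //; first by rewrite scale0r addr0.
  by case: Cf => _ /(_ i)[].
apply: eq_bigr => i _; rewrite scale0r addr0 -[_ *: _]/(_ * _) /dot mulr_sumr; apply: eq_bigr => j _.
by rewrite !mxE; ring.
Qed.

End chain_rule.

(** * The regularized equation and boundary barriers *)

Section maximum_principle.
Variables (R : realType) (n : nat) (p e : R).
Implicit Types (v w G f : 'rV[R]_n -> R) (Omega U K : set 'rV[R]_n)
  (x y z b xi nu : 'rV[R]_n) (X Z H : 'M[R]_n).

Lemma is_derive_lineP (V : normedModType R) (f : V -> R) (x v : V) (d : R) :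
  is_derive x v f d <-> is_derive (0 : R) 1 (fun t => f (x + t *: v)) d.
Proof.
split => [H|/is_derive_epsP H]; first by apply: is_derive_line; rewrite scale0r addr0.
apply/is_derive_epsP => eta /H[delta d0 K]; exists delta => // t /K.
by rewrite scale0r addr0 add0r /GRing.scale/= mulr1.
Qed.

Lemma is_derive_real_comp (V : normedModType R) (f : V -> R) (g : R -> R) (x v : V)
    (df dg : R) : is_derive x v f df -> is_derive (f x) 1 g dg ->
  is_derive x v (g \o f) (dg * df).
Proof.
move=> /is_derive_lineP H1 H2; apply/is_derive_lineP.
have H2' : is_derive (f (x + (0 : R) *: v)) 1 g dg by rewrite scale0r addr0.
exact: (@is_derive1_comp R g (fun t => f (x + t *: v)) 0 dg df H2' H1).
Qed.

Definition flux (b : 'rV[R]_n) : 'rV[R]_n := (e ^+ 2 + enorm b ^+ 2) `^ (p / 2 - 1) *: b.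

(** Coefficient of the rank-one part of the nondivergence form, [\tr X + ellip b * bil X b b],
    obtained from the divergence form by dividing out the positive factor (e^2 + |b|^2)^(p/2 -
    1). *)
Definition ellip b : R := (p - 2) / (e ^+ 2 + dot b b).

Definition jet_solution Omega v := forall x, Omega x ->
  exists b X, jet2 v x b X /\ \tr X + ellip b * bil X b b = 0.

(** Product and chain rule for (e^2 + |Dv|^2)^(p/2 - 1) v_i. The exponent p/2 - 2 is rewritten as
    p/2 - 1 divided by the base, and the factor 2 (p/2 - 1) = p - 2 then produces [ellip]. *)
Lemma is_derive_flux U v x i : 0 < e -> open U -> U x -> Ck 2 U v ->
  is_derive x (basis_rV R i) (fun y => flux (grad v y) ord0 i)
   ((e ^+ 2 + enorm (grad v x) ^+ 2) `^ (p / 2 - 1) *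
     (hessian v x i i + ellip (grad v x) *
        (grad v x ord0 i * bil (hessian v x) (grad v x) (basis_rV R i)))).
Proof.
move=> e0 oU Ux Cv.
have d2 j : is_derive x (basis_rV R i) (partial j v) (hessian v x j i).
  rewrite mxE; apply: derivableP; case: Cv => _ /(_ j)[_ [_ /(_ i)[+ _]]]; exact.
set s := fun y => e ^+ 2 + enorm (grad v y) ^+ 2.
have s0 y : 0 < s y by rewrite ltr_pwDl ?exprn_gt0 ?sqr_ge0.
have ds : is_derive x (basis_rV R i) s
    (2 * bil (hessian v x) (grad v x) (basis_rV R i)).
  have -> : s = cst (e ^+ 2) + \sum_j (partial j v) ^+ 2.
    apply/funext => y; rewrite /s enorm_sqr; congr (_ + _).
    by rewrite fct_sumE; apply: eq_bigr => j _; rewrite !mxE -expr2.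
  apply: is_derive_eq; rewrite add0r -sum_bil_basisl mulr_sumr.
  apply: eq_bigr => j _; rewrite -[_ *: _]/(_ * _) expr1.
  rewrite bilE (bigD1 j)//= (bigD1 i)//= [X in _ + X + _]big1 => [|k ki].
    rewrite [X in _ + X]big1 => [|k kj]; last first.
      by rewrite big1// => l _; rewrite !mxE (negbTE kj) andbF !mul0r.
    by rewrite !mxE !eqxx mul1r mulr1 !addr0 mulrA.
  by rewrite !mxE (negbTE ki) andbF mulr0.
have -> : (fun y => flux (grad v y) ord0 i) =
    ((fun r : R => r `^ (p / 2 - 1)) \o s) * partial i v.
  by apply/funext => y; rewrite /flux !mxE.
have dp := is_derive_real_comp ds (@is_derive1_powR R (p / 2 - 1) (s x) (s0 x)).
apply: is_derive_eq; rewrite -![_ *: _]/(_ * _) /=.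
have -> : s x `^ (p / 2 - 1 - 1) = s x `^ (p / 2 - 1) / s x.
  by rewrite powRB ?powRr1 ?ltW// (gt_eqF (s0 x)) implybT.
rewrite -/(s x) /ellip -enorm_sqr -/(s x) !mxE.
by field; rewrite gt_eqF.
Qed.

Lemma jet_solution_stationary Omega g v : 0 < e -> open Omega ->
  stationary_solution p e Omega g v -> jet_solution Omega v.
Proof.
move=> e0 oO [_ sv _ dv _] x Ox; have Cv := sv 2.
exists (grad v x), (hessian v x); split; first exact: jet2_C2 Cv.
have := dv x Ox; rewrite /divergence.
under eq_bigr => i _.
  rewrite /partial (@derive_val _ _ _ _ _ _ _ (is_derive_flux i e0 oO Ox Cv)).
  over.
rewrite -mulr_sumr big_split/= -mulr_sumr sum_bil_basisr => /eqP.
rewrite mulf_eq0 gt_eqF/= => [/eqP //|].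
by rewrite powR_gt0// ltr_pwDl ?exprn_gt0 ?sqr_ge0.
Qed.

(** The number is 1 + (p - 2) r with r = c / (e^2 + |b|^2) in [0, 1], hence lies between 1 and p -
    1. This is the source of the independence of [e] in the Lipschitz bound. *)
Lemma ellip_gt b c : 1 < p -> 0 < e -> 0 <= c <= dot b b -> 
  Num.min 1 (p - 1) <= 1 + ellip b * c /\ 0 < 1 + ellip b * c.
Proof.
move=> p1 e0 /andP[c0 cb].
have s0 : 0 < e ^+ 2 + dot b b by rewrite ltr_pwDl ?exprn_gt0 ?dotxx_ge0.
have e20 : 0 < e ^+ 2 by rewrite exprn_gt0.
rewrite /ellip mulrAC -mulrA; set r := c / _.
have r0 : 0 <= r by rewrite divr_ge0// ltW.
have r1 : r <= 1 by rewrite ler_pdivrMr//; lra.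
suff H : Num.min 1 (p - 1) <= 1 + (p - 2) * r.
  split => //; apply: lt_le_trans H; rewrite lt_min; lra.
by rewrite ge_min; apply/orP; have [p2|p2] := lerP 2 p; [left|right]; nra.
Qed.

Lemma jet2N v x b X : jet2 v x b X -> jet2 (fun y => - v y) x (- b) (- X).
Proof. by move=> H xi; rewrite dotNl bilNm; apply: taylor2N; exact: H. Qed.

Lemma jet_solutionN Omega v : jet_solution Omega v -> jet_solution Omega (fun y => - v y).
Proof.
move=> H x /H[b [X [jX eX]]]; exists (- b), (- X); split; first exact: jet2N.
rewrite linearN/= bilNm /ellip dotNl dotNr opprK.
by rewrite -(scaleN1r b) bilZl bilZr !mulN1r opprK mulrN -opprD eX oppr0.
Qed.

Lemma open_line Omega x xi : open Omega -> Omega x ->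
  exists2 d : R, 0 < d & forall t, `|t| < d -> Omega (x + t *: xi).
Proof.
move=> oO Ox; have /nbhs_radiusP[r r0 K] : nbhs x Omega by exact: open_nbhs_nbhs.
exists (r / (`|xi| + 1)); first by rewrite divr_gt0// ltr_pwDr.
move=> t; rewrite ltr_pdivlMr ?ltr_pwDr// => tr; apply: K.
rewrite addrC addKr normrZ; apply: le_lt_trans tr.
by rewrite ler_wpM2l// lerDl.
Qed.

Lemma boundaryE Omega x : open Omega -> boundary Omega x <-> closure Omega x /\ ~ Omega x.
Proof. by move=> oO; rewrite /boundary (iffLR (interior_id _) oO). Qed.

Lemma continuous_sum_ord (T : topologicalType) (m : nat) (f : 'I_m -> T -> R) (a : T) :
  (forall i, {for a, continuous (f i)}) ->
  {for a, continuous (fun c : T => \sum_i f i c)}.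
Proof.
move=> H; apply: (@cvg_big _ _ _ _ _ _ _ (nbhs a)) => // [|i _]; last exact: H.
exact: add_continuous.
Qed.

Lemma outer_bil nu xi : bil (nu^T *m nu) xi xi = dot nu xi ^+ 2.
Proof.
rewrite /bil mulmxA -mulmxA mxE big_ord1 !mxE expr2.
by congr (_ * _); apply: eq_bigr => i _; rewrite !mxE// mulrC.
Qed.

Lemma outer_tr nu : \tr (nu^T *m nu) = dot nu nu.
Proof. by apply: eq_bigr => i _; rewrite !mxE big_ord1 !mxE. Qed.

(** Since |b|^2 <= e^2 + |b|^2, the rank-one coefficient contributes at most |p - 2| times the size
    of [H], whatever the gradient and [e] are. *)
Lemma ellip_bound H b (M : R) : 0 < e ->
  \sum_i \sum_j `|H i j| <= M -> `|\tr H + ellip b * bil H b b| <= (1 + `|p - 2|) * M.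
Proof.
move=> e0 HM.
have s0 : 0 < e ^+ 2 + dot b b by rewrite ltr_pwDl ?exprn_gt0 ?dotxx_ge0.
have tH : `|\tr H| <= M.
  apply: le_trans HM; apply: le_trans (ler_norm_sum _ _ _) _; apply: ler_sum => i _.
  by rewrite (bigD1 i)//= lerDl sumr_ge0.
have bH : `|bil H b b| <= dot b b * M.
  apply: le_trans (_ : dot b b * (\sum_i \sum_j `|H i j|) <= _); last first.
    by rewrite ler_wpM2l ?dotxx_ge0.
  rewrite bilE mulr_sumr; apply: le_trans (ler_norm_sum _ _ _) _; apply: ler_sum => i _.
  rewrite mulr_sumr; apply: le_trans (ler_norm_sum _ _ _) _; apply: ler_sum => j _.
  rewrite !normrM -enorm_sqr expr2 mulrAC ler_wpM2r//.
  by rewrite ler_pM// coord_le_enorm.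
have M0 : 0 <= M by exact: le_trans tH.
apply: le_trans (ler_normD _ _) _; rewrite mulrDl mul1r lerD//.
rewrite /ellip !normrM normfV (gtr0_norm s0) -mulrA ler_wpM2l//.
rewrite mulrC ler_pdivrMr//; apply: le_trans bH _.
by rewrite mulrC ler_wpM2l// lerDr sqr_ge0.
Qed.

(* [D d - d^2 / 2] is increasing and concave in the distance [d] to a
   supporting hyperplane; the uniform ellipticity makes it a strict
   supersolution after addition to [G], whatever the gradient is. *)
Lemma barrier_upper Omega v G y nu (D M K : R) :
  1 < p -> 0 < e -> open Omega -> Omega !=set0 -> compact (closure Omega) ->
  {within closure Omega, continuous v} -> {within closure Omega, continuous G} ->
  jet_solution Omega v ->
  (forall x, Omega x -> exists b H, jet2 G x b H /\ \sum_i \sum_j `|H i j| <= M) ->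
  (forall x, boundary Omega x -> v x = G x) ->
  dot nu nu = 1 ->
  (forall x, closure Omega x -> 0 <= dot nu (y - x) <= D) ->
  0 <= K -> (1 + `|p - 2|) * M < K * Num.min 1 (p - 1) ->
  forall x, closure Omega x ->
    v x <= G x + K * (D * dot nu (y - x) - dot nu (y - x) ^+ 2 / 2).
Proof.
move=> p1 e0 oO [x0 Ox0] cO cv cG jv jG vG nu1 nuD K0 KM.
set d := fun x => dot nu (y - x).
set F := fun x => v x - G x - K * (D * d x - d x ^+ 2 / 2).
have cd : continuous d.
  move=> x; have -> : d = fun x => \sum_i nu ord0 i * (y ord0 i - x ord0 i).
    by apply/funext => z; apply: eq_bigr => i _; rewrite !mxE.
  apply: continuous_sum_ord => i; apply: continuousM; first exact: cst_continuous.
  by apply: continuousB; [exact: cst_continuous|exact: coord_continuous].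
have cF : {within closure Omega, continuous F}.
  move=> x; apply: cvgB; first by apply: cvgB; [exact: cv|exact: cG].
  apply: cvgMl_tmp; apply: cvgB; first by apply: cvgMl_tmp; exact: continuous_subspaceT.
  apply: cvgMr_tmp; rewrite expr2; under eq_fun do rewrite expr2.
  by apply: cvgM; exact: continuous_subspaceT.
have cl0 : closure Omega !=set0 by exists x0; exact: subset_closure.
have [c] := compact_EVT_max cl0 cO cF; rewrite inE => cc maxc.
suff Fc : F c <= 0.
  move=> x cx; have : F x <= 0 by apply: le_trans Fc; apply: maxc; rewrite inE.
  by rewrite /F -/(d x); lra.
have [Oc|nOc] := pselect (Omega c); last first.
  have bc : boundary Omega c by apply/boundaryE.
  (* On the boundary only the barrier remains, and D d - d^2 / 2 >= 0 for 0 <= d <= D. *)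
  rewrite /F (vG _ bc) subrr sub0r oppr_le0 mulr_ge0//.
  by have := nuD _ cc; rewrite -/(d c); nra.
exfalso.
have [b [X [jX eX]]] := jv _ Oc.
have [b' [H [jH HM]]] := jG _ Oc.
have scl z : bil (K *: (nu^T *m nu)) z z = K * bil (nu^T *m nu) z z.
  by rewrite /bil -scalemxAr -scalemxAl mxE.
(* Along [xi] the barrier has second derivative - K (nu . xi)^2, so maximality of [F] at [c] bounds
   [X - H] by minus the rank-one matrix [K *: (nu^T *m nu)]. *)
have Z0 xi : bil (X - H + K *: (nu^T *m nu)) xi xi <= 0.
  have [dl dl0 Kd] := open_line xi oO Oc.
  have /taylor2_le := taylor2B (jX xi) (jH xi).
  move=> /(_ (- K * (D - d c) * dot nu xi) (- K * dot nu xi ^+ 2))[].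
    exists dl => // t /Kd Ot.
    have := maxc (c + t *: xi); rewrite inE => /(_ (subset_closure Ot)).
    have dt : d (c + t *: xi) = d c - t * dot nu xi.
      by rewrite /d !dotE; ring.
    by rewrite /F dt scale0r addr0; lra.
  by move=> _; rewrite bilDm bilBm scl outer_bil; lra.

have bb0 := dotxx_ge0 b.
have [_ el] : Num.min 1 (p - 1) <= 1 + ellip b * dot b b /\ 0 < 1 + ellip b * dot b b.
  by apply: ellip_gt => //; rewrite bb0/=.
 have := elliptic_le0 (ltW el) Z0.
rewrite raddfD/= raddfB/= mxtraceZ outer_tr nu1 bilDm bilBm scl outer_bil.
have := ellip_bound b e0 HM; rewrite ler_norml => /andP[_ hH].
have [el2 _] : Num.min 1 (p - 1) <= 1 + ellip b * dot nu b ^+ 2 /\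
    0 < 1 + ellip b * dot nu b ^+ 2.
  apply: ellip_gt => //.
  rewrite sqr_ge0/=; have := cauchy_schwarz nu b; have := cauchy_schwarz (- nu) b.
  have -> : enorm nu = 1.
    by apply/eqP; rewrite -(@eqrXn2 _ 2) ?enorm_ge0// enorm_sqr nu1 expr1n.
  rewrite dotNl enormN; have -> : enorm nu = 1.
    by apply/eqP; rewrite -(@eqrXn2 _ 2) ?enorm_ge0// enorm_sqr nu1 expr1n.
  rewrite -enorm_sqr => h1 h2; have := enorm_ge0 b; nra.
(* With the equation for (b, X), the trace inequality reads K (1 + ellip b (nu . b)^2) <= tr H +
   ellip b H(b, b). The left side is at least K min(1, p - 1), the right side at most (1 + |p - 2|)
   M, against the choice of [K]. *)
have : K * Num.min 1 (p - 1) <= K * (1 + ellip b * dot nu b ^+ 2) by rewrite ler_wpM2l.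
by move: eX hH; nra.
Qed.

End maximum_principle.

(** * Lipschitz estimates uniform in the regularization *)

Section interior_lipschitz.
Variables (R : realType) (n : nat) (p e : R).
Implicit Types (v f : 'rV[R]_n -> R) (Omega : set 'rV[R]_n).

(** The Euclidean norm is used because doubling of variables needs a distance with a second-order
    expansion off the diagonal, which the sup norm lacks. *)
Definition elipschitz_on Omega v (L : R) := forall x y, closure Omega x -> closure Omega y ->
  `|v x - v y| <= L * enorm (x - y).

Lemma within_continuous_epsP (V : normedModType R) (A : set V) (f : V -> R) :
  {within A, continuous f} <-> forall x, A x -> forall eta : R, 0 < eta ->
    exists2 r : R, 0 < r & forall y, A y -> `|y - x| < r -> `|f y - f x| <= eta.
Proof.
split.
  move=> /subspace_continuousP H x Ax eta eta0.
  have /cvgrPdist_le/(_ _ eta0) := H x Ax; rewrite near_withinE => /nbhs_radiusP[r r0 K].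
  by exists r => // y Ay yx; rewrite distrC; exact: K.
move=> H; apply/subspace_continuousP => x Ax; apply/cvgrPdist_le => eta eta0.
have [r r0 K] := H x Ax _ eta0; rewrite near_withinE; apply/nbhs_radiusP.
by exists r => // y yx Ay; rewrite distrC; exact: K.
Qed.

Lemma prod_norm_lt (V W : normedModType R) (z : V * W) (r : R) :
  (`|z| < r) = (`|z.1| < r) && (`|z.2| < r).
Proof. by rewrite prod_normE gt_max. Qed.

Lemma dotxx_eq1_enorm (q : 'rV[R]_n) : dot q q = 1 -> enorm q = 1.
Proof.
by move=> qq; apply/eqP; rewrite -(@eqrXn2 _ 2) ?enorm_ge0// enorm_sqr qq expr1n.
Qed.

Lemma enorm_continuous : continuous (@enorm R n).
Proof.
move=> x; rewrite /enorm; apply: (@continuous_comp _ _ _ (fun x : 'rV[R]_n => \sum_i x ord0 i ^+ 2) (@Num.sqrt R)).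
  apply: continuous_sum_ord => i.
  apply: (@continuous_comp _ _ _ (fun y : 'rV[R]_n => y ord0 i) (fun r => r ^+ 2)).
    exact: coord_continuous.
  exact: exprn_continuous.
exact: sqrt_continuous.
Qed.

(** With r = |z| and s the norm on the left, the right side is r + (s^2 - r^2) / (2 r), which
    exceeds s by (s - r)^2 / (2 r). This global bound replaces a second-order expansion of the
    norm. *)
Lemma enorm_line_le (z xi : 'rV[R]_n) (t : R) : 0 < enorm z ->
  enorm (z + t *: xi) <= enorm z + t * (dot z xi / enorm z)
     + t ^+ 2 * (dot xi xi / (2 * enorm z)).
Proof.
move=> r0; set r := enorm z; set s := enorm _.
have : s ^+ 2 = r ^+ 2 + 2 * t * dot z xi + t ^+ 2 * dot xi xi.
  by rewrite !enorm_sqr !dotE (dotC xi z); ring.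
move=> H; rewrite -subr_ge0.
have -> : r + t * (dot z xi / r) + t ^+ 2 * (dot xi xi / (2 * r)) - s =
   ((s - r) ^+ 2) / (2 * r).
  apply/eqP; rewrite -subr_eq0; apply/eqP.
  transitivity ((r ^+ 2 + 2 * t * dot z xi + t ^+ 2 * dot xi xi - s ^+ 2) / (2 * r)).
    by field; rewrite gt_eqF.
  by rewrite H subrr mul0r.
by rewrite divr_ge0 ?sqr_ge0// mulr_ge0// ltW.
Qed.

Lemma bilNN (X : 'M[R]_n) x : bil X (- x) (- x) = bil X x x.
Proof. by rewrite -scaleN1r bilZl bilZr !mulN1r opprK. Qed.

(* At an interior maximum of [v x - v y - phi |x - y|], moving both points by
   [xi] gives [X - Y <= 0], and moving them along [q] and [-q], with
   [q = (x - y) / |x - y|], gives [(X - Y)(q, q) <= 4 phi'' < 0]. Both points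
   carry the gradient [phi' q], so the two equations have equal coefficients. *)
Lemma interior_lipschitz Omega v (D C : R) :
  1 < p -> 0 < e -> open Omega -> Omega !=set0 -> compact (closure Omega) ->
  {within closure Omega, continuous v} -> jet_solution p e Omega v ->
  0 <= D -> 0 <= C ->
  (forall x y, closure Omega x -> closure Omega y -> enorm (x - y) <= D) ->
  (forall x y, closure Omega x -> boundary Omega y -> `|v x - v y| <= C * enorm (x - y)) ->
  elipschitz_on Omega v (C + D).
Proof.
move=> p1 e0 oO [x0 Ox0] cO cv jv D0 C0 diam bdry.
(* On [0, D] this profile dominates [C * s], which excludes boundary maxima, and has slope at least
   [C]; its second derivative - 1 supplies the strictness. *)
pose phi s : R := (C + D) * s - s ^+ 2 / 2.
suff H : forall x y, closure Omega x -> closure Omega y -> v x - v y <= phi (enorm (x - y)).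
  have phi_le s : phi s <= (C + D) * s by rewrite /phi; have := sqr_ge0 s; lra.
  move=> x y cx cy; rewrite ler_norml; apply/andP; split.
    have := H y x cy cx; rewrite enorm_distC => h.
    by have := phi_le (enorm (x - y)); lra.
  by apply: le_trans (H x y cx cy) _.
pose F (z : 'rV[R]_n * 'rV[R]_n) := v z.1 - v z.2 - phi (enorm (z.1 - z.2)).
set K := closure Omega `*` closure Omega.
have cK : compact K by exact: compact_setX.
have cphi : continuous (fun z : 'rV[R]_n * 'rV[R]_n => phi (enorm (z.1 - z.2))).
  move=> z; apply: (@continuous_comp _ _ _ (fun z : 'rV[R]_n * 'rV[R]_n => z.1 - z.2)
       (fun z => phi (enorm z))).
    by apply: cvgB; [exact: cvg_fst|exact: cvg_snd].
  apply: (@continuous_comp _ _ _ (@enorm R n) phi); first exact: enorm_continuous.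
  rewrite /phi => s; apply: cvgB; first by apply: cvgMl_tmp; exact: cvg_id.
  apply: cvgMr_tmp; rewrite expr2; under eq_fun do rewrite expr2.
  by apply: cvgM; exact: cvg_id.
have cF : {within K, continuous F}.
  have K1 : {within K, continuous (fun z => v z.1)}.
    apply/within_continuous_epsP => -[a b] [/= ca cb] eta eta0.
    have /within_continuous_epsP/(_ a ca eta eta0)[d d0 Kd] := cv.
    exists d => // -[a' b'] [/= ca' cb']; rewrite prod_norm_lt => /andP[/= h _].
    exact: Kd.
  have K2 : {within K, continuous (fun z => v z.2)}.
    apply/within_continuous_epsP => -[a b] [/= ca cb] eta eta0.
    have /within_continuous_epsP/(_ b cb eta eta0)[d d0 Kd] := cv.
    exists d => // -[a' b'] [/= ca' cb']; rewrite prod_norm_lt => /andP[/= _ h].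
    exact: Kd.
  move=> z; apply: cvgB; first by apply: cvgB; [exact: K1|exact: K2].
  exact: (continuous_subspaceT cphi).
have K0 : K !=set0 by exists (x0, x0); split; exact: subset_closure.
have [[x y]] := compact_EVT_max K0 cK cF; rewrite inE => -[/= cx cy] maxF.
suff Fc : F (x, y) <= 0.
  move=> x' y' cx' cy'; have : F (x', y') <= 0.
    by apply: le_trans Fc; apply: maxF; rewrite inE.
  by rewrite /F/=; lra.
rewrite leNgt; apply/negP => Fpos.
have phi_ge s : 0 <= s <= D -> C * s <= phi s by rewrite /phi => /andP[]; nra.
have Fb x' y' : closure Omega x' -> closure Omega y' ->
    `|v x' - v y'| <= C * enorm (x' - y') -> F (x', y') <= 0.
  move=> cx' cy'; rewrite ler_norml => /andP[_ h].
  have := phi_ge (enorm (x' - y')); rewrite enorm_ge0 diam// => /(_ isT).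
  by rewrite /F/=; lra.
have Oy : Omega y.
  apply: contrapT => nO; move: Fpos; apply/negP; rewrite -leNgt; apply: Fb => //.
  by apply: bdry => //; apply/boundaryE.
have Ox : Omega x.
  apply: contrapT => nO; move: Fpos; apply/negP; rewrite -leNgt; apply: Fb => //.
  by rewrite distrC enorm_distC; apply: bdry => //; apply/boundaryE.
(* A positive maximum is off the diagonal because [phi 0 = 0]; dividing by [r] is then
   legitimate. *)
set z := x - y; set r := enorm z.
have r0 : 0 < r.
  rewrite enorm_gt0; apply/eqP => z0; move: Fpos; rewrite /F/= -/z z0.
  have /eqP -> : enorm (0 : 'rV[R]_n) == 0 by rewrite enorm_eq0.
  have -> : x = y by apply/eqP; rewrite -subr_eq0 -/z z0.
  by rewrite /phi mulr0 expr0n/= mul0r !subrr ltxx.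
have rD : r <= D by exact: diam.
set q := r^-1 *: z.
have qq : dot q q = 1.
  by rewrite dotZl dotZr -enorm_sqr -/r; field; rewrite gt_eqF.
have [b [X [jX eX]]] := jv _ Ox.
have [b' [Y [jY eY]]] := jv _ Oy.
have move_pts xi eta : exists2 d : R, 0 < d & forall t, `|t| < d ->
    v (x + t *: xi) - v (y + t *: eta) <=
    v x - v y + (phi (enorm (z + t *: (xi - eta))) - phi r).
  have [d1 d10 K1] := open_line xi oO Ox.
  have [d2 d20 K2] := open_line eta oO Oy.
  exists (Num.min d1 d2); first by rewrite lt_min d10.
  move=> t; rewrite lt_min => /andP[/K1 /subset_closure O1 /K2 /subset_closure O2].
  have := maxF (x + t *: xi, y + t *: eta); rewrite inE => /(_ (conj O1 O2)).
  rewrite /F/= -/z -/r.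
  have -> : x + t *: xi - (y + t *: eta) = z + t *: (xi - eta).
    by rewrite opprD addrACA scalerBr.
  by lra.
set dphi := C + D - r.
have dphi0 : 0 <= dphi by rewrite /dphi; lra.
(* [phi] lies below its tangent at [r], whose slope [dphi] is nonnegative, so the upper bound
   [enorm_line_le] for the norm can be inserted. *)
have phi_line xi : forall t, phi (enorm (z + t *: xi)) - phi r <=
    dphi * dot q xi * t + dphi * (dot xi xi / r) / 2 * t ^+ 2.
  move=> t; have := enorm_line_le xi t r0; rewrite -/r; set s := enorm _.
  have -> : dot q xi = dot z xi / r by rewrite dotZl mulrC.
  set A := dot z xi / r; set B := dot xi xi.
  have -> : B / (2 * r) = (B / r) / 2 by field; rewrite gt_eqF.
  set B' := B / r => hs.
  have : dphi * (s - r) <= dphi * (t * A + t ^+ 2 * (B' / 2)) by rewrite ler_wpM2l//; lra.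
  by rewrite /phi /dphi; have := sqr_ge0 (s - r); nra.
have bE : b = dphi *: q.
  apply/rowP => i; rewrite -(dot_basis b) -(dot_basis (dphi *: q)) dotZl.
  have [d d0 Kd] := move_pts (basis_rV R i) 0.
  have /taylor2_le := jX (basis_rV R i).
  case/(_ (dphi * dot q (basis_rV R i))
      (dphi * (dot (basis_rV R i) (basis_rV R i) / r))) => //.
  exists d => // t /Kd; rewrite scaler0 addr0 subr0 scale0r addr0.
  by have := phi_line (basis_rV R i) t; lra.
have XYle xi : dot (b - b') xi = 0 /\ bil (X - Y) xi xi <= 0.
  have [d d0 Kd] := move_pts xi xi.
  have /taylor2_le := taylor2B (jX xi) (jY xi).
  case/(_ 0 0) => [|h1 h2]; last by rewrite dotBl bilBm; split; lra.
  exists d => // t /Kd; rewrite subrr scaler0 addr0 -/r subrr addr0 !scale0r !addr0.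
  by rewrite !mul0r !addr0.
have bb' : b = b'.
  apply/rowP => i; have := (XYle (basis_rV R i)).1.
  by rewrite dot_basis !mxE => /eqP; rewrite subr_eq0 => /eqP.
have Zqq : bil (X - Y) q q <= -4.
  (* Moving the two points apart along [q] changes the distance by exactly 2 t, so the profile
     contributes the second derivative 4 phi'' = - 4. *)
  have [d d0 Kd] := move_pts q (- q).
  have /taylor2_le := taylor2B (jX q) (jY (- q)).
  case/(_ (2 * dphi) (- 4)) => [|_].
    exists (Num.min d (r / 2)); first by rewrite lt_min d0 divr_gt0.
    move=> t; rewrite lt_min => /andP[/Kd + tr]; rewrite !scale0r !addr0.
    have -> : enorm (z + t *: (q - - q)) = r + 2 * t.
      have -> : z + t *: (q - - q) = ((r + 2 * t) / r) *: z.
        rewrite opprK scalerDr -scalerDl /q scalerA -[X in X + _]scale1r -scalerDl.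
        by congr (_ *: _); field; rewrite gt_eqF.
      have rt : 0 <= r + 2 * t by move: tr; rewrite ltr_norml => /andP[]; lra.
      apply/eqP; rewrite -(@eqrXn2 _ 2) ?enorm_ge0// enorm_sqr dotZl dotZr -enorm_sqr -/r.
      by apply/eqP; field; rewrite gt_eqF.
    by rewrite /phi /dphi; lra.
  by rewrite bilNN bilBm; lra.
(* The difference of the two equations splits as [tr Z - Z(q, q)] + (1 + ellip |b|^2) Z(q, q) with Z
   = X - Y. The first bracket is the borderline case [c = -1] of ellipticity, nonpositive; the
   second term is negative, so the sum cannot be 0. *)
have trZ : \tr (X - Y) + (-1) * bil (X - Y) q q <= 0.
  apply: elliptic_le0 => [|xi]; last exact: (XYle xi).2.
  by rewrite qq mulr1 subrr.
have bilb (W : 'M[R]_n) : bil W b b = dphi ^+ 2 * bil W q q.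
  by rewrite bE bilZl bilZr; ring.
have := eY; rewrite -bb'; move: eX; rewrite !bilb.
have [] : Num.min 1 (p - 1) <= 1 + ellip p e b * dot b b /\ 0 < 1 + ellip p e b * dot b b.
  by apply: ellip_gt => //; rewrite dotxx_ge0/=.
rewrite [in dot b b]bE dotZl dotZr qq mulr1.
move=> _; move: trZ Zqq; rewrite linearB/= !bilBm => h1 h2 h3 h4 h5.
have : (1 + ellip p e b * (dphi * dphi)) * (bil X q q - bil Y q q) < 0.
  by rewrite pmulr_rlt0//; lra.
by move: h1 h4 h5; lra.
Qed.

End interior_lipschitz.

(** * Supporting hyperplanes, compactness and the global Lipschitz bound *)

Section uniform_lipschitz.
Variables (R : realType) (n : nat).
Implicit Types (v f g : 'rV[R]_n -> R) (Omega U : set 'rV[R]_n) (x y : 'rV[R]_n).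

Lemma closure_radiusP Omega x : closure Omega x <->
  forall r : R, 0 < r -> exists2 y, Omega y & `|y - x| < r.
Proof.
split=> [cx r r0|H B /nbhs_radiusP[r r0 K]].
  have [|y [Oy yx]] := cx [set y | `|y - x| < r]; first by apply/nbhs_radiusP; exists r.
  by exists y.
by have [y Oy yx] := H r r0; exists y; split => //; exact: K.
Qed.

Lemma convex_segment Omega x y (t : R) : open Omega -> convex_set Omega ->
  Omega x -> closure Omega y -> 0 < t <= 1 -> Omega (y + t *: (x - y)).
Proof.
move=> oO cvO Ox /closure_radiusP cy /andP[t0 t1].
have /nbhs_radiusP[r r0 K] : nbhs x Omega by exact: open_nbhs_nbhs.
have [|y' Oy' y'y] := cy (t * r); first exact: mulr_gt0.
(* The approximation [y'] of [y] lies in Omega, and [x] is shifted so that t x' + (1 - t) y' is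
   still the target point; [y'] is taken so close that [x'] stays in the ball around [x]. *)
pose x' := x + ((1 - t) / t) *: (y - y').
have Ox' : Omega x'.
  apply: K; rewrite /x' addrC addKr normrZ distrC.
  rewrite ger0_norm ?divr_ge0 ?subr_ge0 ?(ltW t0)// mulrAC ltr_pdivrMr// (mulrC r).
  by apply: le_lt_trans y'y; rewrite ler_piMl// gerBl ltW.
have := cvO x' y' (Itv01 (ltW t0) t1); rewrite !inE => /(_ Ox' Oy').
rewrite /conv/= /x'; congr Omega.
apply/rowP => i; rewrite !mxE /unstable.onem; field; by rewrite gt_eqF.
Qed.

(** The normal is the gradient of a local defining function [rho]. If some [x] of Omega lay strictly
    on its outer side, [rho] would grow at first order from [rho y >= 0] along the segment towards
    [x], yet convexity keeps that segment in Omega, where [rho < 0]. Points of the closure follow by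
    approximation. *)
Lemma supporting_normal Omega y : smooth_convex_domain Omega -> boundary Omega y ->
  exists2 nu, dot nu nu = 1 & forall x, closure Omega x -> 0 <= dot nu (y - x).
Proof.
move=> [oO _ _ cvO sO] By; have [rho [U [oU Uy sr gr rhoO]]] := sO _ By.
have [cy nOy] := (boundaryE _ oO).1 By.
have G0 : 0 < enorm (grad rho y) by rewrite enorm_gt0 gr.
exists ((enorm (grad rho y))^-1 *: grad rho y).
  by rewrite dotZl dotZr -enorm_sqr; field; rewrite gt_eqF.
suff H x : Omega x -> dot (grad rho y) (x - y) <= 0.
  move=> x /closure_radiusP cx; rewrite dotZl pmulr_rge0 ?invr_gt0//.
  rewrite leNgt; apply/negP => neg.
  have := neg; rewrite -oppr_gt0; set m := - _ => m0.
  pose S := \sum_i `|grad rho y ord0 i|.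
  have S0 : 0 < S + 1 by rewrite ltr_pwDr// sumr_ge0.
  have [|x' Ox' x'x] := cx (m / (S + 1)); first exact: divr_gt0.
  have := H _ Ox'; apply/negP; rewrite -ltNge.
  have -> : x' - y = (x - y) + (x' - x).
    by apply/rowP => i; rewrite !mxE; ring.
  rewrite dotDr; have -> : dot (grad rho y) (x - y) = m.
    by rewrite /m !dotE; ring.
  rewrite ltr_pdivlMr// in x'x.
  have : `|dot (grad rho y) (x' - x)| <= S * `|x' - x|.
    rewrite mulr_suml; apply: le_trans (ler_norm_sum _ _ _) _; apply: ler_sum => i _.
    by rewrite normrM ler_wpM2l// coord_le_norm.
  rewrite ler_norml => /andP[h _]; have := normr_ge0 (x' - x); nra.
move=> Ox; rewrite leNgt; apply/negP => pos.
have C1 : Ck 1 U rho by exact: sr.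
have /is_derive_epsP := is_derive_dot_grad (x - y) oU Uy C1.
rewrite dotC; set m := dot _ _ in pos *.
move=> /(_ (m / 2))[|d d0 K]; first by rewrite divr_gt0.
have [d' d'0 K'] := open_line (x - y) oU Uy.
pose t := Num.min 1 (Num.min (d / 2) (d' / 2)).
have t0 : 0 < t by rewrite !lt_min ltr01 !divr_gt0.
have t1 : t <= 1 by rewrite ge_min lexx.
have td : t <= d / 2 by rewrite !ge_min lexx orbT.
have td' : t <= d' / 2 by rewrite !ge_min lexx !orbT.
have tn : `|t| = t by rewrite gtr0_norm.
have /K : `|t| < d by rewrite tn; lra.
rewrite tn ler_norml => /andP[+ _].
have Ot : Omega (y + t *: (x - y)) by apply: convex_segment => //; rewrite t0.
have Ut : U (y + t *: (x - y)) by apply: K'; rewrite tn; lra.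
have := (rhoO _ Ut).1 Ot.
have : 0 <= rho y by rewrite leNgt; apply/negP => /(rhoO _ Uy).2.
have : 0 < t * m by rewrite mulr_gt0.
lra.
Qed.

Lemma bounded_closure Omega : bounded_set Omega ->
  exists2 r : R, 0 < r & forall x, closure Omega x -> `|x| <= r.
Proof.
move=> /pinfty_ex_gt0[r r0 Kr]; exists (r + 1) => [|x /closure_radiusP cx].
  by rewrite addr_gt0.
have [y Oy yx] := cx 1 ltr01.
have -> : x = y - (y - x) by rewrite opprB addrC subrK.
by apply: le_trans (ler_normB _ _) _; rewrite lerD//; [exact: Kr|exact: ltW].
Qed.

Lemma compact_closure Omega : bounded_set Omega -> compact (closure Omega).
Proof.
move=> /bounded_closure[r r0 Kr]; apply: bounded_closed_compact; last exact: closed_closure.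
by exists r; split; [exact: num_real|move=> s rs x /Kr /le_trans; apply; exact: ltW].
Qed.

Lemma compact_bound_fun (T : topologicalType) (K : set T) (f : T -> R) : compact K ->
  {within K, continuous f} -> exists2 M : R, 0 < M & forall a, K a -> `|f a| <= M.
Proof.
move=> cK cf.
have /compact_bounded/pinfty_ex_gt0[M M0 KM] := continuous_compact cf cK.
by exists M => // x Kx; apply: KM; exists x.
Qed.

Lemma compact_norm_ball (r : R) : compact [set x : 'rV[R]_n | `|x| <= r].
Proof.
apply: bounded_closed_compact.
  by exists r; split; [exact: num_real|move=> s rs x /= /le_trans; apply; exact: ltW].
have -> : [set x : 'rV[R]_n | `|x| <= r] = (fun x => `|x|) @^-1` [set s | s <= r] by [].
by apply: preimage_closed; [move=> x _; exact: norm_continuous|exact: closed_le].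
Qed.

Lemma sum_bound_fun (K : set 'rV[R]_n) m (f : 'I_m -> 'rV[R]_n -> R) : compact K ->
  (forall i, continuous (f i)) ->
  exists2 M : R, 0 < M & forall x, K x -> \sum_i `|f i x| <= M.
Proof.
move=> cK cf.
have [|M M0 KM] := @compact_bound_fun _ K (fun x => \sum_i `|f i x|) cK.
  apply: continuous_subspaceT => x; apply: continuous_sum_ord => i.
  by apply: (@continuous_comp _ _ _ (f i) (@Num.norm _ _)); [exact: cf|exact: norm_continuous].
by exists M => // x /KM; rewrite ger0_norm// sumr_ge0.
Qed.

Lemma C1_lipschitz_on_ball f (r : R) : Ck 1 setT f ->
  exists2 L : R, 0 < L & forall x y, `|x| <= r -> `|y| <= r ->
    `|f x - f y| <= L * enorm (x - y).
Proof.
move=> Cf; have [_ df] := Cf.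
have [|L L0 KL] := @sum_bound_fun _ _ (fun i => partial i f) (@compact_norm_ball r).
  by move=> i x; have [_ [+ _]] := df i; apply.
exists L => // x y xr yr.
have dl (t : R) : is_derive t 1 (fun t : R => f (y + t *: (x - y)))
    (dot (x - y) (grad f (y + t *: (x - y)))).
  by apply: is_derive_line; apply: is_derive_dot_grad Cf => //; exact: openT.
have [|c c01] := @MVT R (fun t => f (y + t *: (x - y)))
    (fun t => dot (x - y) (grad f (y + t *: (x - y)))) 0 1 ltr01.
  apply: continuous_subspaceT => t; apply: differentiable_continuous.
  by apply/derivable1_diffP; exact: ex_derive.
have -> : y + 1 *: (x - y) = x by rewrite scale1r addrC subrK.
rewrite subr0 mulr1 scale0r addr0 => ->.
move: c01; rewrite in_itv/= => /andP[c0 c1].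
set z := y + c *: (x - y).
have /KL zL : `|z| <= r.
  have -> : z = (1 - c) *: y + c *: x.
    by rewrite /z scalerBr scalerBl scale1r addrA addrAC.
  apply: le_trans (ler_normD _ _) _; rewrite !normrZ (gtr0_norm c0) (@gtr0_norm _ (1 - c)) ?subr_gt0//.
  have : (1 - c) * `|y| <= (1 - c) * r by rewrite ler_wpM2l// subr_ge0 ltW.
  have : c * `|x| <= c * r by rewrite ler_wpM2l// ltW.
  by lra.
apply: le_trans (_ : \sum_i `|partial i f z| * enorm (x - y) <= _); last first.
  by rewrite -mulr_suml ler_wpM2r// enorm_ge0.
apply: le_trans (ler_norm_sum _ _ _) _; apply: ler_sum => i _.
by rewrite normrM mulrC [grad f z ord0 i]mxE ler_wpM2l// coord_le_enorm.
Qed.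

Lemma normal_dot_le (nu z : 'rV[R]_n) : dot nu nu = 1 -> dot nu z <= enorm z.
Proof.
by move=> nu1; have := cauchy_schwarz nu z; rewrite (dotxx_eq1_enorm nu1) mul1r.
Qed.

Lemma elipschitz_within_continuous Omega v (L : R) :
  elipschitz_on Omega v L -> {within closure Omega, continuous v}.
Proof.
move=> H; apply/within_continuous_epsP => x cx eta eta0.
pose M := n%:R * `|L| + 1; have M0 : 0 < M by rewrite ltr_pwDr// mulr_ge0.
exists (eta / M) => [|y cy]; first exact: divr_gt0.
rewrite ltr_pdivlMr// => yx; apply: le_trans (H _ _ cy cx) _; apply: ltW.
apply: le_lt_trans yx; apply: le_trans (_ : `|L| * (n%:R * `|y - x|) <= _).
  apply: le_trans (ler_wpM2r (enorm_ge0 _) (ler_norm L)) _.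
  by rewrite ler_wpM2l ?enorm_le_norm.
by rewrite /M; have := normr_ge0 (y - x); lra.
Qed.

Lemma stationary_within_continuous (p e : R) Omega g v :
  stationary_solution p e Omega g v -> {within closure Omega, continuous v}.
Proof.
move=> [/pinfty_ex_gt0[k k0 Hk] _ _ _ _].
apply: (@elipschitz_within_continuous _ _ k) => x y cx cy.
have /= := Hk (x, y) (conj cx cy) => /le_trans; apply.
by rewrite ler_wpM2l ?norm_le_enorm// ltW.
Qed.

(** Every constant is fixed before [e]: the diameter bound [D], the Hessian bound [M] and Lipschitz
    constant [LG] of the extension [h] of [g], the barrier height [K] and the boundary slope [C]. *)
Lemma uniform_lipschitz (p : R) Omega g : 1 < p -> smooth_convex_domain Omega ->
  Ck_closure 2 Omega g -> exists2 L : R, 0 < L & forall e v, 0 < e ->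
    stationary_solution p e Omega g v -> elipschitz_on Omega v L.
Proof.
move=> p1 dom [h Ch hg]; have [oO O0 bO cvO sO] := dom.
have cO := compact_closure bO.
have [r r0 Kr] := bounded_closure bO.
pose D := n%:R * (2 * r).
have D0 : 0 <= D by rewrite !mulr_ge0// ltW.
have diam x y : closure Omega x -> closure Omega y -> enorm (x - y) <= D.
  move=> /Kr xr /Kr yr; apply: le_trans (enorm_le_norm _) _.
  rewrite ler_wpM2l//; apply: le_trans (ler_normB _ _) _; lra.
have [LG LG0 HL] := @C1_lipschitz_on_ball h r (Ck_le (leqnSn 1) Ch).
have chess i j : continuous (fun x => hessian h x i j).
  move=> x; have -> : (fun x => hessian h x i j) = partial j (partial i h).
    by apply/funext => y; rewrite mxE.
  by case: Ch => _ /(_ i)[_ [_ /(_ j)[_ [+ _]]]]; apply.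
have [M M0 HM] : exists2 M : R, 0 < M & forall x, closure Omega x ->
    \sum_i \sum_j `|hessian h x i j| <= M.
  have [|M M0 KM] := @compact_bound_fun _ (closure Omega)
      (fun x => \sum_i \sum_j `|hessian h x i j|) cO.
    apply: continuous_subspaceT => x; apply: continuous_sum_ord => i.
    apply: continuous_sum_ord => j.
    by apply: (@continuous_comp _ _ _ (fun x => hessian h x i j) (@Num.norm _ _)); [exact: chess|exact: norm_continuous].
  by exists M => // x /KM; rewrite ger0_norm// sumr_ge0// => i _; rewrite sumr_ge0.
set lam := Num.min 1 (p - 1); have lam0 : 0 < lam by rewrite lt_min; lra.
(* Chosen so that [K * lam] exceeds [(1 + |p - 2|) * M] by 1, the strict inequality required by the
   barrier. *)
pose K := ((1 + `|p - 2|) * M + 1) / lam.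
have K0 : 0 <= K.
  by rewrite divr_ge0 ?ltW// addr_gt0// mulr_gt0// ltr_pwDl.
have KM : (1 + `|p - 2|) * M < K * lam.
  by rewrite /K divfK ?gt_eqF// ltrDl ltr01.
pose C := LG + K * D.
have C0 : 0 <= C by exact: addr_ge0 (ltW LG0) (mulr_ge0 K0 D0).
have ch : {within closure Omega, continuous h}.
  by apply: continuous_subspaceT => x; case: Ch => + _; apply.
have Lh x y : closure Omega x -> closure Omega y -> `|h x - h y| <= LG * enorm (x - y).
  by move=> /Kr xr /Kr yr; exact: HL.
have jh x : Omega x -> exists b H, jet2 h x b H /\ \sum_i \sum_j `|H i j| <= M.
  move=> Ox; exists (grad h x), (hessian h x); split; last exact/HM/subset_closure.
  exact: jet2_C2 openT _ Ch.
have jhN x : Omega x -> exists b H, jet2 (fun y => - h y) x b H /\ \sum_i \sum_j `|H i j| <= M.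
  move=> /jh[b [H [jH sH]]]; exists (- b), (- H); split; first exact: jet2N.
  by under eq_bigr do under eq_bigr do rewrite mxE normrN.
exists (C + D + 1) => [|e v e0 sv]; first by rewrite ltr_pwDr// addr_ge0.
have cv := stationary_within_continuous sv.
have jv := jet_solution_stationary e0 oO sv.
have vh x : boundary Omega x -> v x = h x.
  by move=> Bx; have [_ _ _ _ ->] := sv => //; rewrite hg//; case: Bx.
have bdry x y : closure Omega x -> boundary Omega y -> `|v x - v y| <= C * enorm (x - y).
  move=> cx By; have cy : closure Omega y by case: By.
  have [nu nu1 Hnu] := supporting_normal dom By.
  have nuD z : closure Omega z -> 0 <= dot nu (y - z) <= D.
    move=> cz; rewrite Hnu//=; apply: le_trans (normal_dot_le _ nu1) _; exact: diam.
  have nux := normal_dot_le (y - x) nu1; rewrite enorm_distC in nux.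
  have up := barrier_upper p1 e0 oO O0 cO cv ch jv jh vh nu1 nuD K0 KM cx.
  have cvN : {within closure Omega, continuous (fun x => - v x)}.
    by move=> z; apply: cvgN; exact: cv.
  have chN : {within closure Omega, continuous (fun x => - h x)}.
    by move=> z; apply: cvgN; exact: ch.
  (* The lower barrier is the upper one for [- v] and [- h], as the equation is odd. *)
  have dn := barrier_upper p1 e0 oO O0 cO cvN chN (jet_solutionN jv) jhN
     (fun x Bx => congr1 -%R (vh x Bx)) nu1 nuD K0 KM cx.
  have := Lh x y cx cy; rewrite (vh _ By) !ler_norml => /andP[h1 h2].
  have d0 := Hnu _ cx; move: up dn; set d := dot nu (y - x) in d0 nux *.
  have : K * (D * d - d ^+ 2 / 2) <= K * D * enorm (x - y).
    rewrite -mulrA ler_wpM2l//; have : D * d <= D * enorm (x - y) by rewrite ler_wpM2l.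
    by have := sqr_ge0 d; lra.
  by rewrite /C => *; apply/andP; split; lra.
move=> x y cx cy.
have := interior_lipschitz p1 e0 oO O0 cO cv jv D0 C0 diam bdry cx cy => /le_trans; apply.
by rewrite ler_wpM2r ?enorm_ge0// lerDl.
Qed.

End uniform_lipschitz.

(** * Borel sets, translations and integration by parts on row vectors *)

Section borel_rV.
Variables (R : realType) (n : nat).
Implicit Types (U : set 'rV[R]_n) (x y : 'rV[R]_n).

Lemma norm_rV_ltP x (r : R) : 0 < r -> (`|x| < r <-> forall i, `|x ord0 i| < r).
Proof.
have -> : `|x| = \big[Num.max/0]_ij `|x ij.1 ij.2| by exact: mx_normrE.
move=> r0; split => [/bigmax_ltP[_ H] i|H]; first exact: (H (ord0, i)).
by apply/bigmax_ltP; split => //= -[a i] _ /=; rewrite ord1.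
Qed.

Definition rat_box : countType := ('rV[rat]_n * nat)%type.

Definition box_center (i : rat_box) : 'rV[R]_n := map_mx ratr i.1.

Definition box_radius (i : rat_box) : R := i.2.+1%:R^-1.

Lemma box_radius_gt0 i : 0 < box_radius i.
Proof. by rewrite invr_gt0. Qed.

(** The inner radius is smaller than the outer one by the factor n + 1 because the sup norm and the
    Euclidean norm differ by at most n: the Euclidean bump attached to the box will then be positive
    at [x]. *)
Lemma rat_box_cover U x : open U -> U x -> exists i : rat_box,
  `|x - box_center i| < box_radius i / n.+1%:R /\
  forall y, `|y - box_center i| <= box_radius i -> U y.
Proof.
move=> oU Ux; have /nbhs_radiusP[r r0 K] : nbhs x U by exact: open_nbhs_nbhs.
have r20 : 0 < r / 2 by rewrite divr_gt0.
have [m mr] : exists m : nat, m.+1%:R^-1 < r / 2.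
  have [m _ /(_ _ (leqnn m))] := near_infty_natSinv_lt (PosNum r20).
  by exists m.
pose s : R := m.+1%:R^-1 / n.+1%:R.
have s0 : 0 < s by rewrite divr_gt0.
have H i : exists q : rat, `|x ord0 i - ratr q| < s.
  have [|q] := @rat_in_itvoo R (x ord0 i - s) (x ord0 i + s); first by lra.
  by rewrite in_itv/= => /andP[? ?]; exists q; rewrite ltr_norml; lra.
have [q Hq] := boolp.choice H.
exists (\row_i q i, m); rewrite /box_center /box_radius/=.
have xq : `|x - map_mx ratr (\row_i q i)| < s.
  by apply/norm_rV_ltP => // i; rewrite !mxE.
split => // y yq; apply: K.
set c := map_mx _ _ in xq yq.
have -> : y - x = (y - c) + (c - x) by rewrite addrA subrK.
apply: le_lt_trans (ler_normD _ _) _; rewrite distrC in xq.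
have sm : s <= m.+1%:R^-1 by rewrite ler_piMr ?invr_ge0// invf_le1 ?ler1n.
by apply: lt_le_trans (ler_ltD yq xq) _; rewrite [leRHS]splitr lerD ?(le_trans sm)// ltW.
Qed.

Lemma measurable_norm_ball x (r : R) : measurable [set y : 'rV[R]_n | `|y - x| < r].
Proof.
have [r0|r0] := lerP r 0.
  rewrite (_ : [set _ | _] = set0)//; apply/seteqP; split => y //=.
  by move=> /(le_lt_trans (normr_ge0 _)); rewrite ltNge r0.
rewrite (_ : [set y | _] = \big[setI/setT]_(i < n)
    (rV_coord i @^-1` [set t | `|t - x ord0 i| < r])).
  apply: bigsetI_measurable => i _; rewrite -[X in measurable X]setTI.
  apply: measurable_rV_coord => //.
  rewrite (_ : [set t | _] = ball (x ord0 i) r); first by apply: open_measurable; exact: ball_open.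
  by apply/seteqP; split => t; rewrite /ball/= distrC.
apply/seteqP; split => y.
  move=> /(norm_rV_ltP _ r0) H; rewrite -bigcap_seq => i _ /=.
  by have := H i; rewrite !mxE.
rewrite -bigcap_seq => H; apply/(norm_rV_ltP _ r0) => i; rewrite !mxE.
by apply: (H i); rewrite /= mem_index_enum.
Qed.

(** The measurable sets are generated by the coordinates, so open sets have to be reached through
    countably many rational boxes; boxes that do not fit in [U] contribute the empty set. *)
Lemma open_measurable_rV U : open U -> measurable U.
Proof.
move=> oU; pose inU (i : rat_box) := forall y, `|y - box_center i| <= box_radius i -> U y.
rewrite (_ : U = \bigcup_i ([set y | `|y - box_center i| < box_radius i / n.+1%:R] `&`
    [set y | inU i])).
  apply: countable_bigcupT_measurable => [|i]; first exact: countableP.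
  apply: measurableI; first exact: measurable_norm_ball.
  have [H|H] := pselect (inU i).
    by rewrite (_ : [set _ | inU i] = setT)//; apply/seteqP; split.
  by rewrite (_ : [set _ | inU i] = set0)//; apply/seteqP; split.
apply/seteqP; split => x; first by move=> /(rat_box_cover oU)[i [xi Hi]]; exists i.
move=> [i _ [/= xi]]; apply.
apply: ltW; apply: lt_le_trans xi _; rewrite ler_pdivrMr// ler_peMr ?ler1n//.
exact: ltW (box_radius_gt0 i).
Qed.

Lemma closed_measurable_rV U : closed U -> measurable U.
Proof.
move=> cU; rewrite -(setCK U); apply: measurableC; apply: open_measurable_rV.
exact: closed_openC.
Qed.

Lemma continuous_on_measurable U (f : 'rV[R]_n -> R) : open U ->
  (forall x, U x -> {for x, continuous f}) -> measurable_fun U f.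
Proof.
move=> oU cf; apply: (measurability _ (RGenOpens.measurableE R)).
move=> _ [_ [a [b ->] <-]]; apply: open_measurable_rV.
rewrite openE => x [Ux fx]; apply: filterI; first exact: open_nbhs_nbhs.
apply: cf => //; apply: open_nbhs_nbhs; split => //; exact: interval_open.
Qed.

End borel_rV.

(** * Translation invariance of the measure and volume of cubes *)

Section lebesgue_rV_theory.
Variable R : realType.
Implicit Types (n : nat).

Lemma lebesgue_measure_shift (a : R) (A : set R) : measurable A ->
  pushforward lebesgue_measure ((fun x => x + a) : R -> measurableTypeR R) A =
  lebesgue_measure A.
Proof.
move=> mA; apply/esym/lebesgue_measure_unique => //= [|_ _ [[b c]] _ <-].
  exact: (measurable_funD (@measurable_id _ _ setT) (@measurable_cst _ _ _ _ setT a)).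
rewrite /pushforward (_ : _ @^-1` _ = `]b - a, c - a]%classic).
  rewrite !lebesgue_measure_itv/= !lte_fin ltrD2r; case: ifP => // _.
  by rewrite !EFinB /= -!EFinB; congr (_%:E); ring.
apply/seteqP; split => x /=; rewrite !in_itv/=; lra.
Qed.

Lemma measurable_shift_rV n (h : 'rV[R]_n) :
  measurable_fun setT (fun x : 'rV[R]_n => x + h).
Proof.
apply: measurable_fun_rVP => i.
rewrite (_ : _ \o _ = (fun x => rV_coord i x + h ord0 i)); last first.
  by apply/funext => x; rewrite /rV_coord/= mxE.
by apply: measurable_funD; [exact: measurable_rV_coord|exact: measurable_cst].
Qed.

Lemma rV_consD n (z w : R * 'rV[R]_n) :
  rV_cons (z.1 + w.1, z.2 + w.2) = rV_cons z + rV_cons w.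
Proof. by rewrite /rV_cons/= raddfD/= -add_row_mx. Qed.

Lemma rV_cons_surj n (x : 'rV[R]_n.+1) : exists z, x = rV_cons z.
Proof.
exists (x ord0 ord0, rsubmx (x : 'rV_(1 + n))).
rewrite /rV_cons/=.
transitivity (row_mx (lsubmx (x : 'rV_(1 + n))) (rsubmx (x : 'rV_(1 + n)))).
  by rewrite hsubmxK.
suff -> : lsubmx (x : 'rV_(1 + n)) = (x ord0 ord0)%:M by [].
by apply/rowP => i; rewrite !mxE !ord1 eqxx mulr1n; congr (x _ _); exact: val_inj.
Qed.

(** Induction on the dimension: a section of the translated set is a translated section of the set,
    which the induction hypothesis absorbs; the remaining shift of the first variable is a change of
    variable for the measure on the line. *)
Lemma lebesgue_rV_shift n (h : 'rV[R]_n) (A : set 'rV[R]_n) : measurable A ->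
  lebesgue_rV R n ((fun x => x + h) @^-1` A) = lebesgue_rV R n A.
Proof.
elim: n h A => [|n IH] h A mA.
  congr (lebesgue_rV R 0 _); apply/seteqP; split => x /=;
  by rewrite (thinmx0 h) addr0.
have [w ->] := rV_cons_surj h.
rewrite /= /lebesgue_cons /pushforward.
set B := @rV_cons R n @^-1` A.
have mB : measurable B by rewrite -[B]setTI; exact: measurable_rV_cons.
transitivity (\int[@lebesgue_measure R]_x (lebesgue_rV R n (xsection B ((x : R) + w.1)%R)))%E.
  apply: eq_integral => x _ /=; rewrite -[RHS](IH w.2); last exact: measurable_xsection.
  congr (lebesgue_rV R n _); apply/seteqP; split => y; rewrite /xsection/= !inE/=.
    by rewrite /B/= -rV_consD.
  by rewrite /B/= -rV_consD.
pose f x := lebesgue_rV R n (xsection B x).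
have mf : measurable_fun setT f by exact: measurable_fun_xsection.
have ma : measurable_fun setT ((fun x => x + w.1) : measurableTypeR R -> measurableTypeR R).
  by apply: measurable_funD => //; exact: measurable_cst.
rewrite -(@ge0_integral_pushforward _ _ _ _ R _ ma lebesgue_measure setT f)//.
apply: eq_measure_integral => C mC _; exact: lebesgue_measure_shift.
Qed.

Lemma lebesgue_rV_cube n (r : R) : 0 <= r ->
  lebesgue_rV R n [set x | `|x| <= r] = ((2 * r) ^+ n)%:E.
Proof.
move=> r0; elim: n => [|n IH].
  rewrite /= diracE mem_set ?expr0//=.
  by rewrite normr0.
rewrite /= /lebesgue_cons /pushforward.
rewrite (_ : _ @^-1` _ = `[- r, r]%classic `*` [set x : 'rV[R]_n | `|x| <= r]).
  rewrite product_measure1E//.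
    transitivity (lebesgue_measure (`[(- r)%R, r%R]%classic : set R) * ((2 * r)%R ^+ n)%:E)%E.
      by rewrite -IH.
    rewrite lebesgue_measure_itv/= lte_fin.
    case: ltrP => rr; first by rewrite -EFinB -EFinM exprS; congr (_%:E); ring.
    by have -> : r = 0 by [lra]; rewrite mulr0 exprS mul0r mul0e.
  apply: closed_measurable_rV; exact: compact_closed (@compact_norm_ball R n r).
apply/seteqP; split => -[a x] /=.
  move=> /(norm_rV_leP _ r0) H; split.
    have := H (lshift n ord0 : 'I_(1 + n)).
    by rewrite /rV_cons (@row_mxEl _ _ 1 n) mxE eqxx mulr1n in_itv/= ler_norml.
  apply/norm_rV_leP => // i; have := H (rshift 1 i : 'I_(1 + n)).
  by rewrite /rV_cons (@row_mxEr _ _ 1 n).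
rewrite in_itv/= -ler_norml => -[ar /(norm_rV_leP _ r0) H].
apply/norm_rV_leP => // i; case: (@split_ordP 1 n i) => j ->.
  by rewrite /rV_cons/= (@row_mxEl _ _ 1 n) mxE [j]ord1 eqxx mulr1n.
by rewrite /rV_cons (@row_mxEr _ _ 1 n).
Qed.

Lemma Rintegral_shift n (h : 'rV[R]_n) (f : 'rV[R]_n -> R) :
  (lebesgue_rV R n).-integrable setT (EFin \o f) ->
  \int[lebesgue_rV R n]_x f (x + h) = \int[lebesgue_rV R n]_x f x.
Proof.
move=> intf; congr fine.
have mh := measurable_shift_rV h.
have mf : measurable_fun setT (EFin \o f) by exact: measurable_int intf.
pose tau (x : 'rV[R]_n) := x + h.
have inv (k : 'rV[R]_n -> \bar R) :
    (\int[pushforward (lebesgue_rV R n) tau]_x k x = \int[lebesgue_rV R n]_x k x)%E.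
  by apply: eq_measure_integral => A mA _; exact: lebesgue_rV_shift.
have inth : (lebesgue_rV R n).-integrable (tau @^-1` setT) ((EFin \o f) \o tau).
  rewrite preimage_setT; apply/integrableP; split; first exact: measurableT_comp.
  have /integrableP[_] := intf; rewrite -inv ge0_integral_pushforward//.
  exact: measurableT_comp.
by rewrite -[RHS]inv (integral_pushforward mh mf inth)// preimage_setT.
Qed.

Lemma integrable_bounded_support n (f : 'rV[R]_n -> R) (M r : R) :
  measurable_fun setT f -> (forall x, `|f x| <= M) -> (forall x, r < `|x| -> f x = 0) ->
  (lebesgue_rV R n).-integrable setT (EFin \o f).
Proof.
move=> mf fM fr.
pose D := [set x : 'rV[R]_n | `|x| <= Num.max r 0].
have mD : measurable D by apply: closed_measurable_rV; exact: compact_closed (@compact_norm_ball R n _).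
have -> : EFin \o f = (EFin \o f) \_ D.
  apply/funext => x; rewrite patchE; case: ifPn => //.
  rewrite notin_setE /D/= => /negP; rewrite le_max negb_or -!ltNge => /andP[/fr -> _].
  by [].
apply: (iffLR (integrable_mkcond _ mD)); apply: measurable_bounded_integrable => //.
- have m0 : 0 <= Num.max r 0 by rewrite le_max lexx orbT.
  have e : lebesgue_rV R n D = ((2 * Num.max r 0) ^+ n)%:E by exact: lebesgue_rV_cube.
  by apply: le_lt_trans (ltry ((2 * Num.max r 0) ^+ n)); rewrite -e.
- exact: measurable_funTS.
- by exists M; split; [exact: num_real|move=> s Ms x _; exact: le_trans (ltW Ms)].
Qed.

End lebesgue_rV_theory.

Section bounded_convergence.
Context d (T : measurableType d) (R : realType) (mu : {measure set T -> \bar R}).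
Implicit Types (D : set T) (f : T -> R).

Lemma Rintegral_vanish D f : (forall x, ~ D x -> f x = 0) ->
  \int[mu]_(x in D) f x = \int[mu]_x f x.
Proof.
move=> f0; rewrite Rintegral_mkcond; congr (Rintegral mu setT _).
by apply/funext => x; rewrite patchE; case: ifPn => //; rewrite notin_setE => /f0 ->.
Qed.

Lemma bounded_integrable D f (M : R) : measurable D -> (mu D < +oo)%E ->
  measurable_fun D f -> (forall x, D x -> `|f x| <= M) -> mu.-integrable D (EFin \o f).
Proof.
move=> mD Doo mf fM; apply: measurable_bounded_integrable => //.
by exists M; split; [exact: num_real|move=> s Ms x Dx; exact: le_trans (fM _ Dx) (ltW Ms)].
Qed.

Lemma bounded_convergence D (f_ : nat -> T -> R) f (M : R) :
  measurable D -> (mu D < +oo)%E ->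
  (forall k, measurable_fun D (f_ k)) -> measurable_fun D f ->
  {ae mu, forall x, D x -> f_ k x @[k --> \oo] --> f x} ->
  (forall k x, D x -> `|f_ k x| <= M) ->
  \int[mu]_(x in D) f_ k x @[k --> \oo] --> \int[mu]_(x in D) f x.
Proof.
move=> mD Doo mf_ mf cf fM.
have ig : mu.-integrable D (EFin \o cst `|M|).
  by apply: (bounded_integrable (M := `|M|)) => // x _; rewrite normr_id.
have mE k : measurable_fun D (EFin \o f_ k) by exact/measurable_EFinP.
have mfE : measurable_fun D (EFin \o f) by exact/measurable_EFinP.
have cE : {ae mu, forall x, D x -> (EFin \o f_ k) x @[k --> \oo] --> (EFin \o f) x}.
  by apply: filterS cf => x + Dx => /(_ Dx) cfx; apply/fine_cvgP; split => /=; [exact: nearW|exact: cfx].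
have dE : {ae mu, forall x k, D x -> (`|(EFin \o f_ k) x| <= (EFin \o cst `|M|%R) x)%E}.
  apply: aeW => x k Dx /=; rewrite lee_fin; apply: le_trans (fM k x Dx) (ler_norm _).
have [intf _ cvI] := dominated_convergence mD mE mfE cE ig dE.
apply: (@fine_cvg _ _ _ _ (fun k => \int[mu]_(x in D) (f_ k x)%:E)%E).
rewrite fineK//; exact: integrable_fin_num intf.
Qed.

End bounded_convergence.

(** * Integrals of partial derivatives of functions with bounded support *)

Section integration_by_parts.
Variables (R : realType) (n : nat).
Local Notation mu := (lebesgue_rV R n).
Implicit Types (G f : 'rV[R]_n -> R) (i : 'I_n).

Lemma add_cst_continuous (V : normedModType R) (a x : V) :
  {for x, continuous (fun y : V => y + a)}.
Proof.
apply/cvgrPdist_le => eta eta0; apply/nbhs_radiusP; exists eta => // y yx.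
by rewrite opprD addrACA subrr addr0 distrC ltW.
Qed.

Lemma continuous_scaleB (T : topologicalType) (k l : T -> R) (a : R) :
  continuous k -> continuous l -> continuous (fun x => a * (k x - l x)).
Proof. by move=> ck cl x; apply: cvgMl_tmp; apply: cvgB; [exact: ck|exact: cl]. Qed.

Lemma norm_basis_rV i : `|basis_rV R i| <= 1.
Proof.
apply/norm_rV_leP => // j; rewrite mxE.
by case: eqP; case: eqP; rewrite /= ?normr1 ?normr0.
Qed.

Lemma continuous_measurable f : continuous f -> measurable_fun setT f.
Proof. by move=> cf; apply: continuous_on_measurable => [|x _]; [exact: openT|exact: cf]. Qed.

Lemma continuous_vanish_bounded f (r : R) : continuous f ->
  (forall x, r < `|x| -> f x = 0) -> exists2 M : R, 0 < M & forall x, `|f x| <= M.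
Proof.
move=> cf f0; have [|M M0 H] := @compact_bound_fun R _ _ f (@compact_norm_ball R n r).
  exact: continuous_subspaceT.
exists M => // x; have [xr|/f0 ->] := lerP `|x| r; first exact: H.
by rewrite normr0 ltW.
Qed.

Lemma continuous_vanish_integrable f (r : R) : continuous f ->
  (forall x, r < `|x| -> f x = 0) -> mu.-integrable setT (EFin \o f).
Proof.
move=> cf f0; have [M _ fM] := continuous_vanish_bounded cf f0.
apply: integrable_bounded_support fM f0; exact: continuous_measurable.
Qed.

Lemma lebesgue_rV_bounded_lty (D : set 'rV[R]_n) (r : R) : measurable D ->
  (forall x, D x -> `|x| <= r) -> (mu D < +oo)%E.
Proof.
move=> mD Dr; have m0 : 0 <= Num.max r 0 by rewrite le_max lexx orbT.
apply: le_lt_trans (ltry ((2 * Num.max r 0) ^+ n)).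
rewrite -(lebesgue_rV_cube n m0); apply: le_measure; rewrite ?inE//.
  by apply: closed_measurable_rV; exact: compact_closed (@compact_norm_ball R n _).
by move=> x /Dr xr /=; rewrite le_max xr.
Qed.

(* Difference quotients have zero integral, by translation invariance. *)
Lemma Rintegral_partial0 G i (r : R) : continuous G ->
  (forall x, r < `|x| -> G x = 0) -> (forall x, derivable G x (basis_rV R i)) ->
  continuous (partial i G) -> \int[mu]_x partial i G x = 0.
Proof.
move=> cG G0 dG cdG.
(* As the increments [h k] are at most 1, the enlarged cube contains the supports of all difference
   quotients; it has finite measure, and the mean value theorem bounds the quotients on it. *)
pose D := [set x : 'rV[R]_n | `|x| <= r + 1].
have mD : measurable D by apply: closed_measurable_rV; exact: compact_closed (@compact_norm_ball R n _).
have Doo : (mu D < +oo)%E by apply: (@lebesgue_rV_bounded_lty D (r + 1)).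
pose h (k : nat) : R := k.+1%:R^-1.
have h0 k : 0 < h k by rewrite invr_gt0.
have h1 k : h k <= 1 by rewrite invf_le1// ler1n.
pose f_ k (x : 'rV[R]_n) := (h k)^-1 * (G (x + h k *: basis_rV R i) - G x).
have far x k : ~ D x -> r < `|x| /\ r < `|x + h k *: basis_rV R i|.
  move=> /negP; rewrite -ltNge => xr; split; first by lra.
  have : `|h k *: basis_rV R i| <= 1.
    by rewrite normrZ gtr0_norm// mulr_ile1 ?norm_basis_rV// ltW.
  have := ler_normB (x + h k *: basis_rV R i) (h k *: basis_rV R i).
  by rewrite addrK; lra.
have dG0 x : ~ D x -> partial i G x = 0.
  move=> /negP; rewrite -ltNge => xr.
  apply: (@derive_val _ _ _ x (basis_rV R i) G 0).
  apply: (@near_eq_is_derive _ _ _ (cst 0)).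
  apply/nbhs_radiusP; exists 1 => // y yx; rewrite G0//.
  have := ler_normB (y : 'rV[R]_n) (y - x); rewrite opprB addrC subrK; lra.
have [M M0 dGM] : exists2 M : R, 0 < M & forall x, `|partial i G x| <= M.
  apply: (@continuous_vanish_bounded _ (r + 1)) => // x xr.
  by apply: dG0; apply/negP; rewrite -ltNge.
have intG : mu.-integrable setT (EFin \o G) by exact: continuous_vanish_integrable G0.
have cGs k : continuous (fun x : 'rV[R]_n => G (x + h k *: basis_rV R i)).
  move=> x; apply: (@continuous_comp _ _ _ (fun x : 'rV[R]_n => x + h k *: basis_rV R i) G).
    exact: add_cst_continuous.
  exact: cG.
have intGs k : mu.-integrable setT (EFin \o (fun x : 'rV[R]_n => G (x + h k *: basis_rV R i))).
  apply: (@continuous_vanish_integrable _ (r + 1)) => // x xr.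
  by rewrite G0//; have [|] := far x k; first by apply/negP; rewrite -ltNge.
have If k : \int[mu]_(x in D) f_ k x = 0.
  rewrite Rintegral_vanish => [|x /(far x k)[xr xr']]; last first.
    by rewrite /f_ !G0// subrr mulr0.
  rewrite RintegralZl//; last first.
    by have := integrableB _ (intGs k) intG; apply.
  by rewrite RintegralB// Rintegral_shift// subrr mulr0.
rewrite -(@Rintegral_vanish _ _ _ mu D)//.
have : \int[mu]_(x in D) f_ k x @[k --> \oo] --> \int[mu]_(x in D) partial i G x.
  apply: (@bounded_convergence _ _ _ mu D f_ _ M) => //.
  - move=> k; apply: measurable_funTS; apply: continuous_measurable.
    exact: continuous_scaleB.
  - by apply: measurable_funTS; exact: continuous_measurable.
  - apply: aeW => x _; have /is_derive_epsP H := derivableP (dG x).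
    apply/cvgrPdist_le => eta eta0; have [dl dl0 K] := H _ eta0.
    near=> k; rewrite distrC /f_.
    have -> : (h k)^-1 * (G (x + h k *: basis_rV R i) - G x) - partial i G x =
        (h k)^-1 * (G (x + h k *: basis_rV R i) - G x - h k * partial i G x).
      by field; rewrite gt_eqF.
    rewrite normrM gtr0_norm ?invr_gt0// mulrC ler_pdivrMr//.
    apply: le_trans (K (h k) _) _; last by rewrite gtr0_norm.
    rewrite gtr0_norm//; near: k.
    exact: (near_infty_natSinv_lt (PosNum dl0)).
  - move=> k x _; rewrite /f_ normrM gtr0_norm ?invr_gt0// mulrC ler_pdivrMr//.
    have [|c _] := @MVT_two_sided R (fun s => G (x + s *: basis_rV R i))
       (fun s => partial i G (x + s *: basis_rV R i)) 0 (h k).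
      by move=> s _; apply: is_derive_line; exact: derivableP.
    rewrite scale0r addr0 subr0 => ->; rewrite normrM (gtr0_norm (h0 k)).
    by rewrite ler_wpM2r// ltW.
under eq_cvg do rewrite If.
by move=> /cvg_lim <-//; rewrite lim_cst.
Unshelve. all: by end_near. Qed.

End integration_by_parts.

(** * Monotonicity of the flux *)

Section monotonicity.
Variable R : realType.
Implicit Types (s t D N p : R).

(** For vectors X, Y with norms s, t and |X - Y| = D, this is the inner product of |X|^(p-2) X -
    |Y|^(p-2) Y with X - Y. It is arranged so that both summands are nonnegative: s^(p-1) is
    increasing, and |s - t| <= D. *)
Definition mono_gap p s t D : R :=
  (s `^ (p - 1) - t `^ (p - 1)) * (s - t)
    + (s `^ (p - 2) + t `^ (p - 2)) / 2 * (D ^+ 2 - (s - t) ^+ 2).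

Lemma powR_pred p s : 0 < s -> s `^ (p - 1) = s `^ (p - 2) * s.
Proof.
move=> s0; rewrite -[X in _ * X]powRr1 ?ltW// -powRD; first by congr (_ `^ _); ring.
by rewrite (gt_eqF s0) implybT.
Qed.

Lemma powR_le_base (r x y : R) : 0 <= r -> 0 < x -> x <= y -> x `^ r <= y `^ r.
Proof.
move=> r0 x0 xy; apply: ge0_ler_powR; rewrite ?nnegrE//; first exact: ltW.
exact: le_trans (ltW x0) xy.
Qed.

Lemma powR_ge_base (r x y : R) : r <= 0 -> 0 < x -> x <= y -> y `^ r <= x `^ r.
Proof.
move=> r0 x0 xy; rewrite -(opprK r) !(powRN _ (- r)) lef_pV2 ?posrE ?powR_gt0//.
  by apply: powR_le_base; rewrite ?oppr_ge0.
exact: lt_le_trans xy.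
Qed.

Lemma powR_pred_incr p s t : 1 < p -> 0 < s -> 0 < t ->
  0 <= (s `^ (p - 1) - t `^ (p - 1)) * (s - t).
Proof.
move=> p1; wlog st : s t / t <= s => [H s0 t0|s0 t0].
  have [ts|/ltW st] := lerP t s; first exact: H.
  by have := H _ _ st t0 s0; lra.
apply: mulr_ge0; rewrite subr_ge0//.
by apply: powR_le_base; rewrite // subr_ge0 ltW.
Qed.

Lemma mono_gap_ge0 p s t D : 1 < p -> 0 < s -> 0 < t -> (s - t) ^+ 2 <= D ^+ 2 ->
  0 <= mono_gap p s t D.
Proof.
move=> p1 s0 t0 st; rewrite addr_ge0 ?powR_pred_incr// mulr_ge0 ?subr_ge0//.
by rewrite divr_ge0// addr_ge0// powR_ge0.
Qed.

(** By the mean value theorem the slope of s^(p-1) is (p - 1) c^(p-2) for some c <= N, and for p < 2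
    this power decreases in c. *)
Lemma powR_pred_strong p s t N : 1 < p -> p < 2 -> 0 < s <= N -> 0 < t <= N ->
  (p - 1) * N `^ (p - 2) * (s - t) ^+ 2 <= (s `^ (p - 1) - t `^ (p - 1)) * (s - t).
Proof.
move=> p1 p2; wlog st : s t / t < s => [H sN tN|/andP[s0 sN] /andP[t0 tN]].
  have [ts|ts|->] := ltgtP t s; first exact: H.
    by have := H _ _ ts tN sN; lra.
  by rewrite !subrr expr0n/= !mulr0.
have df x : x \in `]t, s[ -> is_derive x 1 (fun y : R => y `^ (p - 1)) ((p - 1) * x `^ (p - 1 - 1)).
  by rewrite in_itv/= => /andP[tx _]; apply: is_derive1_powR; exact: lt_trans tx.
have cf : {within `[t, s], continuous (fun x : R => x `^ (p - 1))}.
  apply: continuous_in_subspaceT => x; rewrite inE/= in_itv/= => /andP[tx _].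
  apply: differentiable_continuous; apply/derivable1_diffP.
  by have [] := is_derive1_powR (p - 1) (lt_le_trans t0 tx).
have [c] := MVT st df cf; rewrite in_itv/= => /andP[tc cs] ->.
rewrite expr2 mulrA; do 2 (apply: ler_wpM2r; first by rewrite subr_ge0 ltW).
apply: ler_wpM2l; first by rewrite subr_ge0 ltW.
have -> : p - 1 - 1 = p - 2 by ring.
apply: powR_ge_base; [lra|exact: lt_trans tc|].
by rewrite (le_trans (ltW cs)).
Qed.

(** For p < 2 the powers s^(p-2), t^(p-2) are at least N^(p-2), which gives a multiple of D^2. For p
    >= 2 they may vanish, but D <= s + t forces one of s, t to be at least tau / 2. *)
Lemma mono_gap_lower p N tau : 1 < p -> 0 < N -> 0 < tau ->
  exists2 kappa : R, 0 < kappa & forall s t D, 0 < s <= N -> 0 < t <= N ->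
    0 <= D -> (s - t) ^+ 2 <= D ^+ 2 -> D <= s + t -> tau <= D ->
    kappa <= mono_gap p s t D.
Proof.
move=> p1 N0 tau0; have [p2|p2] := ltrP p 2.
  exists ((p - 1) * N `^ (p - 2) * tau ^+ 2).
    by rewrite !mulr_gt0 ?subr_gt0 ?powR_gt0// exprn_gt0.
  move=> s t D /[dup] sN /andP[s0 sN'] /[dup] tN /andP[t0 tN'] D0 stD Dst tauD.
  have lowN x : 0 < x <= N -> N `^ (p - 2) <= x `^ (p - 2).
    by move=> /andP[x0 xN]; apply: powR_ge_base => //; lra.
  have := powR_pred_strong p1 p2 sN tN; have := lowN _ sN; have := lowN _ tN.
  rewrite /mono_gap; set a := s `^ (p - 2); set b := t `^ (p - 2).
  set c := N `^ (p - 2) => bc ac h.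
  have c0 : 0 < c by rewrite powR_gt0.
  have tD : tau ^+ 2 <= D ^+ 2 by rewrite ler_pXn2r ?nnegrE// ltW.
  set X := (s `^ (p - 1) - _) * _ in h *.
  have h2 : c * (D ^+ 2 - (s - t) ^+ 2) <= (a + b) / 2 * (D ^+ 2 - (s - t) ^+ 2).
    by rewrite ler_wpM2r ?subr_ge0//; lra.
  have h3 : (p - 1) * c * (D ^+ 2 - (s - t) ^+ 2) <= c * (D ^+ 2 - (s - t) ^+ 2).
    by rewrite ler_wpM2r ?subr_ge0// ler_piMl ?ltW//; lra.
  have h4 : (p - 1) * c * tau ^+ 2 <= (p - 1) * c * D ^+ 2.
    by rewrite ler_wpM2l// mulr_ge0 ?subr_ge0 ?ltW.
  by lra.
exists ((tau / 2) `^ (p - 2) / 2 * tau ^+ 2).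
  by rewrite mulr_gt0 ?divr_gt0 ?powR_gt0 ?exprn_gt0 ?divr_gt0.
move=> s t D /andP[s0 sN] /andP[t0 tN] D0 stD Dst tauD.
(* In this form the second summand is nonnegative because x^(p-2) is nondecreasing, and the D^2 term
   carries the bound. *)
have -> : mono_gap p s t D = (s `^ (p - 2) + t `^ (p - 2)) / 2 * D ^+ 2
    + (s `^ (p - 2) - t `^ (p - 2)) * (s - t) * (s + t) / 2.
  by rewrite /mono_gap !powR_pred//; field.
have q0 : 0 <= p - 2 by rewrite subr_ge0.
have tD : tau ^+ 2 <= D ^+ 2 by rewrite ler_pXn2r ?nnegrE// ltW.
have mon x y : 0 < x -> x <= y -> x `^ (p - 2) <= y `^ (p - 2).
  by move=> x0 xy; exact: powR_le_base.
have h1 : 0 <= (s `^ (p - 2) - t `^ (p - 2)) * (s - t).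
  have [st|/ltW st] := lerP s t.
    by rewrite mulr_le0// subr_le0// mon.
  by rewrite mulr_ge0// subr_ge0// mon.
have h2 : (tau / 2) `^ (p - 2) <= s `^ (p - 2) + t `^ (p - 2).
  have [st|/ltW st] := lerP s t.
    apply: le_trans (mon (tau / 2) t _ _) _; rewrite ?divr_gt0//; first lra.
    by rewrite lerDr powR_ge0.
  apply: le_trans (mon (tau / 2) s _ _) _; rewrite ?divr_gt0//; first lra.
  by rewrite lerDl powR_ge0.
rewrite -[leLHS]addr0 lerD//; last by rewrite divr_ge0// mulr_ge0// addr_ge0// ltW.
by rewrite ler_pM ?divr_ge0 ?powR_ge0 ?sqr_ge0// ler_wpM2r.
Qed.

Lemma enorm_le_sqr n (x : 'rV[R]_n) D : 0 <= D -> dot x x <= D ^+ 2 -> enorm x <= D.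
Proof. by move=> D0; rewrite -enorm_sqr ler_pXn2r ?nnegrE ?enorm_ge0. Qed.

(* Strict monotonicity of [X |-> |X|^(p-2) X] on R^(n+1) at [X = (xi, e)]: the
   regularization parameter is an additional component of the gradient. *)
Lemma flux_monotone n p (M tau : R) : 1 < p -> 0 <= M -> 0 < tau ->
  exists C : R, 0 <= C /\ forall (e e' : R) (xi eta : 'rV[R]_n),
    0 < e <= 1 -> 0 < e' <= 1 -> enorm xi <= M -> enorm eta <= M ->
    enorm (xi - eta) <= tau + C * (dot (flux p e xi - flux p e' eta) (xi - eta)
       + (M + 1) `^ (p - 1) * `|e - e'|).
Proof.
move=> p1 M0 tau0; set N := M + 1; have N0 : 0 < N by rewrite ltr_pwDr.
have [k k0 Hk] := mono_gap_lower p1 N0 tau0.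
have C0 : 0 < 2 * N / k by rewrite divr_gt0// mulr_gt0.
(* [N] bounds the norms of (xi, e) and (eta, e'), so their distance D is at most 2 N. If D < tau the
   claim is immediate; otherwise the gap is at least [k], and 2 N <= (2 N / k) gap. *)
exists (2 * N / k); split; first exact: ltW.
move=> e e' xi eta /andP[e0 e1] /andP[e'0 e'1] xiM etaM.
set s := Num.sqrt (e ^+ 2 + dot xi xi); set t := Num.sqrt (e' ^+ 2 + dot eta eta).
have pos x (z : 'rV[R]_n) : 0 < x -> 0 < x ^+ 2 + dot z z.
  by move=> x0; rewrite ltr_pwDl ?exprn_gt0 ?dotxx_ge0.
have s0 : 0 < s by rewrite sqrtr_gt0 pos.
have t0 : 0 < t by rewrite sqrtr_gt0 pos.
have s2 : s ^+ 2 = e ^+ 2 + dot xi xi by rewrite sqr_sqrtr ?ltW ?pos.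
have t2 : t ^+ 2 = e' ^+ 2 + dot eta eta by rewrite sqr_sqrtr ?ltW ?pos.
have bnd x (z : 'rV[R]_n) y : 0 < x <= 1 -> enorm z <= M -> 0 < y ->
    y ^+ 2 = x ^+ 2 + dot z z -> y <= N /\ x <= y.
  move=> /andP[x0 x1] zM y0 y2; have z0 := enorm_ge0 z; have dz := dotxx_ge0 z.
  split; rewrite -(@ler_pXn2r _ 2) ?nnegrE ?(ltW y0) ?(ltW N0) ?(ltW x0)// y2.
    have zM2 : enorm z ^+ 2 <= M ^+ 2 by rewrite ler_pXn2r ?nnegrE.
    have x12 : x ^+ 2 <= 1 by rewrite expr_le1// ltW.
    by rewrite -enorm_sqr /N sqrrD1; lra.
  by rewrite lerDl.
have [sN es] : s <= N /\ e <= s by apply: bnd xiM s0 s2; rewrite e0.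
have [tN et] : t <= N /\ e' <= t by apply: bnd etaM t0 t2; rewrite e'0.
have fluxE x (z : 'rV[R]_n) y : 0 < y -> y ^+ 2 = x ^+ 2 + dot z z ->
    flux p x z = y `^ (p - 2) *: z.
  move=> y0 y2; rewrite /flux enorm_sqr -y2 -powR_mulrn ?ltW// -powRrM.
  by congr (_ `^ _ *: _); field.
rewrite (fluxE _ _ _ s0 s2) (fluxE _ _ _ t0 t2).
set a := s `^ (p - 2); set b := t `^ (p - 2).
set D := Num.sqrt (dot (xi - eta) (xi - eta) + (e - e') ^+ 2).
have D2 : D ^+ 2 = dot (xi - eta) (xi - eta) + (e - e') ^+ 2.
  by rewrite sqr_sqrtr// addr_ge0 ?dotxx_ge0 ?sqr_ge0.
have D0 : 0 <= D by exact: sqrtr_ge0.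
have dE : dot (xi - eta) (xi - eta) = dot xi xi - 2 * dot xi eta + dot eta eta.
  by rewrite !dotE (dotC eta xi); ring.
have xd : enorm (xi - eta) <= D by apply: enorm_le_sqr => //; rewrite D2 lerDl sqr_ge0.
have CS : `|dot xi eta + e * e'| <= s * t.
  have h1 := cauchy_schwarz xi eta; have h2 := cauchy_schwarz (- xi) eta.
  rewrite dotNl enormN in h2.
  have x0 := enorm_ge0 xi; have y0 := enorm_ge0 eta.
  have h3 : enorm xi * enorm eta + e * e' <= s * t.
    rewrite -(@ler_pXn2r _ 2) ?nnegrE ?addr_ge0 ?mulr_ge0 ?(ltW e0) ?(ltW e'0) ?(ltW s0) ?(ltW t0)//.
    rewrite exprMn s2 t2 -!enorm_sqr -subr_ge0.
    have := sqr_ge0 (enorm xi * e' - enorm eta * e); lra.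
  by rewrite ler_norml; apply/andP; split; nra.
have stD : (s - t) ^+ 2 <= D ^+ 2.
  by move: CS; rewrite ler_norml => /andP[_ h]; rewrite D2 dE; nra.
have Dst : D <= s + t.
  rewrite -(@ler_pXn2r _ 2) ?nnegrE ?addr_ge0 ?(ltW s0) ?(ltW t0)//.
  by move: CS; rewrite ler_norml => /andP[h _]; rewrite D2 dE; nra.
have gapE : mono_gap p s t D = dot (a *: xi - b *: eta) (xi - eta) + (a * e - b * e') * (e - e').
  rewrite /mono_gap !powR_pred// -/a -/b D2 dE !dotE (dotC eta xi).
  have -> : dot xi xi = s ^+ 2 - e ^+ 2 by rewrite s2; ring.
  have -> : dot eta eta = t ^+ 2 - e' ^+ 2 by rewrite t2; ring.
  by field.
have gap0 := mono_gap_ge0 p1 s0 t0 stD.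
have ae x y z : 0 < z <= y -> y <= N -> x = y `^ (p - 2) -> 0 <= x * z <= N `^ (p - 1).
  move=> /andP[z0 zy] yN ->; have y0 : 0 < y by exact: lt_le_trans zy.
  rewrite mulr_ge0 ?powR_ge0 ?(ltW z0)//=.
  apply: le_trans (_ : y `^ (p - 2) * y <= _); first by rewrite ler_wpM2l ?powR_ge0.
  by rewrite -powR_pred//; apply: powR_le_base; rewrite // subr_ge0 ltW.
have /andP[ae0 aeN] : 0 <= a * e <= N `^ (p - 1) by apply: ae sN _; rewrite ?e0.
have /andP[be0 beN] : 0 <= b * e' <= N `^ (p - 1) by apply: ae tN _; rewrite ?e'0.
set A := dot _ _ in gapE *; set Q := N `^ (p - 1) in aeN beN *.
(* The extra component adds (a e - b e') (e - e') to the inner product; a e and b e' lie in [0, Q],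
   which leaves the error Q |e - e'|. *)
have gapA : mono_gap p s t D <= A + Q * `|e - e'|.
  rewrite gapE lerD2l; apply: le_trans (ler_norm _) _; rewrite normrM ler_wpM2r//.
  by rewrite ler_norml; lra.
have [Dtau|/ltW tauD] := lerP D tau.
  apply: le_trans xd _; apply: le_trans Dtau _; rewrite lerDl.
  by apply: mulr_ge0; [exact: ltW|exact: le_trans gapA].
have N20 : 0 <= 2 * N by rewrite mulr_ge0// ltW.
have kg : k <= mono_gap p s t D by apply: Hk => //; rewrite ?s0 ?t0.
apply: le_trans xd _; apply: le_trans (_ : 2 * N <= _); first by lra.
apply: le_trans (_ : 2 * N / k * (A + Q * `|e - e'|) <= _); last by rewrite lerDr ltW.
rewrite -mulrA; apply: ler_peMr => //.
by rewrite mulrC ler_pdivlMr// mul1r; exact: le_trans gapA.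
Qed.

End monotonicity.

(** * Weak form of the stationary equation *)

Section flux_ibp.
Variables (R : realType) (n : nat).
Local Notation mu := (lebesgue_rV R n).
Implicit Types (F G f phi : 'rV[R]_n -> R) (i : 'I_n) (Omega K : set 'rV[R]_n).

(** Regularity in one direction, pointwise on Omega: the class suits test functions such as squared
    positive parts, and each coordinate is integrated by parts on its own. *)
Definition C1_along i Omega F := forall x, Omega x ->
  [/\ {for x, continuous F}, derivable F x (basis_rV R i) &
      {for x, continuous (partial i F)}].

Lemma near_open Omega x (P : 'rV[R]_n -> Prop) : open Omega -> Omega x ->
  (forall y, Omega y -> P y) -> \forall y \near x, P y.
Proof.
move=> oO Ox H; have : nbhs x Omega by exact: open_nbhs_nbhs.
by apply: filterS => y; exact: H.
Qed.

Lemma continuous_near_eq (T : topologicalType) (F G : T -> R) (x : T) :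
  (\forall y \near x, F y = G y) ->
  {for x, continuous F} -> {for x, continuous G}.
Proof.
move=> FG cF; have e : F x = G x by exact: nbhs_singleton FG.
rewrite /prop_for /continuous_at -e.
apply: cvg_trans cF; by apply: near_eq_cvg; apply: filterS FG => y ->.
Qed.

Lemma C1_along_eq i Omega F G : open Omega -> (forall x, Omega x -> F x = G x) ->
  C1_along i Omega F -> C1_along i Omega G.
Proof.
move=> oO FG CF x Ox; have [cF dF cdF] := CF x Ox; split.
- by apply: continuous_near_eq cF; exact: near_open oO Ox FG.
- by apply: near_eq_derivable dF; exact: near_open oO Ox FG.
- apply: continuous_near_eq cdF; apply: (near_open oO Ox) => y Oy.
  by apply: near_eq_derive; exact: near_open oO Oy FG.
Qed.

Lemma C1_along_derive i Omega F (dF : 'rV[R]_n -> R) : open Omega ->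
  (forall x, Omega x -> {for x, continuous F}) ->
  (forall x, Omega x -> is_derive x (basis_rV R i) F (dF x)) ->
  (forall x, Omega x -> {for x, continuous dF}) -> C1_along i Omega F.
Proof.
move=> oO cF iF cdF x Ox; split; first exact: cF.
  by have [] := iF x Ox.
apply: continuous_near_eq (cdF x Ox); apply: (near_open oO Ox) => y Oy.
by have [_] := iF y Oy.
Qed.

Lemma C1_along_is_derive i Omega F x : C1_along i Omega F -> Omega x ->
  is_derive x (basis_rV R i) F (partial i F x).
Proof. by move=> CF /CF[_ dF _]; exact: derivableP. Qed.

Lemma continuous_at_mul (T : topologicalType) (a : T) (k l : T -> R) :
  {for a, continuous k} -> {for a, continuous l} ->
  {for a, continuous (fun c => k c * l c)}.
Proof. by move=> ck cl; apply: cvgM. Qed.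

Lemma continuous_at_add (T : topologicalType) (a : T) (k l : T -> R) :
  {for a, continuous k} -> {for a, continuous l} ->
  {for a, continuous (fun c => k c + l c)}.
Proof. by move=> ck cl; apply: cvgD. Qed.

Lemma continuous_at_sub (T : topologicalType) (a : T) (k l : T -> R) :
  {for a, continuous k} -> {for a, continuous l} ->
  {for a, continuous (fun c => k c - l c)}.
Proof. by move=> ck cl; apply: cvgB. Qed.

Lemma C1_along_mul i Omega F G : open Omega -> C1_along i Omega F -> C1_along i Omega G ->
  C1_along i Omega (fun x => F x * G x) /\
  forall x, Omega x -> partial i (fun x => F x * G x) x =
    F x * partial i G x + G x * partial i F x.
Proof.
move=> oO CF CG.
have d x : Omega x -> is_derive x (basis_rV R i) (fun x => F x * G x)
    (F x * partial i G x + G x * partial i F x).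
  move=> Ox; have dF := C1_along_is_derive CF Ox; have dG := C1_along_is_derive CG Ox.
  exact: is_deriveM.
split; last by move=> x /d[].
apply: C1_along_derive d _ => // x Ox.
  by have [cF _ _] := CF x Ox; have [cG _ _] := CG x Ox; exact: continuous_at_mul.
have [cF _ dF] := CF x Ox; have [cG _ dG] := CG x Ox.
by apply: continuous_at_add; exact: continuous_at_mul.
Qed.

Lemma C1_along_sub i Omega F G : open Omega -> C1_along i Omega F -> C1_along i Omega G ->
  C1_along i Omega (fun x => F x - G x) /\
  forall x, Omega x -> partial i (fun x => F x - G x) x = partial i F x - partial i G x.
Proof.
move=> oO CF CG.
have d x : Omega x -> is_derive x (basis_rV R i) (fun x => F x - G x)
    (partial i F x - partial i G x).
  move=> Ox; have dF := C1_along_is_derive CF Ox; have dG := C1_along_is_derive CG Ox.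
  exact: is_deriveB.
split; last by move=> x /d[].
apply: C1_along_derive d _ => // x Ox.
  by have [cF _ _] := CF x Ox; have [cG _ _] := CG x Ox; exact: continuous_at_sub.
have [cF _ dF] := CF x Ox; have [cG _ dG] := CG x Ox.
exact: continuous_at_sub.
Qed.

Lemma C1_along_comp i Omega F (k dk : R -> R) : open Omega -> C1_along i Omega F ->
  (forall s : R, is_derive s 1 k (dk s)) -> continuous dk ->
  C1_along i Omega (fun x => k (F x)) /\
  forall x, Omega x -> partial i (fun x => k (F x)) x = dk (F x) * partial i F x.
Proof.
move=> oO CF idk cdk.
have d x : Omega x -> is_derive x (basis_rV R i) (fun x => k (F x)) (dk (F x) * partial i F x).
  move=> Ox; have dF := C1_along_is_derive CF Ox; exact: is_derive_real_comp dF (idk _).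
have ck : continuous k.
  by move=> s; apply: differentiable_continuous; apply/derivable1_diffP; have [] := idk s.
split; last by move=> x /d[].
apply: C1_along_derive d _ => // x Ox; have [cF _ dF] := CF x Ox.
  by apply: continuous_comp => //; exact: ck.
by apply: continuous_at_mul => //; apply: continuous_comp => //; exact: cdk.
Qed.

Lemma Ck_C1_along Omega f i : Ck 1 Omega f -> C1_along i Omega f.
Proof.
by move=> [cf /(_ i)[df [cdf _]]] x Ox; split; [exact: cf|exact: df|exact: cdf].
Qed.

Lemma off_closed_near K (F : 'rV[R]_n -> R) x : closed K -> (forall y, ~ K y -> F y = 0) ->
  ~ K x -> \forall y \near x, 0 = F y.
Proof.
move=> cK F0 Kx; have oK := closed_openC cK.
by apply: (near_open oK Kx) => y /F0.
Qed.

Lemma continuous_glue Omega K F : open Omega -> closed K -> K `<=` Omega ->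
  (forall x, ~ K x -> F x = 0) -> (forall x, Omega x -> {for x, continuous F}) ->
  continuous F.
Proof.
move=> oO cK KO F0 cF x; have [/KO /cF //|Kx] := pselect (K x).
have : {for x, continuous (fun _ : 'rV[R]_n => 0 : R)} by exact: cst_continuous.
by apply: continuous_near_eq; exact: (off_closed_near cK F0 Kx).
Qed.

Lemma partial_off_closed K F i x : closed K -> (forall y, ~ K y -> F y = 0) ->
  ~ K x -> is_derive x (basis_rV R i) F 0.
Proof.
move=> cK F0 Kx; apply: (@near_eq_is_derive _ _ _ (cst 0)).
exact: off_closed_near cK F0 Kx.
Qed.

(** Off the closed set [K] the function is locally zero, so continuity and derivatives on Omega glue
    with zero to the whole space, where the translation argument applies. *)
Lemma Rintegral_C1_along0 Omega K F i (r : R) : open Omega -> closed K -> K `<=` Omega ->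
  (forall x, K x -> `|x| <= r) -> (forall x, ~ K x -> F x = 0) -> C1_along i Omega F ->
  \int[mu]_x partial i F x = 0 /\ mu.-integrable setT (EFin \o partial i F).
Proof.
move=> oO cK KO Kr F0 CF.
have dF0 x : ~ K x -> partial i F x = 0.
  by move=> Kx; have [] := partial_off_closed i cK F0 Kx.
have far x : r < `|x| -> ~ K x by move=> rx /Kr; rewrite leNgt rx.
have cdF : continuous (partial i F).
  by apply: (continuous_glue oO cK KO dF0) => x /CF[].
split; last by apply: (@continuous_vanish_integrable _ _ _ r) => // x /far /dF0.
apply: (@Rintegral_partial0 _ _ F i r) => //.
- by apply: (continuous_glue oO cK KO F0) => x /CF[].
- by move=> x /far /F0.
- move=> x; have [/KO /CF[]//|Kx] := pselect (K x).
  by have [] := partial_off_closed i cK F0 Kx.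
Qed.

Lemma Rintegral_sum_ord m (F : 'I_m -> 'rV[R]_n -> R) :
  (forall j, mu.-integrable setT (EFin \o F j)) ->
  \int[mu]_x (\sum_j F j x) = \sum_j \int[mu]_x F j x.
Proof.
elim: m F => [|m IH] F intF.
  rewrite big_ord0; under eq_fun do rewrite big_ord0.
  by rewrite Rintegral_cst// mul0r.
rewrite big_ord_recr/= -IH//; under eq_fun do rewrite big_ord_recr/=.
rewrite RintegralD//.
rewrite (_ : EFin \o _ = fun x => (\sum_(j < m) (EFin \o F (widen_ord (leqnSn m) j)) x)%E).
  exact: integrable_sum.
by apply/funext => x /=; rewrite sumEFin.
Qed.

Lemma smooth_hessian_continuous Omega f i j x : smooth_on Omega f -> Omega x ->
  {for x, continuous (fun y => hessian f y i j)}.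
Proof.
move=> sf Ox; have -> : (fun x => hessian f x i j) = partial j (partial i f).
  by apply/funext => y; rewrite mxE.
by have [_ /(_ i)[_ [_ /(_ j)[_ [+ _]]]]] := sf 2; apply.
Qed.

Lemma smooth_partial_continuous Omega f i x : smooth_on Omega f -> Omega x ->
  {for x, continuous (partial i f)}.
Proof. by move=> sf Ox; have [_ /(_ i)[_ [+ _]]] := sf 1; apply. Qed.

Lemma powR_continuous (s q : R) : 0 < s -> {for s, continuous (fun t : R => t `^ q)}.
Proof.
move=> s0; apply: differentiable_continuous; apply/derivable1_diffP.
by have [] := is_derive1_powR q s0.
Qed.

Lemma inv_continuous_at (T : topologicalType) (a : T) (k : T -> R) : k a != 0 ->
  {for a, continuous k} -> {for a, continuous (fun c => (k c)^-1)}.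
Proof. by move=> k0 ck; apply: cvgV. Qed.

(** The derivative is explicit in [is_derive_flux]; positivity of [e] keeps the base of the power
    away from 0, so every factor is continuous. *)
Lemma C1_along_flux (p e : R) Omega f i : 0 < e -> open Omega -> smooth_on Omega f ->
  C1_along i Omega (fun x => flux p e (grad f x) ord0 i).
Proof.
move=> e0 oO sf; have C2 : Ck 2 Omega f by exact: sf.
have cg j x : Omega x -> {for x, continuous (fun y => grad f y ord0 j)}.
  move=> Ox; rewrite (_ : (fun _ => _) = partial j f); last by apply/funext => y; rewrite mxE.
  exact: smooth_partial_continuous Ox.
have cdot x : Omega x -> {for x, continuous (fun y => e ^+ 2 + dot (grad f y) (grad f y))}.
  move=> Ox; apply: continuous_at_add; first exact: cst_continuous.
  by apply: continuous_sum_ord => j; apply: continuous_at_mul; exact: cg.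
have s0 x : 0 < e ^+ 2 + dot (grad f x) (grad f x).
  by rewrite ltr_pwDl ?exprn_gt0 ?dotxx_ge0.
have cpow x : Omega x -> {for x, continuous (fun y => (e ^+ 2 + enorm (grad f y) ^+ 2) `^ (p / 2 - 1))}.
  move=> Ox; rewrite (_ : (fun _ => _) = (fun y => (e ^+ 2 + dot (grad f y) (grad f y)) `^ (p / 2 - 1))); last first.
    by apply/funext => y; rewrite enorm_sqr.
  apply: (@continuous_comp _ _ _ (fun y => e ^+ 2 + dot (grad f y) (grad f y)) (fun s => s `^ (p / 2 - 1))).
    exact: cdot.
  exact: powR_continuous.
apply: C1_along_derive (fun x Ox => is_derive_flux p i e0 oO Ox C2) _ => // x Ox.
  rewrite (_ : (fun _ => _) = (fun y => (e ^+ 2 + enorm (grad f y) ^+ 2) `^ (p / 2 - 1) * grad f y ord0 i)).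
    by apply: continuous_at_mul; [exact: cpow|exact: cg].
  by apply/funext => y; rewrite /flux mxE.
apply: continuous_at_mul; first exact: cpow.
apply: continuous_at_add; first exact: smooth_hessian_continuous Ox.
apply: continuous_at_mul.
  rewrite /ellip; apply: continuous_at_mul; first exact: cst_continuous.
  by apply: inv_continuous_at; [rewrite gt_eqF|exact: cdot].
apply: continuous_at_mul; first exact: cg.
rewrite (_ : (fun _ => _) = (fun y => \sum_j \sum_k grad f y ord0 j * hessian f y j k * basis_rV R i ord0 k)).
  apply: continuous_sum_ord => j; apply: continuous_sum_ord => k.
  apply: continuous_at_mul; last exact: cst_continuous.
  by apply: continuous_at_mul; [exact: cg|exact: smooth_hessian_continuous Ox].
by apply/funext => y; rewrite bilE.
Qed.

(** The derivatives of flux_i phi sum to flux . D phi + phi div flux, with div flux = 0 on Omega,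
    and each of them integrates to 0. *)
Lemma flux_ibp (p e r : R) Omega K g v phi : 0 < e -> open Omega -> closed K ->
  K `<=` Omega -> (forall x, Omega x -> `|x| <= r) ->
  stationary_solution p e Omega g v ->
  (forall x, ~ K x -> phi x = 0) -> (forall i, C1_along i Omega phi) ->
  \int[mu]_(x in Omega) (\sum_i flux p e (grad v x) ord0 i * partial i phi x) = 0.
Proof.
move=> e0 oO cK KO Or [_ sv _ dv _] phi0 Cphi.
have dphi0 i x : ~ K x -> partial i phi x = 0.
  by move=> Kx; have [] := partial_off_closed i cK phi0 Kx.
rewrite Rintegral_vanish; last first.
  by move=> x Ox; rewrite big1// => i _; rewrite dphi0 ?mulr0// => /KO.
pose H i x := flux p e (grad v x) ord0 i * phi x.
have CF i := C1_along_flux p i e0 oO sv.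
have CH i := C1_along_mul oO (CF i) (Cphi i).
have H0 i x : ~ K x -> H i x = 0 by move=> /phi0 h; rewrite /H h mulr0.
have IH i := Rintegral_C1_along0 oO cK KO (fun x Kx => Or x (KO x Kx)) (H0 i) (CH i).1.
transitivity (\int[mu]_x \sum_i partial i (H i) x); last first.
  by rewrite Rintegral_sum_ord => [|i]; [rewrite big1// => i _; have [] := IH i|have [] := IH i].
congr (Rintegral mu setT _); apply/funext => x.
have [/KO Ox|Kx] := pselect (K x); last first.
  by rewrite !big1// => i _; [have [] := partial_off_closed i cK (H0 i) Kx|rewrite dphi0 ?mulr0].
under [RHS]eq_bigr do rewrite (CH _).2//.
have dvx : \sum_i partial i (fun y => flux p e (grad v y) ord0 i) x = 0 by exact: dv x Ox.
by rewrite big_split/= -mulr_sumr dvx mulr0 addr0.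
Qed.

End flux_ibp.

(** * Comparison of two stationary solutions *)

Section uniform_cauchy.
Variables (R : realType) (n : nat).
Local Notation mu := (lebesgue_rV R n).
Implicit Types (f v w psi : 'rV[R]_n -> R) (i : 'I_n) (Omega K : set 'rV[R]_n).

(** The square removes the corner of the positive part: in each sign case the first-order remainder
    is at most t^2. *)
Lemma is_derive_sqr_pos (delta s : R) :
  is_derive s 1 (fun t : R => Num.max (t - delta) 0 ^+ 2) (2 * Num.max (s - delta) 0).
Proof.
apply/is_derive_epsP => eta eta0; exists eta => // t teta.
have -> : s + t *: (1 : R) = s + t by rewrite /GRing.scale/= mulr1.
have -> : s + t - delta = (s - delta) + t by ring.
set a := s - delta.
apply: le_trans (_ : t ^+ 2 <= _); last first.
  by rewrite -real_normK ?num_real// expr2 ler_wpM2r// ltW.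
have := sqr_ge0 t; have := sqr_ge0 a; have := sqr_ge0 (a + t).
by rewrite ler_norml /Num.max; case: ifP; case: ifP => *; nra.
Qed.

Lemma max_sub_continuous (delta : R) : continuous (fun t : R => Num.max (t - delta) 0).
Proof.
move=> t; apply: (@continuous_max _ _ (fun t => t - delta) (cst 0)); last exact: cst_continuous.
exact: add_cst_continuous.
Qed.

(** The crossing is the first exit time, an infimum: openness excludes that its point is in Omega,
    and slightly earlier points are in Omega. *)
Lemma segment_crosses_boundary Omega x z : open Omega -> Omega x -> ~ Omega z ->
  exists2 t : R, 0 <= t <= 1 & boundary Omega (x + t *: (z - x)).
Proof.
move=> oO Ox nOz.
pose T := [set t : R | 0 <= t <= 1 /\ ~ Omega (x + t *: (z - x))].
have lbT : lbound T 0 by move=> t [/andP[]].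
have geT t : T t -> inf T <= t by apply: ge_inf; exists 0; exact: lbT.
have T1 : T 1 by rewrite /T/= ler01 lexx scale1r addrC subrK.
have hiT : has_inf T by split; [exists 1|exists 0].
have i0 : 0 <= inf T by apply: lb_le_inf => //; exists 1.
have i1 : inf T <= 1 by exact: geT.
set t0 := inf T in i0 i1.
have nO : ~ Omega (x + t0 *: (z - x)).
  move=> /(open_line (z - x) oO)[d d0 Kd].
  have [t Tt tt0] := inf_adherent d0 hiT; apply: (Tt.2).
  have t0t : t0 <= t by exact: geT.
  have -> : x + t *: (z - x) = x + t0 *: (z - x) + (t - t0) *: (z - x).
    by rewrite -[RHS]addrA -scalerDl [t0 + _]addrC subrK.
  by apply: Kd; rewrite ger0_norm ?subr_ge0// ltrBlDl.
have t00 : 0 < t0.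
  by rewrite lt_def i0 andbT; apply/eqP => e; apply: nO; rewrite e scale0r addr0.
exists t0; first by rewrite i0.
apply/boundaryE => //; split => //; apply/closure_radiusP => rho rho0.
pose m := rho / (`|z - x| + 1).
have m0 : 0 < m by rewrite divr_gt0// ltr_pwDr.
pose s := Num.max 0 (t0 - m / 2).
have st0 : s < t0 by rewrite gt_max t00/=; lra.
have s0 : 0 <= s by rewrite le_max lexx.
have ms : t0 - s < m.
  by have : t0 - m / 2 <= s by [rewrite le_max lexx orbT]; lra.
exists (x + s *: (z - x)).
  apply: contrapT => nOs; move: (st0); rewrite ltNge => /negP; apply.
  by apply: geT; split => //; rewrite s0/=; lra.
rewrite opprD addrACA subrr add0r -scalerBl normrZ distrC ger0_norm ?subr_ge0 ?(ltW st0)//.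
move: ms; rewrite /m ltr_pdivlMr ?ltr_pwDr//; apply: le_lt_trans.
by rewrite ler_wpM2l ?subr_ge0 ?(ltW st0)// lerDl.
Qed.

Lemma elipschitz_partial Omega v L x i : open Omega -> elipschitz_on Omega v L ->
  Omega x -> derivable v x (basis_rV R i) -> `|partial i v x| <= L.
Proof.
move=> oO Lv Ox /derivableP/is_derive_epsP H; apply/ler_addgt0Pr => eta eta0.
have [d d0 Kd] := H _ eta0; have [d' d'0 Kd'] := open_line (basis_rV R i) oO Ox.
pose t := Num.min d d' / 2.
have m0 : 0 < Num.min d d' by rewrite lt_min d0.
have t0 : 0 < t by rewrite divr_gt0.
have tn : `|t| = t by rewrite gtr0_norm.
have tm : t < Num.min d d' by rewrite /t; lra.
have /andP[td td'] : (t < d) && (t < d') by rewrite -lt_min.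
have := Kd t; rewrite tn => /(_ td) h.
have e1 : enorm (x + t *: basis_rV R i - x) = t.
  rewrite addrC addKr; apply/eqP; rewrite -(@eqrXn2 _ 2) ?enorm_ge0 ?ltW//.
  by rewrite enorm_sqr dotZl dotZr dot_basis mxE !eqxx mulr1 expr2.
have := Lv (x + t *: basis_rV R i) x; rewrite e1 => /(_ _ (subset_closure Ox)) h'.
have {}h' := h' (subset_closure (Kd' t _)); rewrite tn in h'; have {}h' := h' td'.
rewrite -(ler_pM2l t0) mulrDr -[X in X * `|_|]tn -normrM.
rewrite -[t * _](subKr (v (x + t *: basis_rV R i) - v x)).
apply: le_trans (ler_normB _ _) _.
by rewrite (mulrC t L) (mulrC t eta) lerD.
Qed.

Lemma elipschitz_grad Omega v L x : open Omega -> elipschitz_on Omega v L ->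
  smooth_on Omega v -> 0 <= L -> Omega x -> enorm (grad v x) <= n%:R * L.
Proof.
move=> oO Lv sv L0 Ox; apply: le_trans (enorm_le_norm _) _; rewrite ler_wpM2l//.
apply/norm_rV_leP => // i; rewrite mxE; apply: (elipschitz_partial oO Lv Ox).
by have [_ /(_ i)[dv _]] := sv 1; exact: dv.
Qed.

(** With s = |(xi, e)| the flux is at most s^(p-2) s = s^(p-1). Pairing the powers in this way gives
    a bound free of [e] also for p < 2. *)
Lemma flux_bound (p e M : R) (xi : 'rV[R]_n) i : 1 < p -> 0 < e <= 1 -> 0 <= M ->
  enorm xi <= M -> `|flux p e xi ord0 i| <= (M + 1) `^ (p - 1).
Proof.
move=> p1 /andP[e0 e1] M0 xiM.
set s := Num.sqrt (e ^+ 2 + dot xi xi).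
have pos : 0 < e ^+ 2 + dot xi xi by rewrite ltr_pwDl ?exprn_gt0 ?dotxx_ge0.
have s0 : 0 < s by rewrite sqrtr_gt0.
have s2 : s ^+ 2 = e ^+ 2 + dot xi xi by rewrite sqr_sqrtr ?ltW.
have xis : enorm xi <= s.
  rewrite -(@ler_pXn2r _ 2) ?nnegrE ?enorm_ge0 ?(ltW s0)// s2 enorm_sqr.
  by rewrite lerDr sqr_ge0.
have sN : s <= M + 1.
  rewrite -(@ler_pXn2r _ 2) ?nnegrE ?(ltW s0) ?addr_ge0// s2 -enorm_sqr sqrrD1.
  have : enorm xi ^+ 2 <= M ^+ 2 by rewrite ler_pXn2r ?nnegrE ?enorm_ge0.
  have : e ^+ 2 <= 1 by rewrite expr_le1// ltW.
  by lra.
have -> : flux p e xi ord0 i = s `^ (p - 2) * xi ord0 i.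
  rewrite /flux enorm_sqr -s2 -powR_mulrn ?(ltW s0)// -powRrM mxE.
  by congr (_ `^ _ * _); field.
rewrite normrM ger0_norm ?powR_ge0//.
apply: le_trans (_ : s `^ (p - 2) * s <= _).
  by rewrite ler_wpM2l ?powR_ge0// (le_trans (coord_le_enorm _ _)).
by rewrite -powR_pred//; apply: powR_le_base; rewrite // subr_ge0 ltW.
Qed.

Definition Rvol Omega : R := fine (mu Omega).

Lemma continuous_on_integrable Omega f (M r : R) : open Omega ->
  (forall x, Omega x -> `|x| <= r) -> (forall x, Omega x -> {for x, continuous f}) ->
  (forall x, Omega x -> `|f x| <= M) -> mu.-integrable Omega (EFin \o f).
Proof.
move=> oO Or cf fM; have mO := open_measurable_rV oO.
apply: bounded_integrable fM => //; first exact: lebesgue_rV_bounded_lty Or.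
exact: continuous_on_measurable.
Qed.

Lemma Rintegral_cst_Omega Omega (c r : R) : open Omega -> (forall x, Omega x -> `|x| <= r) ->
  \int[mu]_(x in Omega) c = c * Rvol Omega.
Proof. by move=> oO Or; rewrite Rintegral_cst//; exact: open_measurable_rV. Qed.

Lemma dot_continuous (a b : 'rV[R]_n -> 'rV[R]_n) x :
  (forall i, {for x, continuous (fun y => a y ord0 i)}) ->
  (forall i, {for x, continuous (fun y => b y ord0 i)}) ->
  {for x, continuous (fun y => dot (a y) (b y))}.
Proof.
by move=> ca cb; apply: continuous_sum_ord => i; exact: continuous_at_mul.
Qed.

Lemma norm_dot_le (a b : 'rV[R]_n) (A B : R) : 0 <= A -> (forall i, `|a ord0 i| <= A) ->
  (forall i, `|b ord0 i| <= B) -> `|dot a b| <= n%:R * (A * B).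
Proof.
move=> A0 aA bB; apply: le_trans (ler_norm_sum _ _ _) _.
apply: le_trans (_ : \sum_(i < n) A * B <= _).
  by apply: ler_sum => i _; rewrite normrM ler_pM.
by rewrite sumr_const card_ord mulr_natl.
Qed.

Section two_solutions.
Variables (p e e' r L : R) (Omega : set 'rV[R]_n) (g v v' : 'rV[R]_n -> R).
Hypotheses (p1 : 1 < p) (e01 : 0 < e <= 1) (e01' : 0 < e' <= 1) (L0 : 0 < L).
Hypotheses (oO : open Omega) (Or : forall x, closure Omega x -> `|x| <= r).
Hypotheses (sv : stationary_solution p e Omega g v)
           (sv' : stationary_solution p e' Omega g v').
Hypotheses (Lv : elipschitz_on Omega v L) (Lv' : elipschitz_on Omega v' L).

Let f x := v x - v' x.
Let M := n%:R * L.
Let Q := (M + 1) `^ (p - 1).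
Let B x := flux p e (grad v x) - flux p e' (grad v' x).
Let smv : smooth_on Omega v. Proof. by case: sv. Qed.
Let smv' : smooth_on Omega v'. Proof. by case: sv'. Qed.
Let e0 : 0 < e. Proof. by case/andP: e01. Qed.
Let e0' : 0 < e'. Proof. by case/andP: e01'. Qed.
Let M0 : 0 <= M. Proof. by rewrite mulr_ge0// ltW. Qed.
Let Or' x : Omega x -> `|x| <= r. Proof. by move=> Ox; exact/Or/subset_closure. Qed.
Let gv x : Omega x -> enorm (grad v x) <= M.
Proof. by apply: elipschitz_grad => //; exact: ltW. Qed.
Let gv' x : Omega x -> enorm (grad v' x) <= M.
Proof. by apply: elipschitz_grad => //; exact: ltW. Qed.

Lemma sub_C1_along i : C1_along i Omega f.
Proof. by apply: (C1_along_sub oO _ _).1; apply: Ck_C1_along; [exact: smv|exact: smv']. Qed.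

Lemma grad_sub x : Omega x -> grad f x = grad v x - grad v' x.
Proof.
move=> Ox; apply/rowP => i; rewrite !mxE.
by apply: (C1_along_sub oO _ _).2 => //; apply: Ck_C1_along; [exact: smv|exact: smv'].
Qed.

Lemma partial_sub_bound i x : Omega x -> `|partial i f x| <= 2 * M.
Proof.
move=> Ox; have := grad_sub Ox => /rowP/(_ i); rewrite !mxE => ->.
apply: le_trans (ler_normB _ _) _.
have := le_trans (coord_le_enorm (grad v x) i) (gv Ox); rewrite mxE.
have := le_trans (coord_le_enorm (grad v' x) i) (gv' Ox); rewrite mxE; lra.
Qed.

Lemma flux_diff_bound i x : Omega x -> `|B x ord0 i| <= 2 * Q.
Proof.
move=> Ox; rewrite !mxE; apply: le_trans (ler_normB _ _) _.
have := flux_bound i p1 e01 M0 (gv Ox); have := flux_bound i p1 e01' M0 (gv' Ox).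
by rewrite /flux !mxE /Q; lra.
Qed.

Lemma grad_sub_continuous i x : Omega x -> {for x, continuous (fun y => grad f y ord0 i)}.
Proof.
move=> Ox; rewrite (_ : (fun _ => _) = partial i f); last by apply/funext => y; rewrite mxE.
by have [] := sub_C1_along i Ox.
Qed.

Lemma flux_diff_continuous i x : Omega x -> {for x, continuous (fun y => B y ord0 i)}.
Proof.
move=> Ox; rewrite (_ : (fun _ => _) = (fun y => flux p e (grad v y) ord0 i -
  flux p e' (grad v' y) ord0 i)); last by apply/funext => y; rewrite !mxE.
apply: continuous_at_sub.
  by have [] := C1_along_flux p i e0 oO smv Ox.
by have [] := C1_along_flux p i e0' oO smv' Ox.
Qed.

Lemma flux_dot_integrable psi S : (forall x, Omega x -> {for x, continuous psi}) ->
  (forall x, Omega x -> 0 <= psi x <= S) ->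
  mu.-integrable Omega (EFin \o (fun x => psi x * dot (B x) (grad f x))).
Proof.
move=> cpsi psiS.
apply: (@continuous_on_integrable _ _ (S * (n%:R * (2 * Q * (2 * M)))) r) => // x Ox.
  apply: continuous_at_mul; first exact: cpsi.
  by apply: dot_continuous => i; [exact: flux_diff_continuous|exact: grad_sub_continuous].
have /andP[h0 hS] := psiS x Ox; rewrite normrM ger0_norm// ler_pM//.
apply: norm_dot_le => [|i|i]; first by rewrite mulr_ge0// powR_ge0.
  exact: flux_diff_bound.
by rewrite mxE; exact: partial_sub_bound.
Qed.

(* The constant [C] is the one of [flux_monotone] for [tau]. *)
Lemma weighted_partial_le (tau C S : R) psi i :
  (forall (e e' : R) (xi eta : 'rV[R]_n), 0 < e <= 1 -> 0 < e' <= 1 ->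
    enorm xi <= M -> enorm eta <= M ->
    enorm (xi - eta) <= tau + C * (dot (flux p e xi - flux p e' eta) (xi - eta)
       + Q * `|e - e'|)) ->
  0 <= tau -> 0 <= C ->
  (forall x, Omega x -> {for x, continuous psi}) ->
  (forall x, Omega x -> 0 <= psi x <= S) ->
  \int[mu]_(x in Omega) (psi x * `|partial i f x|) <=
    (tau + C * Q * `|e - e'|) * S * Rvol Omega +
    C * \int[mu]_(x in Omega) (psi x * dot (B x) (grad f x)).
Proof.
move=> HC tau0 C0 cpsi psiS.
have mO := open_measurable_rV oO.
have intB := flux_dot_integrable cpsi psiS.
set c := (tau + C * Q * `|e - e'|) * S.
have intc : mu.-integrable Omega (EFin \o cst c).
  by apply: (@continuous_on_integrable _ _ `|c| r) => // x Ox; exact: cst_continuous.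
have intCB : mu.-integrable Omega (EFin \o (fun x => C * (psi x * dot (B x) (grad f x)))).
  by have := integrableZl mO C intB; apply.
rewrite -(Rintegral_cst_Omega c oO Or') -RintegralZl// -RintegralD//.
have Q0 : 0 <= Q by exact: powR_ge0.
apply: le_Rintegral => //.
- apply: (@continuous_on_integrable _ _ (S * (2 * M)) r) => // x Ox.
    apply: continuous_at_mul; first exact: cpsi.
    apply: (@continuous_comp _ _ _ (partial i f) (@Num.norm _ _)); last exact: norm_continuous.
    by have [] := sub_C1_along i Ox.
  have /andP[h0 hS] := psiS x Ox.
  by rewrite normrM ger0_norm// normr_id ler_pM// partial_sub_bound.
- by have := integrableD mO intc intCB; apply.
move=> x Ox; have /andP[h0 hS] := psiS x Ox.
have := HC e e' (grad v x) (grad v' x) e01 e01' (gv Ox) (gv' Ox).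
rewrite -grad_sub// => h.
have : `|partial i f x| <= enorm (grad f x).
  by have := coord_le_enorm (grad f x) i; rewrite mxE.
rewrite -/(B x) in h; move: h; set D := dot _ _; set E := enorm _ => h1 h2.
have h3 : psi x * `|partial i f x| <= psi x * (tau + C * (D + Q * `|e - e'|)).
  by rewrite ler_wpM2l// (le_trans h2).
have h4 : psi x * (tau + C * Q * `|e - e'|) <= S * (tau + C * Q * `|e - e'|).
  by rewrite ler_wpM2r// addr_ge0// !mulr_ge0.
by rewrite /c; lra.
Qed.

End two_solutions.

End uniform_cauchy.

(** * Uniform bound for the difference of two solutions *)

Section uniform_gap.
Variables (R : realType) (n : nat) (i0 : 'I_n).
Local Notation mu := (lebesgue_rV R n).
Implicit Types (Omega K : set 'rV[R]_n) (v : 'rV[R]_n -> R).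

Lemma elipschitz_sub Omega v v' (L : R) : elipschitz_on Omega v L ->
  elipschitz_on Omega v' L -> elipschitz_on Omega (fun x => v x - v' x) (2 * L).
Proof.
move=> Lv Lv' x y cx cy; have := Lv x y cx cy; have := Lv' x y cx cy.
by rewrite !ler_norml => /andP[? ?] /andP[? ?]; apply/andP; split; lra.
Qed.

Lemma closed_superlevel Omega (f : 'rV[R]_n -> R) (L delta : R) : 0 <= L ->
  elipschitz_on Omega f L -> closed [set x | closure Omega x /\ delta <= f x].
Proof.
move=> L0 Lf x /closure_radiusP cx.
have cOx : closure Omega x.
  apply: (@closed_closure _ Omega); apply/closure_radiusP => rho /cx[y [cy _] yx].
  by exists y.
split => //; apply/ler_addgt0Pr => eta eta0.
pose m := eta / (L * n%:R + 1).
have D0 : 0 < L * n%:R + 1 by rewrite ltr_pwDr// mulr_ge0.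
have [|y [cy fy] yx] := cx m; first exact: divr_gt0.
have h := Lf y x cy cOx; apply: (le_trans fy).
have h2 : L * enorm (y - x) <= L * (n%:R * `|y - x|) by rewrite ler_wpM2l// enorm_le_norm.
move: yx; rewrite ltr_pdivlMr// => yx.
have := normr_ge0 (y - x); move: h; rewrite ler_norml => /andP[_ h].
by rewrite mulrA in h2; lra.
Qed.

Lemma unbounded_rV (r : R) : exists z : 'rV[R]_n, r < `|z|.
Proof.
exists (\row_(i < n) (`|r| + 1)); apply: lt_le_trans (coord_le_norm _ i0).
by rewrite mxE ger0_norm ?addr_ge0//; have := ler_norm r; lra.
Qed.

Lemma cube_measurable (x : 'rV[R]_n) (rho : R) : measurable [set y | `|y - x| <= rho].
Proof.
rewrite (_ : [set y | _] = (fun y => y + - x) @^-1` [set z | `|z| <= rho])//.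
rewrite -[X in measurable X]setTI; apply: measurable_shift_rV => //.
by apply: closed_measurable_rV; exact: compact_closed (@compact_norm_ball R _ _).
Qed.

Lemma cube_measure (x : 'rV[R]_n) (rho : R) : 0 <= rho ->
  mu [set y | `|y - x| <= rho] = ((2 * rho) ^+ n)%:E.
Proof.
move=> rho0; have mB : measurable [set z : 'rV[R]_n | `|z| <= rho].
  by apply: closed_measurable_rV; exact: compact_closed (@compact_norm_ball R _ _).
by rewrite -(lebesgue_rV_cube n rho0) -(lebesgue_rV_shift (- x) mB).
Qed.

(* Testing with [((v - v' - delta)_+)^2] bounds [int (v - v' - delta)_+ |D_0 (v - v')|];
   the Poincare inequality obtained from [D_0 (x_0 ((v - v' - delta)_+)^2)] then
   bounds the L2 norm of [(v - v' - delta)_+], and the Lipschitz bound its maximum. *)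
Lemma uniform_gap (p r L delta : R) Omega g : 1 < p -> open Omega ->
  (forall x, closure Omega x -> `|x| <= r) -> 0 < L -> 0 < delta ->
  exists2 eta : R, 0 < eta & forall e e' v v', 0 < e <= 1 -> 0 < e' <= 1 ->
    `|e - e'| < eta ->
    stationary_solution p e Omega g v -> stationary_solution p e' Omega g v' ->
    elipschitz_on Omega v L -> elipschitz_on Omega v' L ->
    forall x, closure Omega x -> v x - v' x <= 2 * delta.
Proof.
move=> p1 oO Or L0 delta0.
have Or' x : Omega x -> `|x| <= r by move=> Ox; exact/Or/subset_closure.
have mO := open_measurable_rV oO.
set V := Rvol Omega.
have V0 : 0 <= V by rewrite fine_ge0.
have [r0|r0] := ltrP r 0.
  exists 1 => // e e' v v' _ _ _ _ _ _ _ x /Or; rewrite leNgt.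
  by rewrite (lt_le_trans r0).
set N := n%:R : R; have N0 : 0 < N by rewrite ltr0n (leq_ltn_trans (leq0n i0) (ltn_ord i0)).
pose M := N * L; have M0 : 0 <= M by rewrite mulr_ge0// ltW.
pose Q := (M + 1) `^ (p - 1); have Q0 : 0 <= Q by exact: powR_ge0.
(* Bound for [f]: its Lipschitz constant 2 L times the Euclidean diameter, measured to a boundary
   point, where [f] vanishes. *)
pose S := 2 * L * (N * (2 * r)).
have S0 : 0 <= S by rewrite !mulr_ge0// ltW.
(* On the cube of radius [rho] around [x0] the function [f] drops by at most delta / 2 from a value
   above 2 delta; hence [psi >= delta / 2] there, and [c] is a lower bound for the integral of
   [psi ^+ 2]. *)
pose rho := delta / (4 * L * N).
have rho0 : 0 < rho by rewrite divr_gt0// !mulr_gt0.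
pose c := (delta / 2) ^+ 2 * (2 * rho) ^+ n.
have c0 : 0 < c by rewrite mulr_gt0// exprn_gt0// ?divr_gt0// mulr_gt0.
pose B := 2 * r * S * V + 1.
have B0 : 0 < B.
  rewrite ltr_pwDr//; apply: mulr_ge0 => //; apply: mulr_ge0 => //.
  exact: mulr_ge0.
(* Chosen with [B * (2 * tau) = c / 2], so that the Poincare bound stays below [c]; the [+ 1] in [B]
   keeps it positive. The choice of eta below adds [C * Q * |e - e'| <= tau]. *)
pose tau := c / (4 * B); have tau0 : 0 < tau by rewrite divr_gt0// mulr_gt0.
have [C [C0 HC]] := @flux_monotone R n p M tau p1 M0 tau0.
have CQ0 : 0 < C * Q + 1 by rewrite ltr_pwDr// mulr_ge0.
exists (tau / (C * Q + 1)); first exact: divr_gt0.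
move=> e e' v v' e01 e01' ee' sv sv' Lv Lv' x0 cx0.
rewrite leNgt; apply/negP => fx0.
pose f x := v x - v' x.
have Lf : elipschitz_on Omega f (2 * L) by exact: elipschitz_sub.
have fb x : boundary Omega x -> f x = 0.
  by move=> bx; have [_ _ _ _ h] := sv; have [_ _ _ _ h'] := sv'; rewrite /f h// h'// subrr.
have Ox0 : Omega x0.
  apply: contrapT => nO; have /fb f0 : boundary Omega x0 by apply/boundaryE.
  by move: fx0; rewrite -/(f x0) f0; lra.
have fS x : Omega x -> f x <= S.
  move=> Ox; have [z zr] := unbounded_rV r.
  have nOz : ~ Omega z by move=> /Or'; rewrite leNgt zr.
  have [t _ bt] := segment_crosses_boundary oO Ox nOz.
  have := Lf x _ (subset_closure Ox) bt.1; rewrite (fb _ bt) subr0.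
  move=> /(le_trans (ler_norm _)) /le_trans; apply.
  rewrite ler_wpM2l ?mulr_ge0 ?(ltW L0)//; apply: le_trans (enorm_le_norm _) _.
  rewrite ler_wpM2l//; apply: le_trans (ler_normB _ _) _.
  by have := Or _ bt.1; have := Or' _ Ox; lra.
pose psi x := Num.max (f x - delta) 0.
have psiS x : Omega x -> 0 <= psi x <= S.
  move=> Ox; rewrite /psi le_max lexx orbT/= ge_max S0 andbT.
  by have := fS _ Ox; lra.
(* Nothing is known of [v] and [v'] off the closure, hence the restriction to Omega. Since [f] is 0
   on the boundary, the superlevel set [K] stays inside Omega and is closed. *)
pose phi := (fun x => Num.max (f x - delta) 0 ^+ 2) \_ Omega.
pose K := [set x | closure Omega x /\ delta <= f x].
have cK : closed K by apply: closed_superlevel Lf; rewrite mulr_ge0// ltW.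
have KO : K `<=` Omega.
  move=> x [cx fx]; apply: contrapT => nO.
  have /fb f0 : boundary Omega x by apply/boundaryE.
  by move: fx; rewrite f0 leNgt delta0.
have psi0 x : Omega x -> ~ K x -> psi x = 0.
  move=> Ox nK; rewrite /psi; apply/max_idPr; rewrite subr_le0 leNgt; apply/negP => h.
  by apply: nK; split; [exact: subset_closure|exact: ltW].
have phiE x : Omega x -> phi x = psi x ^+ 2.
  by move=> Ox; rewrite /phi patchE mem_set.
have phi0 x : ~ K x -> phi x = 0.
  move=> nK; rewrite /phi patchE; case: ifPn => //; rewrite inE => Ox.
  by have := psi0 x Ox nK; rewrite /psi => ->; rewrite expr0n.
have Cf i : C1_along i Omega f.
  exact: (sub_C1_along oO sv sv').
have cdk : continuous (fun t : R => 2 * Num.max (t - delta) 0).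
  by move=> t; apply: cvgMl_tmp; exact: max_sub_continuous.
have CP i := C1_along_comp oO (Cf i) (is_derive_sqr_pos delta) cdk.
have phiE' x : Omega x -> Num.max (f x - delta) 0 ^+ 2 = phi x by move=> /phiE ->.
have Cphi i : C1_along i Omega phi by exact: (C1_along_eq oO phiE' (CP i).1).
have dphi i x : Omega x -> partial i phi x = 2 * psi x * partial i f x.
  move=> Ox; rewrite -(CP i).2//; apply: near_eq_derive.
  by apply: (near_open oO Ox) => y Oy; rewrite phiE.
have cpsi x : Omega x -> {for x, continuous psi}.
  move=> Ox; have [cf _ _] := Cf i0 x Ox.
  by apply: (@continuous_comp _ _ _ f (fun t => Num.max (t - delta) 0)) => //; exact: max_sub_continuous.
have dfM i x : Omega x -> `|partial i f x| <= 2 * M.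
  exact: (partial_sub_bound L0 oO sv sv' Lv Lv').
have ibp (a : R) u : 0 < a <= 1 -> stationary_solution p a Omega g u ->
    elipschitz_on Omega u L -> mu.-integrable Omega
     (EFin \o (fun x => psi x * dot (flux p a (grad u x)) (grad f x))) /\
    \int[mu]_(x in Omega) (psi x * dot (flux p a (grad u x)) (grad f x)) = 0.
  move=> a01 su Lu; have [a0 _] := andP a01; have [_ smu _ _ _] := su.
  have intu : mu.-integrable Omega
      (EFin \o (fun x => psi x * dot (flux p a (grad u x)) (grad f x))).
    apply: (@continuous_on_integrable _ _ _ _ (S * (n%:R * (Q * (2 * M)))) r) => // x Ox.
      apply: continuous_at_mul; first exact: cpsi.
      apply: dot_continuous => i; first by have [] := C1_along_flux p i a0 oO smu Ox.
      exact: (grad_sub_continuous oO sv sv').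
    have /andP[h0 hS] := psiS x Ox; rewrite normrM ger0_norm// ler_pM//.
    apply: norm_dot_le => // i; last by rewrite mxE dfM.
    exact: (flux_bound i p1 a01 M0 (elipschitz_grad oO Lu smu (ltW L0) Ox)).
  split => //.
  have := flux_ibp a0 oO cK KO Or' su phi0 Cphi.
  rewrite (@eq_Rintegral _ _ _ _ _
      (fun x => 2 * (psi x * dot (flux p a (grad u x)) (grad f x)))); last first.
    move=> x; rewrite inE => Ox; rewrite !mulr_sumr; apply: eq_bigr => i _.
    by rewrite dphi// [grad f x ord0 i]mxE; ring.
  rewrite RintegralZl// => /eqP; rewrite mulf_eq0 pnatr_eq0/= => /eqP; exact.
have [int1 I1] := ibp e v e01 sv Lv.
have [int2 I2] := ibp e' v' e01' sv' Lv'.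
have W := weighted_partial_le p1 e01 e01' L0 oO Or sv sv' Lv Lv' i0 HC (ltW tau0) C0 cpsi psiS.
have I12 : \int[mu]_(x in Omega) (psi x * dot (flux p e (grad v x) - flux p e' (grad v' x))
     (grad f x)) = 0.
  transitivity (\int[mu]_(x in Omega) (psi x * dot (flux p e (grad v x)) (grad f x) -
     psi x * dot (flux p e' (grad v' x)) (grad f x))).
    by apply: eq_Rintegral => x _; rewrite dotBl mulrBr.
  by rewrite RintegralB// I1 I2 subrr.
(* Both equations tested with [phi] cancel the monotone term, so the integral of [psi] times the
   partial derivative of [f] is controlled by [tau] and |e - e'| alone. *)
rewrite -/f I12 mulr0 addr0 in W.
have intd : mu.-integrable Omega (EFin \o (fun x => psi x * `|partial i0 f x|)).
  apply: (@continuous_on_integrable _ _ _ _ (S * (2 * M)) r) => // x Ox.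
    apply: continuous_at_mul; first exact: cpsi.
    apply: (@continuous_comp _ _ _ (partial i0 f) (@Num.norm _ _)); last exact: norm_continuous.
    by have [] := Cf i0 x Ox.
  have /andP[h0 hS] := psiS x Ox.
  by rewrite normrM ger0_norm// normr_id ler_pM// dfM.
have intpsi2 : mu.-integrable Omega (EFin \o (fun x => psi x ^+ 2)).
  apply: (@continuous_on_integrable _ _ _ _ (S * S) r) => // x Ox.
    by rewrite (_ : (fun x => _) = (fun x => psi x * psi x))//; apply: continuous_at_mul; exact: cpsi.
  by have /andP[h0 hS] := psiS x Ox; rewrite expr2 normrM ger0_norm// ler_pM.
have P : \int[mu]_(x in Omega) (psi x ^+ 2) <=
    2 * r * \int[mu]_(x in Omega) (psi x * `|partial i0 f x|).
  pose X (x : 'rV[R]_n) := x ord0 i0.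
  have dX x : is_derive x (basis_rV R i0) X 1.
    apply/is_derive_epsP => eta eta0; exists 1 => // t _.
    rewrite /X !mxE !eqxx mulr1 (addrC (x _ _)) addrK subrr normr0.
    by rewrite mulr_ge0// ltW.
  have CX : C1_along i0 Omega X.
    apply: (C1_along_derive (dF := cst 1) oO) => x Ox //; first exact: coord_continuous.
    exact: cst_continuous.
  have [CXphi dXphi] := C1_along_mul oO CX (Cphi i0).
  have Xphi0 x : ~ K x -> X x * phi x = 0 by move=> /phi0 ->; rewrite mulr0.
  have [I0 _] := Rintegral_C1_along0 oO cK KO (fun x Kx => Or' x (KO x Kx)) Xphi0 CXphi.
  have pX x : Omega x -> partial i0 (fun x => X x * phi x) x =
      psi x ^+ 2 + X x * (2 * (psi x * partial i0 f x)).
    move=> Ox; rewrite dXphi// dphi// phiE//.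
    by rewrite [partial i0 X x](@derive_val _ _ _ _ _ _ _ (dX x)); ring.
  have intX : mu.-integrable Omega (EFin \o (fun x => partial i0 (fun x => X x * phi x) x)).
    apply: (@continuous_on_integrable _ _ _ _ (S * S + r * (2 * (S * (2 * M)))) r) => // x Ox.
      by have [] := CXphi x Ox.
    have /andP[h0 hS] := psiS x Ox; rewrite pX//; apply: le_trans (ler_normD _ _) _.
    rewrite lerD//; first by rewrite expr2 normrM ger0_norm// ler_pM.
    rewrite !normrM (ger0_norm h0) (@gtr0_norm _ 2)//.
    apply: ler_pM => //; first by rewrite !mulr_ge0.
      exact: le_trans (coord_le_norm x i0) (Or' x Ox).
    by rewrite ler_wpM2l// ler_pM// dfM.
  have int2r : mu.-integrable Omega (EFin \o (fun x => 2 * r * (psi x * `|partial i0 f x|))).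
    by have := integrableZl mO (2 * r) intd; apply.
  rewrite -RintegralZl// -subr_le0 -RintegralB//.
  have I0' : \int[mu]_(x in Omega) partial i0 (fun x => X x * phi x) x = 0.
    rewrite Rintegral_vanish// => x Ox; have nK : ~ K x by move=> /KO.
    by have [] := partial_off_closed i0 cK Xphi0 nK.
  rewrite -I0'; apply: le_Rintegral => //.
    by have := integrableB mO intpsi2 int2r; apply.
  move=> x Ox; rewrite pX// lerD2l.
  have /andP[h0 hS] := psiS x Ox.
  have : `|X x * (2 * (psi x * partial i0 f x))| <= 2 * r * (psi x * `|partial i0 f x|).
    rewrite !normrM (ger0_norm h0) (@gtr0_norm _ 2)// mulrCA -mulrA ler_wpM2l//.
    rewrite ler_wpM2r ?mulr_ge0//; exact: le_trans (coord_le_norm x i0) (Or' x Ox).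
  by rewrite ler_norml => /andP[].
have low : c <= \int[mu]_(x in Omega) (psi x ^+ 2).
  pose cube := [set y : 'rV[R]_n | `|y - x0| <= rho].
  have mcube : measurable cube by exact: cube_measurable.
  have near_x0 y : cube y -> 2 * L * enorm (x0 - y) <= delta / 2.
    move=> /= cy; rewrite enorm_distC.
    apply: le_trans (_ : 2 * L * (N * rho) <= _).
      rewrite ler_wpM2l ?mulr_ge0 ?(ltW L0)//; apply: le_trans (enorm_le_norm _) _.
      by rewrite ler_wpM2l// ltW.
    rewrite le_eqVlt; apply/orP; left; apply/eqP; rewrite /rho; field.
    by rewrite !gt_eqF.
  (* A segment from [x0] leaving Omega inside the cube would meet the boundary, where [f = 0],
     forcing [f x0 <= delta / 2]. *)
  have cubeO : cube `<=` Omega.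
    move=> y cy; apply: contrapT => nOy.
    have [t /andP[t0 t1] bt] := segment_crosses_boundary oO Ox0 nOy.
    have := Lf x0 _ cx0 bt.1; rewrite (fb _ bt) subr0 => h.
    have : 2 * L * enorm (x0 - (x0 + t *: (y - x0))) <= delta / 2.
      apply: near_x0; rewrite /cube/= addrC addKr normrZ ger0_norm//.
      by apply: le_trans cy; rewrite ler_piMl.
    move: (le_trans (ler_norm _) h) fx0 delta0; rewrite -/(f x0).
    by move: (2 * L * _) (f x0); clear => a b; lra.
  have e1 : \int[mu]_(x in cube) ((delta / 2) ^+ 2) = c.
    rewrite Rintegral_cst//; congr (_ * _).
    exact: (congr1 fine (cube_measure x0 (ltW rho0))).
  rewrite -e1; apply: le_trans (_ : \int[mu]_(x in cube) (psi x ^+ 2) <= _).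
    apply: le_Rintegral => //.
    - apply: (bounded_integrable (M := (delta / 2) ^+ 2)) => //.
      + have := ltry ((2 * rho) ^+ n); rewrite -(cube_measure x0 (ltW rho0)); apply.
      + by move=> x _; rewrite ger0_norm// sqr_ge0.
    - by have := integrableS mO mcube cubeO intpsi2.
    move=> y cy; rewrite ler_pXn2r ?nnegrE//; first last.
    + by have /andP[] := psiS y (cubeO _ cy).
    + by rewrite divr_ge0// ltW.
    have := Lf x0 y cx0 (subset_closure (cubeO _ cy)); have := near_x0 y cy.
    move: fx0; rewrite -/(f x0) ler_norml /psi le_max => h1 h2 /andP[_ h3].
    apply/orP; left; move: h1 h2 h3.
    by move: (2 * L * _) (f x0) (f y); clear => a b d; lra.
  rewrite [leLHS]Rintegral_mkcond [leRHS]Rintegral_mkcond.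
  apply: le_Rintegral => //.
  - rewrite -restrict_EFin; apply: (iffLR (integrable_mkcond _ mcube)).
    by have := integrableS mO mcube cubeO intpsi2.
  - by rewrite -restrict_EFin; apply: (iffLR (integrable_mkcond _ mO)).
  move=> x _; rewrite !patchE; case: ifPn => [|_]; first by rewrite inE => /cubeO; rewrite -inE => ->.
  by case: ifPn => // _; exact: sqr_ge0.
have: c < c; last by rewrite ltxx.
apply: le_lt_trans low _; apply: le_lt_trans P _.
apply: le_lt_trans (_ : 2 * r * ((tau + C * Q * `|e - e'|) * S * V) < _).
  by rewrite ler_wpM2l ?mulr_ge0.
have CQe : C * Q * `|e - e'| <= tau.
  move: ee'; rewrite ltr_pdivlMr// => /ltW; apply: le_trans.
  by rewrite mulrC ler_wpM2l// lerDl.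
apply: le_lt_trans (_ : (2 * r * S * V) * (2 * tau) < _).
  have -> : 2 * r * ((tau + C * Q * `|e - e'|) * S * V) = (2 * r * S * V) * (tau + C * Q * `|e - e'|) by ring.
  apply: ler_wpM2l; first by apply: mulr_ge0 => //; apply: mulr_ge0 => //; exact: mulr_ge0.
  by rewrite mulr2n mulrDl !mul1r lerD2l.
apply: le_lt_trans (_ : (2 * r * S * V + 1) * (2 * tau) < _).
  apply: ler_wpM2r; first by apply: mulr_ge0 => //; exact: ltW.
  by rewrite lerDl.
rewrite -/B; have -> : B * (2 * tau) = c / 2 by rewrite /tau; field; rewrite gt_eqF.
by rewrite ltr_pdivrMr// ltr_pMr// ltr1n.
Qed.

End uniform_gap.

(** * Almost everywhere convergence of the gradients *)

Section ae_limits.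
Context d (T : measurableType d) (R : realType) (mu : {measure set T -> \bar R}).
Implicit Types (D : set T) (G : nat -> T -> R) (Z : T -> R).

(** The upper limit is measurable whether or not the sequence converges; clamping it to [-M, M]
    makes it bounded everywhere and does not change it where there is a limit. *)
Lemma measurable_pointwise_limit D G (M : R) : measurable D -> 0 <= M ->
  (forall k, measurable_fun D (G k)) -> (forall k x, D x -> `|G k x| <= M) ->
  exists H : T -> R, [/\ measurable_fun D H, forall x, `|H x| <= M &
    forall x, D x -> cvgn (fun k => G k x) -> G k x @[k --> \oo] --> H x].
Proof.
move=> mD M0 mG GM.
pose l x := limn_esup (fun k => (G k x)%:E).
exists (fun x => Num.max (- M) (Num.min M (fine (l x)))); split.
- apply: measurable_maxr; first exact: measurable_cst.
  apply: measurable_minr; first exact: measurable_cst.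
  apply: measurableT_comp; first exact: fine_measurable.
  by apply: measurable_fun_limn_esup => k; exact/measurable_EFinP.
- move=> x; rewrite ler_norml le_max lexx/= ge_max ge_min lexx/= andbT; lra.
- move=> x Dx /cvg_ex[/= a Ga].
  have -> : l x = a%:E.
    have : (fun k => (G k x)%:E) @ \oo --> a%:E.
      by apply/fine_cvgP; split => /=; [exact: nearW|exact: Ga].
    by move=> /cvg_limn_einf_sup[_].
  have aM : `|a| <= M.
    by apply: (cvgr_to_le (cvg_norm Ga)); apply: nearW => k; exact: GM.
  move: aM; rewrite ler_norml => /andP[Ma aM] /=.
  by rewrite (min_idPr aM) (max_idPr Ma).
Qed.

(** The weighted increments have integrals summing to at most 2, so their series is finite almost
    everywhere; where [Z] is positive this is absolute convergence of the telescoping series. *)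
Lemma ae_cvg_summable D G Z : measurable D ->
  (forall k, measurable_fun D (G k)) -> measurable_fun D Z ->
  (forall x, D x -> 0 <= Z x) ->
  (forall k,
    mu.-integrable D (EFin \o (fun x => Z x * `|G k x - G k.+1 x|)) /\
    \int[mu]_(x in D) (Z x * `|G k x - G k.+1 x|) <= 2^-1 ^+ k) ->
  {ae mu, forall x, D x -> 0 < Z x -> cvgn (fun k => G k x)}.
Proof.
move=> mD mG mZ Z0 HG.
pose h k x := Z x * `|G k x - G k.+1 x|.
have h0 k x : D x -> 0 <= h k x by move=> Dx; rewrite mulr_ge0// Z0.
have mh k : measurable_fun D (h k).
  apply: measurable_funM => //; apply: measurableT_comp => //.
  exact: measurable_funB.
have Ih k : (\int[mu]_(x in D) (h k x)%:E <= (2^-1 ^+ k)%:E)%E.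
  have [intk lek] := HG k.
  by rewrite -(fineK (integrable_fin_num mD intk)) lee_fin.
have Isum : (\int[mu]_(x in D) \sum_(k <oo) (h k x)%:E < +oo)%E.
  rewrite integral_nneseries//.
  - apply: (@le_lt_trans _ _ (\sum_(k <oo) (2^-1 ^+ k : R)%:E)%E).
      apply: lee_nneseries => [k _ _|k _]; last exact: Ih.
      by apply: integral_ge0 => x Dx; rewrite lee_fin h0.
    apply: (@le_lt_trans _ _ 2%:E); last exact: ltry.
    apply: lime_le.
      by apply: is_cvg_nneseries => k _ _; rewrite lee_fin exprn_ge0.
    apply: nearW => k; rewrite sumEFin lee_fin.
    suff -> : \sum_(0 <= i < k) 2^-1 ^+ i = 2 - 2 * 2^-1 ^+ k :> R.
      by rewrite gerBl mulr_ge0// exprn_ge0.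
    elim: k => [|k IH]; first by rewrite big_geq// expr0; lra.
    by rewrite big_nat_recr//= IH exprS; lra.
  - by move=> k; exact/measurable_EFinP.
have msum : measurable_fun D (fun x => \sum_(k <oo) (h k x)%:E)%E.
  apply: ge0_emeasurable_sum => k; first by move=> x Dx _; rewrite lee_fin h0.
  by move=> _; exact/measurable_EFinP.
have intsum : mu.-integrable D (fun x => \sum_(k <oo) (h k x)%:E)%E.
  apply/integrableP; split => //.
  under eq_integral => x /set_mem Dx.
    rewrite gee0_abs; last by apply: nneseries_ge0 => k _ _; rewrite lee_fin h0.
    over.
  exact: Isum.
have := integrable_ae mD intsum; apply: filterS => x H Dx Zx.
have {}H := H Dx.
pose f k := G k x - G k.+1 x.
have GE k : G k x = G 0%N x - series f k.
  rewrite /series/=; elim: k => [|k IH]; first by rewrite big_geq// subr0.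
  by rewrite big_nat_recr//= opprD addrA -IH /f; lra.
suff cf : cvgn (series f).
  rewrite (_ : (fun k => G k x) = (fun k => G 0%N x - series f k)); last exact/funext.
  by apply: is_cvgB => //; exact: is_cvg_cst.
apply: normed_cvg; change (cvgn (series (fun k => `|f k|))).
apply: nondecreasing_is_cvgn.
  exact: nondecreasing_series.
exists (fine (\sum_(k <oo) (h k x)%:E)%E / Z x) => _ [N _ <-].
rewrite ler_pdivlMr// mulrC mulr_sumr -lee_fin fineK// -sumEFin.
by apply: nneseries_lim_ge => k _; rewrite lee_fin h0.
Qed.

End ae_limits.

(** * Cutoffs and the local estimate for gradients *)

Section bumps.
Variables (R : realType) (n : nat).
Local Notation mu := (lebesgue_rV R n).
Implicit Types (Omega K : set 'rV[R]_n) (v phi zeta : 'rV[R]_n -> R).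

(** This is ((rho^2 - |x - c|^2)_+)^2, written as the square of a positive part above the level -
    rho^2 so that [is_derive_sqr_pos] applies. *)
Definition bump (c : 'rV[R]_n) (rho : R) (x : 'rV[R]_n) : R :=
  Num.max (- dot (x - c) (x - c) - - rho ^+ 2) 0 ^+ 2.

Lemma bump_C1 c rho i : C1_along i setT (bump c rho).
Proof.
pose F (x : 'rV[R]_n) := - dot (x - c) (x - c).
have cc j (x : 'rV[R]_n) : {for x, continuous (fun y : 'rV[R]_n => (y - c) ord0 j)}.
  rewrite (_ : (fun _ => _) = (fun y : 'rV[R]_n => y ord0 j - c ord0 j)); last first.
    by apply/funext => y; rewrite !mxE.
  by apply: continuous_at_sub; [exact: coord_continuous|exact: cst_continuous].
have CF : C1_along i setT F.
  apply: (C1_along_derive (dF := fun x => (- 2) * (x - c) ord0 i)).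
  - exact: openT.
  - move=> x _; rewrite (_ : F = (fun x => (- 1) * dot (x - c) (x - c))).
      apply: continuous_at_mul; first exact: cst_continuous.
      by apply: dot_continuous => j; exact: cc.
    by apply/funext => y; rewrite /F mulN1r.
  - move=> x _; apply/is_derive_epsP => eta eta0; exists eta => // t te.
    have -> : F (x + t *: basis_rV R i) - F x - t * (- 2 * (x - c) ord0 i) = - (t * t).
      rewrite /F (_ : x + _ - c = (x - c) + t *: basis_rV R i); last by rewrite addrAC.
      move: (x - c) => z; rewrite !dotE (dotC (basis_rV R i)) !dot_basis.
      by rewrite mxE !eqxx/=; ring.
    by rewrite normrN normrM ler_wpM2r// ltW.
  - by move=> x _; apply: continuous_at_mul; [exact: cst_continuous|exact: cc].
have cdk : continuous (fun t : R => 2 * Num.max (t - - rho ^+ 2) 0).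
  by move=> t; apply: cvgMl_tmp; exact: max_sub_continuous.
exact: (C1_along_comp openT CF (is_derive_sqr_pos (- rho ^+ 2)) cdk).1.
Qed.

Lemma bump_off c rho x : 0 <= rho -> rho < `|x - c| -> bump c rho x = 0.
Proof.
move=> rho0 xc; rewrite /bump (max_idPr _) ?expr0n// opprK addrC subr_le0 -enorm_sqr.
by rewrite ler_pXn2r ?nnegrE ?enorm_ge0// ltW// (lt_le_trans xc)// norm_le_enorm.
Qed.

Lemma bump_gt0 c rho x : 0 < rho -> `|x - c| < rho / n.+1%:R -> 0 < bump c rho x.
Proof.
move=> rho0; rewrite ltr_pdivlMr// => xc; rewrite /bump exprn_gt0// lt_max ltxx orbF opprK.
rewrite addrC subr_gt0 -enorm_sqr ltr_pXn2r ?nnegrE ?enorm_ge0 ?(ltW rho0)//.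
apply: le_lt_trans (enorm_le_norm _) _; apply: le_lt_trans xc.
by rewrite mulrC ler_wpM2l// ler_nat.
Qed.

Definition cutoff Omega zeta := [/\ forall x, 0 <= zeta x,
  forall i, C1_along i setT zeta &
  exists K, [/\ closed K, K `<=` Omega & forall x, ~ K x -> zeta x = 0]].

(** Rational boxes contained in Omega carry a bump, the others the zero function. Countability lets
    almost everywhere statements for single cutoffs combine over all of Omega. *)
Lemma cutoff_cover Omega : open Omega -> exists Z : nat -> 'rV[R]_n -> R,
  (forall m, cutoff Omega (Z m)) /\ forall x, Omega x -> exists m, 0 < Z m x.
Proof.
move=> oO.
pose inside (b : rat_box n) :=
  `[< forall y : 'rV[R]_n, `|y - box_center R b| <= box_radius R b -> Omega y >].
pose Z m : 'rV[R]_n -> R := if unpickle m is Some b then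
    if inside b then bump (box_center R b) (box_radius R b) else cst 0
  else cst 0.
have cut0 : cutoff Omega (cst 0).
  split => // [i|]; last by exists set0; split => //; exact: closed0.
  move=> x _; split; [exact: cst_continuous|exact: derivable_cst|].
  rewrite (_ : partial i _ = cst 0); first exact: cst_continuous.
  by apply/funext => y; exact: derive_cst.
exists Z; split => [m|x Ox].
  rewrite /Z; case: unpickle => // b; rewrite /inside; case: asboolP => // Hb; split.
  - by move=> x; rewrite /bump exprn_even_ge0.
  - by move=> i; exact: bump_C1.
  exists [set x | `|x - box_center R b| <= box_radius R b]; split => //.
  - apply: (@preimage_closed _ _ (fun x : 'rV[R]_n => `|x + - box_center R b|) [set t | t <= _]).
      move=> x _; apply: (@continuous_comp _ _ _ (fun y : 'rV[R]_n => y + - box_center R b) Num.norm).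
        exact: add_cst_continuous.
      exact: norm_continuous.
    exact: closed_le.
  - move=> x /negP; rewrite -ltNge => /bump_off -> //.
    exact/ltW/box_radius_gt0.
have [b [xb Hb]] := rat_box_cover oO Ox.
exists (pickle b); rewrite /Z pickleK /inside; case: asboolP => // _.
exact: bump_gt0 (box_radius_gt0 _ _) xb.
Qed.

Lemma C1_vanish_bounded (i : 'I_n) Omega K phi (r : R) : K `<=` Omega ->
  (forall x, Omega x -> `|x| <= r) -> (forall x, ~ K x -> phi x = 0) ->
  C1_along i setT phi -> exists2 S : R, 0 < S & forall x, `|phi x| <= S.
Proof.
move=> KO Or phi0 Cphi; apply: (@continuous_vanish_bounded _ _ _ r) => x.
  by have [] := Cphi x I.
by move=> rx; apply: phi0 => /KO /Or; rewrite leNgt rx.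
Qed.

Lemma C1_vanish_partials_bounded Omega K phi (r : R) : closed K -> K `<=` Omega ->
  (forall x, Omega x -> `|x| <= r) -> (forall x, ~ K x -> phi x = 0) ->
  (forall i, C1_along i setT phi) ->
  exists2 S : R, 0 < S & forall i x, `|partial i phi x| <= S.
Proof.
move=> cK KO Or phi0 Cphi.
have H i : exists S : R, 0 < S /\ forall x, `|partial i phi x| <= S.
  have [x|x rx|s s0 Hs] := @continuous_vanish_bounded R n (partial i phi) r.
  - by have [] := Cphi i x I.
  - have Kx : ~ K x by move=> /KO /Or; rewrite leNgt rx.
    by have [] := partial_off_closed i cK phi0 Kx.
  by exists s.
have [s Hs] := boolp.choice H.
have s0 i : 0 <= s i by apply: ltW; have [] := Hs i.
exists (1 + \sum_i s i); first by rewrite ltr_pwDl// sumr_ge0.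
move=> i x; have [_ /(_ x) h] := Hs i; apply: le_trans h _.
by rewrite (bigD1 i)//= addrCA lerDl addr_ge0// sumr_ge0.
Qed.

(* By [flux_ibp] applied to [(v - v') zeta],
   [int zeta B.D(v - v') = - int (v - v') B.D zeta] where [B] is the difference of the fluxes. *)
Lemma grad_gap (p r L delta : R) Omega g zeta : 1 < p -> open Omega ->
  (forall x, closure Omega x -> `|x| <= r) -> 0 < L -> 0 < delta -> cutoff Omega zeta ->
  exists2 eta : R, 0 < eta & forall e e' v v', 0 < e <= 1 -> 0 < e' <= 1 ->
    `|e - e'| < eta ->
    stationary_solution p e Omega g v -> stationary_solution p e' Omega g v' ->
    elipschitz_on Omega v L -> elipschitz_on Omega v' L ->
    (forall x, Omega x -> `|v x - v' x| <= eta) ->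
    forall i, \int[mu]_(x in Omega) (zeta x * `|partial i v x - partial i v' x|) <= delta.
Proof.
move=> p1 oO Or L0 delta0 [z0 Cz [K [cK KO zK]]].
have Or' x : Omega x -> `|x| <= r by move=> Ox; exact/Or/subset_closure.
have mO := open_measurable_rV oO.
have CzO i : C1_along i Omega zeta by move=> x _; exact: Cz.
have [S1 S10 dzS] := C1_vanish_partials_bounded cK KO Or' zK Cz.
(* Without coordinates there is no partial derivative to estimate; otherwise a coordinate gives
   access to the continuity of [zeta]. *)
have [i|i0] := pselect (exists i : 'I_n, True); last first.
  by exists 1 => // *; exfalso; apply: i0; eexists.
have [i0 _] := i.
have [S S0 zS] := C1_vanish_bounded KO Or' zK (Cz i0).
set V := Rvol Omega.
have V0 : 0 <= V by rewrite fine_ge0.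
pose M := n%:R * L; have M0 : 0 <= M by rewrite mulr_ge0// ltW.
pose Q := (M + 1) `^ (p - 1); have Q0 : 0 <= Q by exact: powR_ge0.
have SV0 : 0 < S * V + 1 by rewrite ltr_pwDr// mulr_ge0// ltW.
pose tau := delta / (2 * (S * V + 1)).
have tau0 : 0 < tau by rewrite divr_gt0// mulr_gt0.
have [C [C0 HC]] := @flux_monotone R n p M tau p1 M0 tau0.
pose T := n%:R * (2 * Q * S1).
have T0 : 0 <= T by rewrite /T !mulr_ge0// ltW.
(* [A] collects the coefficients of eta, which bounds both |e - e'| and |v - v'|. The term with
   [tau] and the term [eta * A] each get half of delta. *)
pose A := C * Q * (S * V) + C * (T * V).
have A0 : 0 <= A by rewrite addr_ge0// mulr_ge0// mulr_ge0// ltW.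
pose eta := delta / (2 * (A + 1)).
have A1 : 0 < A + 1 by rewrite ltr_pwDr.
have eta0 : 0 < eta by rewrite divr_gt0// mulr_gt0.
exists eta => // e e' v v' e01 e01' ee' sv sv' Lv Lv' fe i1.
pose f x := v x - v' x.
pose B x := flux p e (grad v x) - flux p e' (grad v' x).
have Cf j : C1_along j Omega f by exact: (sub_C1_along oO sv sv').
have cz x : Omega x -> {for x, continuous zeta} by move=> _; have [] := Cz i0 x I.
have zS' x : Omega x -> 0 <= zeta x <= S by rewrite z0 (le_trans (ler_norm _) (zS x)).
have W := weighted_partial_le p1 e01 e01' L0 oO Or sv sv' Lv Lv' i1 HC (ltW tau0) C0 cz zS'.
rewrite (_ : \int[mu]_(x in Omega) _ = \int[mu]_(x in Omega) (zeta x * `|partial i1 f x|)); last first.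
  apply: eq_Rintegral => x; rewrite inE => Ox.
  by have := grad_sub oO sv sv' Ox => /rowP/(_ i1); rewrite !mxE => <-.
apply: le_trans W _; rewrite -/f -/V -/M -/Q -/(B _).
pose phi x := f x * zeta x.
have Cphi j := C1_along_mul oO (Cf j) (CzO j).
have phi0 x : ~ K x -> phi x = 0 by move=> /zK; rewrite /phi => ->; rewrite mulr0.
have ibp (a : R) w : 0 < a <= 1 -> stationary_solution p a Omega g w ->
    elipschitz_on Omega w L -> mu.-integrable Omega
     (EFin \o (fun x => \sum_i flux p a (grad w x) ord0 i * partial i phi x)) /\
    \int[mu]_(x in Omega) (\sum_i flux p a (grad w x) ord0 i * partial i phi x) = 0.
  move=> a01 sw Lw; have [a0 _] := andP a01; have [_ smw _ _ _] := sw.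
  split; last exact: flux_ibp a0 oO cK KO Or' sw phi0 (fun j => (Cphi j).1).
  rewrite (_ : (fun _ => _) = (fun x => dot (flux p a (grad w x)) (grad phi x))); last first.
    by apply/funext => x; apply: eq_bigr => j _; rewrite [grad _ _ _ _]mxE.
  apply: (@continuous_on_integrable _ _ _ _ (n%:R * (Q * (eta * S1 + S * (2 * M)))) r) => // x Ox.
    apply: dot_continuous => j; first by have [] := C1_along_flux p j a0 oO smw Ox.
    rewrite (_ : (fun _ => _) = partial j phi); last by apply/funext => y; rewrite mxE.
    by have [] := (Cphi j).1 x Ox.
  apply: norm_dot_le => // j.
    exact: (flux_bound j p1 a01 M0 (elipschitz_grad oO Lw smw (ltW L0) Ox)).
  rewrite mxE (Cphi j).2//; apply: le_trans (ler_normD _ _) _; rewrite !normrM.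
  apply: lerD; apply: ler_pM => //; [exact: fe|exact: (partial_sub_bound L0 oO sv sv' Lv Lv')].
have [int1 I1] := ibp e v e01 sv Lv.
have [int2 I2] := ibp e' v' e01' sv' Lv'.
have int3 : mu.-integrable Omega (EFin \o (fun x => f x * dot (B x) (grad zeta x))).
  apply: (@continuous_on_integrable _ _ _ _ (eta * T) r) => // x Ox.
    apply: continuous_at_mul; first by have [] := Cf i0 x Ox.
    apply: dot_continuous => j; first exact: (flux_diff_continuous e01 e01' oO sv sv' Ox).
    rewrite (_ : (fun _ => _) = partial j zeta); last by apply/funext => y; rewrite mxE.
    by have [] := Cz j x I.
  rewrite normrM ler_pM//; first exact: fe.
  apply: norm_dot_le => [|j|j]; first by rewrite mulr_ge0.
    exact: (flux_diff_bound p1 e01 e01' L0 oO sv sv' Lv Lv').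
  by rewrite mxE.
have I3 : \int[mu]_(x in Omega) (zeta x * dot (B x) (grad f x)) =
    - \int[mu]_(x in Omega) (f x * dot (B x) (grad zeta x)).
  have int12 : mu.-integrable Omega (EFin \o (fun x =>
      \sum_i flux p e (grad v x) ord0 i * partial i phi x -
      \sum_i flux p e' (grad v' x) ord0 i * partial i phi x)).
    by have := integrableB mO int1 int2; apply.
  have E0 : 0 = \int[mu]_(x in Omega) (\sum_i flux p e (grad v x) ord0 i * partial i phi x -
      \sum_i flux p e' (grad v' x) ord0 i * partial i phi x).
    by rewrite RintegralB// I1 I2 subrr.
  rewrite -[RHS]add0r E0 -RintegralB//; apply: eq_Rintegral => x; rewrite inE => Ox.
  rewrite -sumrB !mulr_sumr -sumrB; apply: eq_bigr => j _.
  have -> : B x ord0 j = flux p e (grad v x) ord0 j - flux p e' (grad v' x) ord0 j.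
    by rewrite mxE [X in _ + X]mxE.
  rewrite [grad f x ord0 j]mxE [grad zeta x ord0 j]mxE ((Cphi j).2 _ Ox).
  move: (flux p e _ _ _) (flux p e' _ _ _) (partial j f x) (partial j zeta x) (f x) (zeta x).
  by clear => a b c d h k; ring.
have I4 : \int[mu]_(x in Omega) (zeta x * dot (B x) (grad f x)) <= eta * T * V.
  rewrite I3 -(Rintegral_cst_Omega (eta * T) oO Or') -mulN1r -RintegralZl//.
  apply: le_Rintegral => //.
  - by have := integrableZl mO (- 1) int3; apply.
  - apply: (@continuous_on_integrable _ _ _ _ `|eta * T| r) => // x Ox; exact: cst_continuous.
  move=> x Ox; rewrite mulN1r; apply: le_trans (ler_norm _) _; rewrite normrN normrM.
  apply: ler_pM => //; first exact: fe.
  apply: norm_dot_le => [|j|j]; first by rewrite mulr_ge0.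
    exact: (flux_diff_bound p1 e01 e01' L0 oO sv sv' Lv Lv').
  by rewrite mxE.
have h1 : C * \int[mu]_(x in Omega) (zeta x * dot (B x) (grad f x)) <= C * (eta * T * V).
  by rewrite ler_wpM2l.
have h2 : C * Q * `|e - e'| * (S * V) <= C * Q * eta * (S * V).
  by rewrite ler_wpM2r ?(mulr_ge0 (ltW S0))// ler_wpM2l ?mulr_ge0// ltW.
have half (D : R) : 0 <= D -> delta / (2 * (D + 1)) * D <= delta / 2.
  move=> D0; have D1 : 0 < D + 1 by rewrite ltr_pwDr.
  rewrite invfM mulrA -(mulrA _ (D + 1)^-1) ler_piMr ?divr_ge0 ?(ltW delta0)//.
  by rewrite mulrC ler_pdivrMr// mul1r lerDl.
have h3 : tau * (S * V) <= delta / 2 by apply: half; rewrite mulr_ge0// ltW.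
have h4 : eta * A <= delta / 2 by exact: half.
have {}h4 : C * Q * eta * (S * V) + C * (eta * T * V) <= delta / 2.
  by apply: le_trans h4; rewrite le_eqVlt /A; apply/orP; left; apply/eqP; ring.
have h5 : (tau + C * Q * `|e - e'|) * S * V = tau * (S * V) + C * Q * `|e - e'| * (S * V).
  by ring.
rewrite h5; apply: le_trans (lerD (lerD h3 h2) h1) _; rewrite -addrA.
by apply: le_trans (lerD (lexx _) h4) _; rewrite -splitr.
Qed.

End bumps.

(** * Passage to the limit *)

Section uniform_limits.
Variable R : realType.

Lemma uniform_cvg_epsP (I : Type) (F : set_system I) (FF : Filter F) (T : choiceType)
    (A : set T) (f : I -> T -> R) (w : T -> R) :
  {uniform A, f @ F --> w} <->
  forall eps : R, 0 < eps -> \forall t \near F, forall x, A x -> `|w x - f t x| < eps.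
Proof.
split=> [H eps eps0|H].
  have : nbhs (w : {uniform` A -> R}) [set h | forall x, A x -> `|w x - h x| < eps].
    apply/uniform_nbhs; exists [set xy : R * R | ball xy.1 (PosNum eps0)%:num xy.2]; split => //.
    by exists eps.
  by move=> /H.
move=> P /uniform_nbhs[E [+ EP]]; rewrite -entourage_ballE => -[eps /= eps0 Eeps].
apply: filterS (H eps eps0) => t Ht; apply: EP => x Ax; apply: Eeps; exact: Ht.
Qed.

Lemma near_right0 (eta : R) : 0 < eta -> \forall e \near 0^'+, 0 < e < eta.
Proof.
move=> eta0; near=> e; apply/andP; split; near: e.
  exact: nbhs_right_gt.
exact: nbhs_right_lt.
Unshelve. all: by end_near. Qed.

Lemma uniform_cauchy_limit (T : Type) (A : set T) (v : R -> T -> R) :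
  (forall delta : R, 0 < delta -> exists2 eta : R, 0 < eta &
    forall e e' : R, 0 < e < eta -> 0 < e' < eta -> forall x, A x -> `|v e x - v e' x| <= delta) ->
  exists w, forall delta : R, 0 < delta -> exists2 eta : R, 0 < eta &
    forall e : R, 0 < e < eta -> forall x, A x -> `|w x - v e x| <= delta.
Proof.
move=> H; exists (fun x => lim (v e x @[e --> 0^'+])).
have cv x : A x -> v e x @[e --> 0^'+] --> lim (v e x @[e --> 0^'+]).
  move=> Ax; apply: cauchy_cvg; apply: cauchy_exP => eps eps0.
  have [eta eta0 Heta] := H (eps / 2) (divr_gt0 eps0 (ltr0Sn _ _)).
  exists (v (eta / 2) x); apply: filterS (near_right0 eta0) => e e0.
  rewrite /ball/=; apply: le_lt_trans (Heta _ _ _ e0 x Ax) _; last by lra.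
  by apply/andP; split; lra.
move=> delta delta0; have [eta eta0 Heta] := H delta delta0; exists eta => // e e0 x Ax.
rewrite distrC.
apply: (cvgr_to_le (cvg_norm (cvgB (cvg_cst (v e x)) (cv x Ax)))).
by apply: filterS (near_right0 eta0) => e' e'0; exact: Heta.
Qed.

End uniform_limits.

Section limit_tools.
Variables (R : realType) (n : nat).
Local Notation mu := (lebesgue_rV R n).
Implicit Types (Omega D : set 'rV[R]_n) (f v w : 'rV[R]_n -> R).

Lemma elipschitz_continuous_at Omega v (L : R) x : open Omega ->
  elipschitz_on Omega v L -> Omega x -> {for x, continuous v}.
Proof.
move=> oO Lv Ox; have : {within Omega, continuous v}.
  apply: (continuous_subspaceW (@subset_closure _ Omega)).
  exact: elipschitz_within_continuous Lv.
by rewrite continuous_open_subspace// => /(_ x); apply; rewrite inE.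
Qed.

Lemma bounded_Lp_on (p M : R) D f : 0 <= p -> measurable D -> (mu D < +oo)%E ->
  measurable_fun D f -> (forall x, D x -> `|f x| <= M) -> Lp_on p D f.
Proof.
move=> p0 mD Doo mf fM; split => //.
apply: (@le_lt_trans _ _ (\int[mu]_(x in D) (`|M| `^ p)%:E)%E).
  apply: ge0_le_integral => //.
  - apply/measurable_EFinP; apply: (measurableT_comp (f := @powR R ^~ p)).
      exact: measurable_powR.
    exact: measurableT_comp.
  - by move=> x Dx; rewrite lee_fin; apply: ge0_ler_powR; rewrite ?nnegrE//; exact: le_trans (fM x Dx) (ler_norm _).
by rewrite integral_cst// lte_mul_pinfty// lee_fin powR_ge0.
Qed.

Lemma enorm_sqr_cvg (xi_ : nat -> 'rV[R]_n) (xi : 'rV[R]_n) :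
  (forall i, xi_ k ord0 i @[k --> \oo] --> xi ord0 i) ->
  enorm (xi_ k) ^+ 2 @[k --> \oo] --> enorm xi ^+ 2.
Proof.
move=> cxi; under eq_fun do rewrite enorm_sqr; rewrite enorm_sqr /dot.
apply: (@cvg_big _ _ _ _ _ _ _ \oo) => // [|i _]; last by apply: cvgM; exact: cxi.
exact: add_continuous.
Qed.

(** At a nonzero limit the power is continuous. At [xi = 0] the factor in front may blow up when p <
    2, but the flux is bounded by s^((p-1)/2), which tends to 0 because p > 1; the limit expression
    is 0 there as well. *)
Lemma flux_cvg (p : R) (e_ : nat -> R) (xi_ : nat -> 'rV[R]_n) (xi : 'rV[R]_n) i :
  1 < p -> (forall k, 0 < e_ k) -> e_ @ \oo --> 0 ->
  (forall i, xi_ k ord0 i @[k --> \oo] --> xi ord0 i) ->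
  flux p (e_ k) (xi_ k) ord0 i @[k --> \oo] --> enorm xi `^ (p - 2) * xi ord0 i.
Proof.
move=> p1 e0 ce cxi.
pose s k := e_ k ^+ 2 + enorm (xi_ k) ^+ 2.
have s0 k : 0 < s k by rewrite ltr_pwDl ?exprn_gt0// exprn_ge0// enorm_ge0.
have cs : s @ \oo --> enorm xi ^+ 2.
  have ce2 : e_ k * e_ k @[k --> \oo] --> (0 * 0 : R) by exact: cvgM.
  rewrite mul0r in ce2; rewrite -[enorm xi ^+ 2]add0r.
  by apply: cvgD; [exact: ce2|exact: enorm_sqr_cvg].
have fluxE k : flux p (e_ k) (xi_ k) ord0 i = s k `^ (p / 2 - 1) * xi_ k ord0 i.
  by rewrite mxE.
under eq_fun do rewrite fluxE.
have [xi0|xi0] := eqVneq (enorm xi) 0; last first.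
  have sx0 : 0 < enorm xi ^+ 2 by rewrite exprn_gt0// lt_def xi0 enorm_ge0.
  have -> : enorm xi `^ (p - 2) = (enorm xi ^+ 2) `^ (p / 2 - 1).
    by rewrite -powR_mulrn ?enorm_ge0// -powRrM; congr (_ `^ _); field.
  apply: cvgM; last exact: cxi.
  by apply: (@continuous_cvg _ _ _ _ _ _ (fun t : R => t `^ (p / 2 - 1))) => //; exact: powR_continuous.
have -> : xi ord0 i = 0.
  by apply/eqP; rewrite -normr_le0 -xi0 coord_le_enorm.
rewrite mulr0; apply/cvgr0Pnorm_lt => eps eps0.
(* The exponent comes from s^(p/2 - 1) times |xi_k| <= s^(1/2); [a] is the threshold with
   [a ^ q = eps]. *)
pose q := (p - 1) / 2; have q0 : 0 < q by rewrite divr_gt0// subr_gt0.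
pose a := eps `^ q^-1; have a0 : 0 < a by rewrite powR_gt0.
have /cvgrPdist_lt/(_ a a0) := cs; apply: filterS => k.
rewrite xi0 expr0n sub0r normrN gtr0_norm// => sa.
apply: (@le_lt_trans _ _ (s k `^ q)).
  rewrite normrM (ger0_norm (powR_ge0 _ _)).
  apply: le_trans (_ : s k `^ (p / 2 - 1) * s k `^ 2^-1 <= _).
    rewrite ler_wpM2l ?powR_ge0// powR12_sqrt ?(ltW (s0 k))//.
    apply: le_trans (coord_le_enorm _ _) _;
    rewrite -(@ler_pXn2r _ 2) ?nnegrE ?enorm_ge0 ?sqrtr_ge0// [leRHS]sqr_sqrtr ?(ltW (s0 k))//.
    by rewrite /s lerDr sqr_ge0.
  rewrite -powRD; last by rewrite (gt_eqF (s0 k)) implybT.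
  by rewrite le_eqVlt; apply/orP; left; apply/eqP; congr (_ `^ _); rewrite /q; field.
have -> : eps = a `^ q by rewrite -powRrM mulVf ?gt_eqF// powRr1// ltW.
by rewrite gt0_ltr_powR// nnegrE ?ltW.
Qed.

(** The gap estimate is one-sided, so it is used twice with the roles exchanged; the cap 1 on eta
    meets its condition [e <= 1]. *)
Lemma stationary_uniform_cauchy (i0 : 'I_n) (p r L : R) Omega g (v : R -> 'rV[R]_n -> R) :
  1 < p -> open Omega -> (forall x, closure Omega x -> `|x| <= r) -> 0 < L ->
  (forall e, 0 < e -> stationary_solution p e Omega g (v e)) ->
  (forall e, 0 < e -> elipschitz_on Omega (v e) L) ->
  forall delta : R, 0 < delta -> exists2 eta : R, 0 < eta &
    forall e e' : R, 0 < e < eta -> 0 < e' < eta ->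
    forall x, closure Omega x -> `|v e x - v e' x| <= delta.
Proof.
move=> p1 oO Or L0 sv Lv delta delta0; have d0 : 0 < delta / 2 by rewrite divr_gt0.
have [eta eta0 H] := uniform_gap i0 g p1 oO Or L0 d0.
exists (Num.min eta 1); first by rewrite lt_min eta0 ltr01.
move=> e e'; rewrite !lt_min => /andP[e0 /andP[e1 e2]] /andP[e'0 /andP[e'1 e'2]] x cx.
have ee' : `|e - e'| < eta by rewrite ltr_norml; apply/andP; split; lra.
have e01 : 0 < e <= 1 by rewrite e0 ltW.
have e01' : 0 < e' <= 1 by rewrite e'0 ltW.
have h1 := H _ _ _ _ e01 e01' ee' (sv _ e0) (sv _ e'0) (Lv _ e0) (Lv _ e'0) x cx.
rewrite distrC in ee'.
have h2 := H _ _ _ _ e01' e01 ee' (sv _ e'0) (sv _ e0) (Lv _ e'0) (Lv _ e0) x cx.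
by rewrite ler_norml; apply/andP; split; lra.
Qed.

End limit_tools.

(** The operator is an empty sum, so [u] is constant in time. In dimension 0 boundary values carry
    no information, and this is how the limits for different [e] are identified. *)
Lemma classical_solution_dim0 (R : realType) (p e : R) (Omega : set 'rV[R]_0) g u x t :
  classical_solution p e Omega g u -> Omega x -> 0 <= t -> u x t = g x.
Proof.
move=> [cu du u0 _] Ox t0; rewrite -(u0 x Ox).
have [||s sI h] := @MVT_segment R (u x) (fun=> 0) 0 t t0.
- move=> s; rewrite in_itv/= => /andP[s0 _].
  have [ds _ _ _ us] := du x s Ox s0; apply: DeriveDef => //.
  by rewrite -derive1E us /reg_operator big_ord0.
- apply/within_continuous_epsP => s; rewrite /= in_itv/= => /andP[s0 _] eta eta0.
  have xs : (closure Omega `*` [set t | 0 <= t]) (x, s) by split => //; exact: subset_closure.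
  have /within_continuous_epsP/(_ (x, s) xs eta eta0)[d d0 Kd] := cu.
  exists d => // s'; rewrite /= in_itv/= => /andP[s'0 _] ss'.
  apply: (Kd (x, s')); first by split => //; exact: subset_closure.
  by rewrite prod_norm_lt /= subrr normr0 d0.
by move: h; rewrite mul0r => /eqP; rewrite subr_eq0 => /eqP.
Qed.

(** * The limit function and a sequence of converging gradients *)

Section stationary_limit.
Variables (R : realType) (n : nat) (p r L : R) (Omega : set 'rV[R]_n).
Variables (g w : 'rV[R]_n -> R) (v : R -> 'rV[R]_n -> R).
Local Notation mu := (lebesgue_rV R n).
Hypotheses (p1 : 1 < p) (oO : open Omega) (L0 : 0 < L).
Hypothesis Or : forall x, closure Omega x -> `|x| <= r.
Hypothesis sv : forall e, 0 < e -> stationary_solution p e Omega g (v e).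
Hypothesis Lv : forall e, 0 < e -> elipschitz_on Omega (v e) L.
Hypothesis vw : forall delta : R, 0 < delta -> exists2 eta : R, 0 < eta &
  forall e : R, 0 < e < eta -> forall x, closure Omega x -> `|w x - v e x| <= delta.

Let mO : measurable Omega. Proof. exact: open_measurable_rV. Qed.
Let Or' x : Omega x -> `|x| <= r. Proof. by move=> Ox; exact/Or/subset_closure. Qed.
Let Ooo : (mu Omega < +oo)%E. Proof. exact: lebesgue_rV_bounded_lty Or'. Qed.

Lemma limit_near delta : 0 < delta -> exists2 e : R, 0 < e &
  forall x, closure Omega x -> `|w x - v e x| <= delta.
Proof.
move=> /vw[eta eta0 H]; exists (eta / 2); first by rewrite divr_gt0.
by apply: H; rewrite divr_gt0//=; lra.
Qed.

Lemma limit_elipschitz : elipschitz_on Omega w L.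
Proof.
move=> x y cx cy; apply/ler_addgt0Pr => d d0.
have d2 : 0 < d / 2 by rewrite divr_gt0.
have [e e0 H] := limit_near d2; have := H x cx; have := H y cy; have := Lv e0 cx cy.
by rewrite !ler_norml => /andP[? ?] /andP[? ?] /andP[? ?]; apply/andP; split; lra.
Qed.

Lemma limit_boundary x : boundary Omega x -> w x = g x.
Proof.
move=> bx; apply/eqP; rewrite -subr_eq0 -normr_le0; apply/ler_addgt0Pr => d d0.
rewrite add0r; have [e e0 H] := limit_near d0; have := H x bx.1.
by have [_ _ _ _ ->] := sv e0.
Qed.

Lemma cutoffs_gap (Z : nat -> 'rV[R]_n -> R) N (delta : R) :
  (forall m, cutoff Omega (Z m)) -> 0 < delta ->
  exists2 eta : R, 0 < eta & forall m, (m < N)%N ->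
    forall e e' : R, 0 < e < eta -> 0 < e' < eta -> forall i,
    \int[mu]_(x in Omega) (Z m x * `|partial i (v e) x - partial i (v e') x|) <= delta.
Proof.
move=> cZ delta0; elim: N => [|N [a a0 IH]]; first by exists 1.
have [b b0 Hb] := grad_gap g p1 oO Or L0 delta0 (cZ N).
have [c c0 Hc] := vw (divr_gt0 b0 (ltr0Sn _ 1)).
exists (Num.min (Num.min a b) (Num.min c 1)); first by rewrite !lt_min a0 b0 c0 ltr01.
move=> m; rewrite ltnS leq_eqVlt => /orP[/eqP ->|mN] e e'; rewrite !lt_min
  => /andP[e0 /andP[/andP[ea eb] /andP[ec e1]]] /andP[e0' /andP[/andP[ea' eb'] /andP[ec' e1']]].
  apply: (Hb e e'); [| | |exact: sv|exact: sv|exact: Lv|exact: Lv|].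
  - by rewrite e0 ltW.
  - by rewrite e0' ltW.
  - by rewrite ltr_norml; apply/andP; split; lra.
  move=> x Ox; have cx := @subset_closure _ Omega x Ox.
  have := Hc e _ x cx; rewrite e0 => /(_ ec).
  have := Hc e' _ x cx; rewrite e0' => /(_ ec').
  by rewrite !ler_norml => /andP[? ?] /andP[? ?]; apply/andP; split; lra.
by apply: IH => //; rewrite ?e0 ?e0'.
Qed.

(** One sequence serves all cutoffs: at stage k the parameters are small enough for the cutoffs of
    index at most k, with error 2^-k. For a fixed cutoff the increments are then summable from some
    stage on. *)
Lemma gradient_sequence : exists (E : nat -> R) (Dw : 'rV[R]_n -> 'rV[R]_n),
  [/\ forall k, 0 < E k <= 1, E @ \oo --> 0,
      forall k x, closure Omega x -> `|w x - v (E k) x| <= 1,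
      forall i, measurable_fun Omega (fun x => Dw x ord0 i) /\
        forall x, `|Dw x ord0 i| <= L &
      {ae mu, forall x, Omega x -> forall i,
        partial i (v (E k)) x @[k --> \oo] --> Dw x ord0 i}].
Proof.
have [Z [cZ Zcov]] := cutoff_cover oO.
have [eta1 eta10 Heta1] := vw ltr01.
have half0 k : 0 < (2^-1 : R) ^+ k by rewrite exprn_gt0// invr_gt0.
have H k : exists eta : R, 0 < eta /\ forall m, (m <= k)%N ->
    forall e e' : R, 0 < e < eta -> 0 < e' < eta -> forall i,
    \int[mu]_(x in Omega) (Z m x * `|partial i (v e) x - partial i (v e') x|) <= 2^-1 ^+ k.
  by have [eta eta0 He] := @cutoffs_gap Z k.+1 (2^-1 ^+ k) cZ (half0 k); exists eta.
have {H}[eta Heta] := boolp.choice H.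
(* Halving makes the sequence strictly decreasing and below [eta k]; the bound 1 / (k + 1) sends it
   to 0. The index shift in [E] is needed because [A k.+1], not [A k], lies below [eta k]. *)
pose step k (a : R) := Num.min a (Num.min (eta k) k.+1%:R^-1) / 2.
pose A k := iteri k step (Num.min eta1 1).
pose E k := A k.+1.
have A0 k : 0 < A k.
  elim: k => [|k IH]; first by rewrite lt_min eta10 ltr01.
  by rewrite /A/= divr_gt0// !lt_min IH/= invr_gt0 ltr0n/= andbT; have [] := Heta k.
have AE k : [/\ A k.+1 < A k, A k.+1 < eta k & A k.+1 < k.+1%:R^-1].
  have [eta0 _] := Heta k; have k0 : 0 < k.+1%:R^-1 :> R by rewrite invr_gt0.
  have A1 : A k.+1 = Num.min (A k) (Num.min (eta k) k.+1%:R^-1) / 2 by [].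
  pose c := Num.min (A k) (Num.min (eta k) k.+1%:R^-1).
  have /and3P[h1 h2 h3] : [&& c <= A k, c <= eta k & c <= k.+1%:R^-1].
    by rewrite -!le_min.
  have h0 : A k.+1 < c.
    by rewrite A1 -/c ltr_pdivrMr// ltr_pMr ?ltr1n// /c !lt_min A0 eta0.
  by split; exact: lt_le_trans h0 _.
have Alt k : A k <= Num.min eta1 1.
  by elim: k => // k IH; have [h _ _] := AE k; exact: le_trans (ltW h) IH.
have E0 k : 0 < E k < eta1.
  rewrite A0/=; have [h _ _] := AE k; apply: (lt_le_trans h); apply: le_trans (Alt k) _.
  by rewrite ge_min lexx.
have E1 k : 0 < E k <= 1.
  by rewrite A0/=; apply: le_trans (Alt k.+1) _; rewrite ge_min lexx orbT.
have Elim : E @ \oo --> 0.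
  apply: (@squeeze_cvgr _ _ _ _ (fun=> 0) (@harmonic R)); last exact: cvg_harmonic.
    by apply: nearW => k; have [_ _ h] := AE k; rewrite (ltW (A0 _))/= ltW.
  exact: cvg_cst.
have smv k : smooth_on Omega (v (E k)) by have [] := sv (A0 k.+1).
have mG i k : measurable_fun Omega (partial i (v (E k))).
  by apply: continuous_on_measurable => // x Ox; exact: smooth_partial_continuous (smv k) Ox.
have GL i k x : Omega x -> `|partial i (v (E k)) x| <= L.
  move=> Ox; apply: (elipschitz_partial oO (Lv (A0 k.+1)) Ox).
  by have [_ /(_ i)[dv _]] := smv k 1; exact: dv.
have cv i : {ae mu, forall x, Omega x -> cvgn (fun k => partial i (v (E k)) x)}.
  (* The shift by [m] is there because cutoff number [m] is controlled from stage [m] on. *)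
  have : {ae mu, forall x m, Omega x -> 0 < Z m x ->
      cvgn (fun k => partial i (v (E (k + m)%N)) x)}.
    apply/ae_foralln => m; have [Zm0 CZ [K [_ KO ZK]]] := cZ m.
    have [S S0 ZS] := C1_vanish_bounded KO Or' ZK (CZ i).
    have cZm x : {for x, continuous (Z m)} by have [] := CZ i x I.
    apply: (@ae_cvg_summable _ _ _ mu Omega (fun k => partial i (v (E (k + m)%N))) (Z m)) => //.
      by apply: continuous_on_measurable => // x _; exact: cZm.
    move=> k; split.
      apply: (@continuous_on_integrable _ _ _ _ (S * (L + L)) r) => // x Ox.
        apply: continuous_at_mul; first exact: cZm.
        apply: (@continuous_comp _ _ _ (fun y => partial i (v (E (k + m)%N)) y -
          partial i (v (E (k.+1 + m)%N)) y) (@Num.norm _ _)); last exact: norm_continuous.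
        by apply: continuous_at_sub; exact: (smooth_partial_continuous (smv _) Ox).
      rewrite normrM ler_pM// normr_id; apply: le_trans (ler_normB _ _) _.
      by rewrite lerD// GL.
    apply: le_trans (_ : 2^-1 ^+ (k + m) <= _).
      have [e0 He] := Heta (k + m)%N; rewrite addSn.
      have [_ h _] := AE (k + m)%N; have [h' _ _] := AE (k + m).+1.
      apply: He; rewrite ?leq_addl ?A0//=; exact: lt_trans h' h.
    by rewrite ler_wiXn2l ?leq_addr// ?invr_ge0// invf_le1// ler1n.
  apply: filterS => x Hx Ox; have [m Zm] := Zcov x Ox.
  have /cvg_ex[l Hl] := Hx m Ox Zm; apply/cvg_ex; exists l.
  by rewrite -(cvg_shiftn m).
have HD i : exists h : 'rV[R]_n -> R, [/\ measurable_fun Omega h, forall x, `|h x| <= L &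
    {ae mu, forall x, Omega x -> partial i (v (E k)) x @[k --> \oo] --> h x}].
  have [h [mh hL Hh]] := measurable_pointwise_limit mO (ltW L0) (mG i) (GL i).
  by exists h; split => //; apply: filterS (cv i) => x cx Ox; apply: Hh => //; exact: cx.
have [h Hh] := boolp.choice HD.
exists E, (fun x => \row_i h i x); split => //.
- by move=> k x cx; exact: Heta1.
- move=> i; have [mh hL _] := Hh i; split; last by move=> x; rewrite mxE.
  by rewrite (_ : (fun _ => _) = h i)//; apply/funext => x; rewrite mxE.
have {}Hh i : {ae mu, forall x, Omega x -> partial i (v (E k)) x @[k --> \oo] --> h i x}.
  by have [] := Hh i.
have Hall : {ae mu, forall x (i : 'I_n), Omega x ->
    partial i (v (E k)) x @[k --> \oo] --> h i x}.
  refine (@filter_forall _ _ (fun i x => Omega x -> partial i (v (E k)) x @[k --> \oo] --> h i x) _ _ Hh).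
by apply: filterS Hall => x Hx Ox i; rewrite mxE; exact: Hx.
Qed.

End stationary_limit.

(** * Passage to the limit in the weak identities *)

Section sequence_limit.
Variables (R : realType) (n : nat) (p r L W : R) (Omega : set 'rV[R]_n).
Variables (g w : 'rV[R]_n -> R) (E : nat -> R) (vk : nat -> 'rV[R]_n -> R).
Variable Dw : 'rV[R]_n -> 'rV[R]_n.
Local Notation mu := (lebesgue_rV R n).
Hypotheses (p1 : 1 < p) (oO : open Omega) (L0 : 0 < L).
Hypothesis Or : forall x, Omega x -> `|x| <= r.
Hypotheses (E1 : forall k, 0 < E k <= 1) (E0 : E @ \oo --> 0).
Hypothesis sv : forall k, stationary_solution p (E k) Omega g (vk k).
Hypothesis Lv : forall k, elipschitz_on Omega (vk k) L.
Hypothesis Lw : elipschitz_on Omega w L.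
Hypothesis wW : forall x, Omega x -> `|w x| <= W.
Hypothesis vw : forall k x, Omega x -> `|w x - vk k x| <= 1.
Hypothesis cvw : forall x, Omega x -> vk k x @[k --> \oo] --> w x.
Hypothesis mDw : forall i, measurable_fun Omega (fun x => Dw x ord0 i) /\
  forall x, `|Dw x ord0 i| <= L.
Hypothesis cDw : {ae mu, forall x, Omega x -> forall i,
  partial i (vk k) x @[k --> \oo] --> Dw x ord0 i}.

Let mO : measurable Omega. Proof. exact: open_measurable_rV. Qed.
Let Ooo : (mu Omega < +oo)%E. Proof. exact: lebesgue_rV_bounded_lty Or. Qed.
Let smv k : smooth_on Omega (vk k). Proof. by case: (sv k). Qed.
Let Epos k : 0 < E k. Proof. by have /andP[] := E1 k. Qed.

Let partial_le k i x : Omega x -> `|partial i (vk k) x| <= L.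
Proof.
move=> Ox; apply: (elipschitz_partial oO (Lv k) Ox).
by have [_ /(_ i)[dv _]] := smv k 1; exact: dv.
Qed.

Let v_le k x : Omega x -> `|vk k x| <= W + 1.
Proof.
move=> Ox; have := wW Ox; have := vw k Ox.
by rewrite !ler_norml => /andP[? ?] /andP[? ?]; apply/andP; split; lra.
Qed.

Let cv k x : Omega x -> {for x, continuous (vk k)}.
Proof. exact: elipschitz_continuous_at oO (Lv k). Qed.

Let cdv k i x : Omega x -> {for x, continuous (partial i (vk k))}.
Proof. exact: smooth_partial_continuous (smv k). Qed.

Let mw : measurable_fun Omega w.
Proof. by apply: continuous_on_measurable => // x; exact: elipschitz_continuous_at oO Lw. Qed.

Section test.
Variables (phi : 'rV[R]_n -> R).
Hypothesis tphi : test_function Omega phi.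
Let K := closure [set x | phi x != 0].

Let cK : closed K. Proof. exact: closed_closure. Qed.

Let KO : K `<=` Omega. Proof. by case: tphi. Qed.

Let phi0 x : ~ K x -> phi x = 0.
Proof.
by move=> Kx; apply/eqP; apply: contrapT => /negP h; apply: Kx; exact: subset_closure.
Qed.

Let Cphi i : C1_along i setT phi.
Proof. by have [sphi _ _] := tphi; exact: Ck_C1_along (sphi 1). Qed.

Let CphiO i : C1_along i Omega phi.
Proof. by move=> x _; exact: Cphi. Qed.

(** The identity passes to the limit in the form that the derivative of [vk k * phi] has integral 0,
    with values and gradients bounded uniformly in k. *)
Lemma limit_weak_gradient i : \int[mu]_(x in Omega) (w x * partial i phi x) =
  - \int[mu]_(x in Omega) (Dw x ord0 i * phi x).
Proof.
have [S S0 phiS] := C1_vanish_bounded KO Or phi0 (@Cphi i); have [S1 S10 dphiS] := C1_vanish_partials_bounded cK KO Or phi0 Cphi.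
have [mD DL] := mDw i.
have cphi x : {for x, continuous phi} by have [] := @Cphi i x I.
have cdphi x : {for x, continuous (partial i phi)} by have [] := @Cphi i x I.
have mphi : measurable_fun Omega phi by apply: continuous_on_measurable => // x _; exact: cphi.
have mdphi : measurable_fun Omega (partial i phi).
  by apply: continuous_on_measurable => // x _; exact: cdphi.
pose F k x := vk k x * partial i phi x + partial i (vk k) x * phi x.
have IF k : \int[mu]_(x in Omega) F k x = 0.
  have Cv : C1_along i Omega (vk k) by exact: Ck_C1_along (smv k 1).
  have [CP dP] := C1_along_mul oO Cv (@CphiO i).
  have P0 x : ~ K x -> vk k x * phi x = 0 by move=> /phi0 ->; rewrite mulr0.
  have [<- _] := Rintegral_C1_along0 oO cK KO (fun x Kx => Or (KO Kx)) P0 CP.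
  rewrite -(@Rintegral_vanish _ _ _ _ Omega); last first.
    move=> x Ox; have Kx : ~ K x by move=> /KO.
    by have [] := partial_off_closed i cK P0 Kx.
  by apply: eq_Rintegral => x; rewrite inE => Ox; rewrite dP// /F (mulrC (phi x)).
have mF : measurable_fun Omega (fun x => w x * partial i phi x + Dw x ord0 i * phi x).
  by apply: measurable_funD; exact: measurable_funM.
have FL : \int[mu]_(x in Omega) F k x @[k --> \oo] -->
    \int[mu]_(x in Omega) (w x * partial i phi x + Dw x ord0 i * phi x).
  apply: (@bounded_convergence _ _ _ _ _ _ _ ((W + 1) * S1 + L * S)) => //.
  - move=> k; apply: continuous_on_measurable => // x Ox.
    apply: continuous_at_add; apply: continuous_at_mul => //; [exact: cv|exact: cdv].
  - apply: filterS cDw => x Hx Ox.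
    by apply: cvgD; apply: cvgM; [exact: cvw|exact: cvg_cst|exact: Hx|exact: cvg_cst].
  - move=> k x Ox; apply: le_trans (ler_normD _ _) _; rewrite !normrM.
    by apply: lerD; apply: ler_pM => //; [exact: v_le|exact: partial_le].
have I0 : \int[mu]_(x in Omega) (w x * partial i phi x + Dw x ord0 i * phi x) = 0.
  by rewrite -(cvg_lim _ FL)//; under eq_fun do rewrite IF; exact: lim_cst.
move: I0; rewrite RintegralD//.
- by move=> /eqP; rewrite addr_eq0 => /eqP.
- apply: (@bounded_integrable _ _ _ _ _ _ (W * S1)) => //; first exact: measurable_funM.
  by move=> x Ox; rewrite normrM ler_pM// wW.
- apply: (@bounded_integrable _ _ _ _ _ _ (L * S)) => //; first exact: measurable_funM.
  by move=> x Ox; rewrite normrM ler_pM.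
Qed.

(** [flux_cvg] gives convergence of the integrands almost everywhere, zeros of the limit gradient
    included, and [flux_bound] dominates them uniformly in k for every p > 1. *)
Lemma limit_p_harmonic : \int[mu]_(x in Omega)
  (enorm (Dw x) `^ (p - 2) * \sum_i Dw x ord0 i * partial i phi x) = 0.
Proof.
have [S1 S10 dphiS] := C1_vanish_partials_bounded cK KO Or phi0 Cphi.
have cdphi i x : {for x, continuous (partial i phi)} by have [] := @Cphi i x I.
pose F k x := \sum_i flux p (E k) (grad (vk k) x) ord0 i * partial i phi x.
have IF k : \int[mu]_(x in Omega) F k x = 0.
  exact: (flux_ibp (Epos k) oO cK KO Or (sv k) phi0 CphiO).
have M0 : 0 <= n%:R * L by rewrite mulr_ge0// ltW.
have FL : \int[mu]_(x in Omega) F k x @[k --> \oo] --> \int[mu]_(x in Omega)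
    (enorm (Dw x) `^ (p - 2) * \sum_i Dw x ord0 i * partial i phi x).
  apply: (@bounded_convergence _ _ _ _ _ _ _ (n%:R * ((n%:R * L + 1) `^ (p - 1) * S1))) => //.
  - move=> k; apply: continuous_on_measurable => // x Ox.
    apply: continuous_sum_ord => i; apply: continuous_at_mul; last exact: cdphi.
    by have [] := C1_along_flux p i (Epos k) oO (smv k) Ox.
  - apply: measurable_funM.
      apply: (measurableT_comp (f := @powR R ^~ (p - 2))); first exact: measurable_powR.
      apply: (measurableT_comp (f := @Num.sqrt R)).
        by apply: continuous_measurable_fun; exact: sqrt_continuous.
      apply: measurable_sum => i; apply: measurable_funX; exact: (mDw i).1.
    apply: measurable_sum => i; apply: measurable_funM; first exact: (mDw i).1.
    by apply: continuous_on_measurable => // x _; exact: cdphi.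
  - apply: filterS cDw => x Hx Ox; rewrite mulr_sumr.
    apply: (@cvg_big _ _ _ _ _ _ _ \oo) => // [|i _]; first exact: add_continuous.
    rewrite mulrA; apply: cvgM; last exact: cvg_cst.
    by apply: flux_cvg => // j; under eq_fun do rewrite mxE; exact: Hx.
  - move=> k x Ox.
    rewrite (_ : F k x = dot (flux p (E k) (grad (vk k) x)) (grad phi x)); last first.
      by apply: eq_bigr => j _; rewrite [grad phi x _ _]mxE.
    apply: norm_dot_le => [|i|i]; first exact: powR_ge0.
      apply: flux_bound => //; exact: (elipschitz_grad oO (Lv k) (smv k) (ltW L0) Ox).
    by rewrite mxE.
by rewrite -(cvg_lim _ FL)//; under eq_fun do rewrite IF; exact: lim_cst.
Qed.

End test.

Lemma limit_W1p : W1p p Omega w Dw.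
Proof.
have p0 : 0 <= p by rewrite (le_trans ler01)// ltW.
split; first exact: bounded_Lp_on wW.
  by move=> i; have [mD DL] := mDw i; apply: (bounded_Lp_on (M := L)).
by move=> phi i tphi; exact: limit_weak_gradient.
Qed.

Lemma limit_W1p_loc : W1p_loc p Omega w Dw.
Proof.
have [[mw' _] _ wD] := limit_W1p.
have p0 : 0 <= p by rewrite (le_trans ler01)// ltW.
have H (f : 'rV[R]_n -> R) (M : R) : measurable_fun Omega f -> (forall x, Omega x -> `|f x| <= M) -> Lp_loc p Omega f.
  move=> mf fM K cK KO.
  have mK : measurable K by apply: closed_measurable_rV; exact: compact_closed.
  apply: (bounded_Lp_on (M := M)) => //.
  - by apply: le_lt_trans Ooo; apply: le_measure; rewrite ?inE.
  - exact: measurable_funS mf.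
  - by move=> x /KO; exact: fM.
split => //; first exact: H wW.
by move=> i; have [mD DL] := mDw i; apply: (H _ L).
Qed.

End sequence_limit.

Theorem theorem7p4 (R : realType) (n : nat) (p : R) (Omega : set 'rV[R]_n)
    (g : 'rV[R]_n -> R) (u : R -> 'rV[R]_n -> R -> R)
    (v : R -> 'rV[R]_n -> R)
    (hp : 1 < p)
    (hOmega : smooth_convex_domain Omega)
    (hcurv : mean_curvature_bounded_below Omega)
    (hg : Ck_closure 2 Omega g)
    (hu : forall e, 0 < e -> classical_solution p e Omega g (u e))
    (huv : forall e, 0 < e ->
       {uniform closure Omega, (fun t x => u e x t) @ +oo --> v e})
    (hv : forall e, 0 < e -> stationary_solution p e Omega g (v e)) :
  exists w : 'rV[R]_n -> R,
    [/\ {uniform closure Omega, v @ 0^'+ --> w},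
        exists Dw, W1p p Omega w Dw,
        p_harmonic p Omega w,
        {within closure Omega, continuous w} /\
        (forall x, boundary Omega x -> w x = g x) &
        forall x, closure Omega x ->
          lim (u e x t @[t --> +oo]) @[e --> 0^'+] --> w x].
Proof.
have [L L0 HL] := uniform_lipschitz hp hOmega hg.
have Lv e : 0 < e -> elipschitz_on Omega (v e) L by move=> e0; exact: HL e0 (hv e e0).
have [oO [x0 Ox0] bO _ _] := hOmega.
have [r r0 Or] := bounded_closure bO.
have cuv e x : 0 < e -> closure Omega x -> u e x t @[t --> +oo] --> v e x.
  move=> e0 cx; apply/cvgrPdist_lt => eps eps0.
  have /uniform_cvg_epsP/(_ eps eps0) := huv e e0.
  by apply: filterS => t; apply.
have UC : forall delta : R, 0 < delta -> exists2 eta : R, 0 < eta &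
    forall e e' : R, 0 < e < eta -> 0 < e' < eta ->
    forall x, closure Omega x -> `|v e x - v e' x| <= delta.
  (* A coordinate is needed for the Poincare inequality. Without one, Omega is a single point and
     each [v e] is the limit of a function constant in time with value [g]. *)
  have [[i0 _]|noi] := pselect (exists i : 'I_n, True).
    exact: (stationary_uniform_cauchy i0 hp oO Or L0 hv Lv).
  move=> delta delta0; exists 1 => // e e' /andP[e0 _] /andP[e'0 _] x cx.
  have n0 : n = 0%N.
    by apply/eqP; rewrite -leqn0 leqNgt; apply/negP => n0; apply: noi; exists (Ordinal n0).
  subst n; have Ox : Omega x by have -> : x = x0 by apply/rowP => -[].
  have vg a : 0 < a -> v a x = g x.
    move=> a0; rewrite -(cvg_lim _ (cuv a x a0 cx))//; apply: cvg_lim => //.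
    apply: cvg_near_cst; near=> t; apply: (classical_solution_dim0 (hu a a0) Ox).
    by near: t; exact: nbhs_pinfty_ge.
  by rewrite !vg// subrr normr0 ltW.
have [w Hw] := uniform_cauchy_limit UC.
have Lw := limit_elipschitz Lv Hw.
have cw := elipschitz_within_continuous Lw.
have [W W0 wW] := compact_bound_fun (compact_closure bO) cw.
have vw0 x : closure Omega x -> v e x @[e --> 0^'+] --> w x.
  move=> cx; apply/cvgrPdist_le => eps eps0; have [eta eta0 H] := Hw eps eps0.
  by apply: filterS (near_right0 eta0) => e /H; apply.
have [E [Dw [E1 E0 vw mDw cDw]]] := gradient_sequence hp oO L0 Or hv Lv Hw.
have Epos k : 0 < E k by have /andP[] := E1 k.
have cvw x : Omega x -> v (E k) x @[k --> \oo] --> w x.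
  move=> Ox; have cx := @subset_closure _ Omega x Ox.
  apply/cvgrPdist_le => eps eps0; have [eta eta0 H] := Hw eps eps0.
  have /cvgr0Pnorm_lt/(_ eta eta0) := E0; apply: filterS => k.
  by rewrite gtr0_norm// => Ek; apply: H => //; rewrite Epos.
have Or' x : Omega x -> `|x| <= r by move=> Ox; exact/Or/subset_closure.
have wW' x : Omega x -> `|w x| <= W by move=> Ox; exact/wW/subset_closure.
have vw' k x : Omega x -> `|w x - v (E k) x| <= 1 by move=> Ox; exact/vw/subset_closure.
have svE k := hv _ (Epos k); have LvE k := Lv _ (Epos k).
exists w; split.
- apply/uniform_cvg_epsP => eps eps0.
  have [eta eta0 H] := Hw _ (divr_gt0 eps0 (ltr0Sn _ 1)).
  apply: filterS (near_right0 eta0) => e e0 x cx; apply: le_lt_trans (H e e0 x cx) _.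
  by lra.
- exists Dw; exact: (limit_W1p hp oO Or' svE LvE Lw wW' vw' cvw mDw cDw).
- exists Dw; first exact: (limit_W1p_loc hp oO Or' svE LvE Lw wW' vw' cvw mDw cDw).
  exact: (limit_p_harmonic hp oO L0 Or' E1 E0 svE LvE mDw cDw).
- by split=> // x; exact: limit_boundary hv Hw _.
(* For [e > 0] the inner limit equals [v e x] by uniqueness of limits, so the two families agree to
   the right of 0. *)
move=> x cx; apply: cvg_trans (vw0 x cx); apply: near_eq_cvg.
apply: filterS (near_right0 ltr01) => e /andP[e0 _].
by apply/esym/cvg_lim => //; exact: cuv.
Unshelve. all: by end_near. Qed.
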